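(* Let $\mathcal F=\mathcal F^{(\hat x,k_0)}:L^2(0,\tau_w)\to L^2(0,\tau_w)$ be the far-field correlation operator and $\mathcal L:L^2(D\times[t_1,t_2])\to L^2(0,\tau_w)$ the operator $$(\mathcal L u)(\tau)=\int_{t_1}^{t_2}\int_D e^{-\mathrm i\tau(\hat x\cdot y-t)}u(y,t)\,\mathrm dy\,\mathrm dt,\qquad \tau\in(0,\tau_w),$$ for $u\in L^2(D\times[t_1,t_2])$, and let $\mathcal T:L^2(D\times[t_1,t_2])\to L^2(D\times[t_1,t_2])$ be the multiplication operator $$(\mathcal T\psi)(y,t)=\Big(\int_{t_1}^{t_2}F(t-s)K(y,t)K(y,s)\,e^{\mathrm i((k_0+\tau_c)t-k_0s)}\,\mathrm ds\Big)e^{-\mathrm i\tau_c\hat x\cdot y}\,\psi(y,t).$$ Then $\mathcal F=\mathcal L\mathcal T\mathcal L^*$. Furthermore, $\mathcal L$ is compact and has dense range in $L^2(0,\tau_w)$.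
   Context: All $L^2$ spaces are complex. Let $d\in\{2,3\}$, let $D\subset\mathbb R^d$ be a bounded Lipschitz domain with $\mathbb R^d\setminus D$ connected, $0<t_1<t_2<\infty$, $\hat x\in\mathbb S^{d-1}$ (the unit sphere of $\mathbb R^d$), and $k_0>0$. Let $\tau_{\min}<\tau_{\max}$ be real, $\tau_c=(\tau_{\min}+\tau_{\max})/2$ and $\tau_w=(\tau_{\max}-\tau_{\min})/2$. $F$ is a real-valued function on $\mathbb R$ (a temporal correlation function) and $K$ is a real-valued function with compact support $D\times[t_1,t_2]$. Both are measurable and such that $(y,t)\mapsto\int_{t_1}^{t_2}|F(t-s)K(y,t)K(y,s)|\,\mathrm ds$ is essentially bounded on $D\times[t_1,t_2]$. The covariance data are $$C(\hat x,\tau,k)=\int_D\int_{t_1}^{t_2}\int_{t_1}^{t_2}F(t-s)K(y,t)K(y,s)\,e^{\mathrm i(k+\tau)t}e^{-\mathrm iks}\,\mathrm dt\,\mathrm ds\;e^{-\mathrm i\tau\hat x\cdot y}\,\mathrm dy .$$ (This is $\mathbb E[u^\infty(\hat x,\tau+k)\overline{u^\infty(\hat x,k)}]$ for the far-field pattern $u^\infty(\hat x,k)=\int_De^{-\mathrm ik\hat x\cdot y}\int_{t_1}^{t_2}S(y,t)e^{\mathrm ikt}\,\mathrm dt\,\mathrm dy$ of a mean-zero random source $S$ with covariance $F(t-s)K(x,t)K(x,s)\delta(x-y)$.) The far-field correlation operator is $$(\mathcal F\phi)(\tau)=\int_0^{\tau_w}C(\hat x,\tau_c+\tau-\gamma,k_0)\,\phi(\gamma)\,\mathrm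 d\gamma,\qquad \tau\in(0,\tau_w).$$ *)

(* Defs.v *)
From HB Require Import structures.
From mathcomp Require Import all_boot all_order all_algebra.
From mathcomp Require Import complex.
From mathcomp Require Import all_classical all_reals all_analysis.
From mathcomp Require Import measurable_realfun lebesgue_Rintegral.

Set Implicit Arguments.
Unset Strict Implicit.
Unset Printing Implicit Defensive.
Import Order.TTheory GRing.Theory Num.Theory.
Import numFieldNormedType.Exports.
Local Open Scope classical_set_scope.
Local Open Scope ring_scope.

Definition cmod {R : realType} {T : Type} (f : T -> R[i]) : T -> R :=
  fun x => Normc.normc (f x).

Definition cmeasurable_fun {d} {T : measurableType d} {R : realType}
    (A : set T) (f : T -> R[i]) : Prop :=
  measurable_fun A (fun x => complex.Re (f x)) /\
  measurable_fun A (fun x => complex.Im (f x)).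

Definition cintegral {d} {T : measurableType d} {R : realType}
    (mu : {measure set T -> \bar R}) (A : set T) (f : T -> R[i]) : R[i] :=
  Complex (\int[mu]_(x in A) complex.Re (f x))
          (\int[mu]_(x in A) complex.Im (f x)).

Notation "\cint [ mu ]_ ( x 'in' A ) f" := (cintegral mu A (fun x => f))
  (at level 36, mu at level 10, x at level 10, A at level 60, f at level 36,
   format "\cint [ mu ]_ ( x  'in'  A )  f") : ring_scope.

Section Lfun2c.
Context d (T : measurableType d) (R : realType).
Variable mu : {measure set T -> \bar R}.
Implicit Types f g : T -> R[i].

Definition in_L2 f : Prop := cmeasurable_fun setT f /\ finite_norm mu 2%:E (cmod f).

Lemma measurable_cmod f : cmeasurable_fun setT f -> measurable_fun setT (cmod f).
Proof.
move=> [mr mi].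
have -> : cmod f =
    fun x => Num.sqrt (complex.Re (f x) ^+ 2 + complex.Im (f x) ^+ 2).
  by apply/funext => x; rewrite /cmod; case: (f x).
apply: (measurableT_comp (continuous_measurable_fun (@sqrt_continuous R))) => //.
by apply: measurable_funD; apply: measurable_funX.
Qed.

Lemma cmeasurable_fun_lin a f g : cmeasurable_fun setT f -> cmeasurable_fun setT g ->
  cmeasurable_fun setT (fun x => a * f x + g x).
Proof.
move=> [fr fi] [gr gi]; case: a => a b; split.
- rewrite (_ : (fun x => _) = fun x => (a * complex.Re (f x) - b * complex.Im (f x)) + complex.Re (g x)).
    apply: measurable_funD => //; apply: measurable_funB; exact: measurable_funM.
  by apply/funext => x; case: (f x) => ? ?; case: (g x).
- rewrite (_ : (fun x => _) = fun x => (a * complex.Im (f x) + b * complex.Re (f x)) + complex.Im (g x)).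
    apply: measurable_funD => //; apply: measurable_funD; exact: measurable_funM.
  by apply/funext => x; case: (f x) => ? ?; case: (g x).
Qed.

Definition Lfun2c : {pred T -> R[i]} := [pred f | `[< in_L2 f >]].

Lemma Lfun2cP f : reflect (in_L2 f) (f \in Lfun2c).
Proof. exact: asboolP. Qed.

Let N f := 'N[mu]_2%:E[EFin \o cmod f]%E.

Lemma le_Lnorm2 (u v : T -> R) : measurable_fun setT u -> measurable_fun setT v ->
  (forall x, `|u x| <= `|v x|) ->
  ('N[mu]_2%:E[EFin \o u] <= 'N[mu]_2%:E[EFin \o v])%E.
Proof.
move=> mu_ mv uv; rewrite unlock /Lnorm.
apply: gt0_ler_poweR; rewrite ?invr_ge0 ?ler0n//.
- by rewrite in_itv/= leey andbT integral_ge0// => x _; exact: poweR_ge0.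
- by rewrite in_itv/= leey andbT integral_ge0// => x _; exact: poweR_ge0.
apply: ge0_le_integral => //.
- by move=> x _; exact: poweR_ge0.
- apply: (measurableT_comp (measurable_poweR _)).
  by apply: measurableT_comp => //; exact/measurable_EFinP.
- apply: (measurableT_comp (measurable_poweR _)).
  by apply: measurableT_comp => //; exact/measurable_EFinP.
- by move=> x _; rewrite /= lee_fin ge0_ler_powR// nnegrE.
Qed.

Lemma normc_ge0 (z : R[i]) : 0 <= Normc.normc z.
Proof. by case: z => a b; exact: sqrtr_ge0. Qed.

Lemma Lnorm2cD f g : cmeasurable_fun setT f -> cmeasurable_fun setT g ->
  (N (f + g)%R <= N f + N g)%E.
Proof.
move=> mf mg.
have mfg : cmeasurable_fun setT (f + g).
  have -> : f + g = fun x => 1 * f x + g x by apply/funext => x; rewrite mul1r.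
  exact: cmeasurable_fun_lin.
have h1 : (N (f + g)%R <= 'N[mu]_2%:E[EFin \o (cmod f \+ cmod g)%R])%E.
  apply: le_Lnorm2.
  - exact: measurable_cmod.
  - by apply: measurable_funD; exact: measurable_cmod.
  - move=> x; rewrite /cmod !ger0_norm ?addr_ge0 ?normc_ge0//.
    exact: le_normcD.
apply: (le_trans h1).
by apply: eminkowski; rewrite ?lee1n//; exact: measurable_cmod.
Qed.

Lemma Lnorm2cZ a f : cmeasurable_fun setT f ->
  (N (a *: f)%R = (Normc.normc a)%:E * N f)%E.
Proof.
move=> mf; rewrite /N unlock /Lnorm.
have fE x : (`|(EFin \o cmod (a *: f)%R) x| `^ 2 =
     (Normc.normc a `^ 2)%:E * (`|(EFin \o cmod f) x| `^ 2))%E.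
  rewrite /= -EFinM; congr (_%:E).
  by rewrite /cmod -[(a *: f) x]/(a * f x) Normc.normcM normrM powRM// (ger0_norm (normc_ge0 a)).
under eq_integral do rewrite fE.
rewrite ge0_integralZl//.
- have i0 : (0 <= \int[mu]_x (`|(EFin \o cmod f) x| `^ 2))%E.
    by apply: integral_ge0 => x _; exact: poweR_ge0.
  by rewrite poweRM ?lee_fin ?powR_ge0// poweR_EFin -powRrM mulfV// powRr1// normc_ge0.
- apply: (measurableT_comp (measurable_poweR _)).
  by apply: measurableT_comp => //; apply/measurable_EFinP; exact: measurable_cmod.
- by move=> x _; exact: poweR_ge0.
- by rewrite lee_fin powR_ge0.
Qed.

Lemma in_L2_lin (a : R[i]) f g : in_L2 f -> in_L2 g -> in_L2 (a *: f + g).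
Proof.
move=> [mf nf] [mg ng]; split; first exact: cmeasurable_fun_lin.
have maf : cmeasurable_fun setT (a *: f).
  have -> : a *: f = fun x => a * f x + (fun=> 0) x by apply/funext => x; rewrite addr0.
  by apply: cmeasurable_fun_lin => //; split; exact: measurable_cst.
apply: (le_lt_trans (Lnorm2cD maf mg)); rewrite lte_add_pinfty// -/(N _) Lnorm2cZ//.
by rewrite lte_mul_pinfty// ?lee_fin ?normc_ge0.
Qed.

Lemma in_L2_0 : in_L2 0.
Proof.
split; first by split; exact: measurable_cst.
rewrite /finite_norm (_ : EFin \o _ = cst 0%E); last first.
  by apply/funext => x; rewrite /= /cmod Normc.normc0.
by rewrite Lnorm0.
Qed.

Lemma Lfun2c_submod_closed : submod_closed Lfun2c.
Proof.
split; first by apply/Lfun2cP; exact: in_L2_0.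
by move=> a f g /Lfun2cP fL /Lfun2cP gL; apply/Lfun2cP; exact: in_L2_lin.
Qed.

HB.instance Definition _ := GRing.isSubmodClosed.Build R[i] (T -> R[i]) Lfun2c
  Lfun2c_submod_closed.

Record L2fun := MkL2fun { L2fun_val :> T -> R[i] ; _ : L2fun_val \in Lfun2c }.

HB.instance Definition _ := [isSub for L2fun_val].
HB.instance Definition _ := [Choice of L2fun by <:].
HB.instance Definition _ := [SubChoice_isSubLmodule of L2fun by <:].

(* functions vanishing almost everywhere; L2 is the quotient by them *)
Definition ae0 : {pred L2fun} := [pred f : L2fun | `[< \forall x \ae mu, f x = 0 >]].

Lemma ae0_zmod_closed : zmod_closed ae0.
Proof.
split; first by apply/asboolP; exact: aeW.
move=> f g /asboolP f0 /asboolP g0; apply/asboolP.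
by apply: filterS2 f0 g0 => x fx gx; change (f x - g x = 0); rewrite fx gx subr0.
Qed.

HB.instance Definition _ := GRing.isZmodClosed.Build L2fun ae0 ae0_zmod_closed.

Definition L2 : Type := Quotient.quot ae0.
HB.instance Definition _ := Choice.on L2.
HB.instance Definition _ := GRing.Zmodule.on L2.
HB.instance Definition _ := EqQuotient.on L2.

Local Open Scope quotient_scope.

Lemma L2_eqP (f g : L2fun) :
  \pi_L2 f = \pi_L2 g <-> \forall x \ae mu, f x = g x.
Proof.
rewrite (rwP eqP) -Quotient.idealrBE; split => [/asboolP fg|fg].
  by apply: filterS fg => x; change (f x - g x = 0 -> f x = g x); move/subr0_eq.
by apply/asboolP; apply: filterS fg => x fgx; change (f x - g x = 0); rewrite fgx subrr.
Qed.

Lemma repr_piE (f : L2fun) : \forall x \ae mu, (repr (\pi_L2 f) : L2fun) x = f x.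
Proof. by apply/L2_eqP; rewrite reprK. Qed.

Definition L2_scale (a : R[i]) (u : L2) : L2 := \pi_L2 (a *: repr u).

Lemma L2_scale_pi a (f : L2fun) : L2_scale a (\pi_L2 f) = \pi_L2 (a *: f).
Proof.
apply/L2_eqP; apply: filterS (repr_piE f) => x fx.
by change (a * (repr (\pi_L2 f) : L2fun) x = a * f x); rewrite fx.
Qed.

Lemma L2_addE (f g : L2fun) : \pi_L2 (f + g) = \pi_L2 f + \pi_L2 g.
Proof. exact: (@Quotient.pi_add _ ae0). Qed.

Fact L2_scalerA a b u : L2_scale a (L2_scale b u) = L2_scale (a * b) u.
Proof. by elim/quotW: u => f; rewrite (L2_scale_pi b) !L2_scale_pi scalerA. Qed.
Fact L2_scale1r : left_id 1 L2_scale.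
Proof. by elim/quotW => f; rewrite L2_scale_pi scale1r. Qed.
Fact L2_scalerDr : right_distributive L2_scale +%R.
Proof.
by move=> a; elim/quotW => f; elim/quotW => g; rewrite -L2_addE !L2_scale_pi scalerDr L2_addE.
Qed.
Fact L2_scalerDl u : {morph L2_scale^~ u : a b / a + b}.
Proof. by elim/quotW: u => f a b; rewrite !L2_scale_pi scalerDl L2_addE. Qed.

HB.instance Definition _ := GRing.Zmodule_isLmodule.Build R[i] L2
  L2_scalerA L2_scale1r L2_scalerDr L2_scalerDl.

(* valued in R[i], as the norm of a normedModType R[i] must be *)
Definition L2_norm (u : L2) : R[i] := (fine (N (repr u)))%:C%C.

Lemma L2fun_Lnorm_fin (f : L2fun) : (fine (N f))%:E = N f.
Proof.
rewrite fineK// ge0_fin_numE ?Lnorm_ge0//.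
by case: f => f /= /Lfun2cP[].
Qed.

Lemma L2fun_meas (f : L2fun) : cmeasurable_fun setT f.
Proof. by case: f => f /= /Lfun2cP[]. Qed.

Lemma ae_eq_Lnorm2 (f g : L2fun) : (\forall x \ae mu, f x = g x) -> N f = N g.
Proof.
have mpow (h : L2fun) : measurable_fun setT (fun x => `|(EFin \o cmod h) x| `^ 2)%E.
  apply: (measurableT_comp (measurable_poweR _)).
  by apply: measurableT_comp => //; apply/measurable_EFinP; exact/measurable_cmod/L2fun_meas.
move=> fg; rewrite /N unlock /Lnorm; congr (_ `^ _)%E.
apply: ae_eq_integral => //.
by apply: filterS fg => x fgx _; rewrite /= /cmod fgx.
Qed.

Lemma L2_normE (f : L2fun) : L2_norm (\pi_L2 f) = (fine (N f))%:C%C.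
Proof. by rewrite /L2_norm (ae_eq_Lnorm2 (repr_piE f)). Qed.

Fact L2_ler_normD u v : L2_norm (u + v) <= L2_norm u + L2_norm v.
Proof.
elim/quotW: u => f; elim/quotW: v => g.
have : fine (N (f + g : L2fun)) <= fine (N f) + fine (N g).
  rewrite -lee_fin EFinD !L2fun_Lnorm_fin.
  exact: (Lnorm2cD (L2fun_meas f) (L2fun_meas g)).
by rewrite -L2_addE !L2_normE -lecR rmorphD.
Qed.

Fact L2_normrZ a u : L2_norm (a *: u) = `|a| * L2_norm u.
Proof.
elim/quotW: u => f.
change (L2_norm (L2_scale a (\pi_L2 f)) = `|a| * L2_norm (\pi_L2 f)).
rewrite L2_scale_pi !L2_normE.
have := Lnorm2cZ a (L2fun_meas f); rewrite -(L2fun_Lnorm_fin f) => h.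
have -> : fine (N (a *: f)) = Normc.normc a * fine (N f).
  by apply: EFin_inj; rewrite L2fun_Lnorm_fin EFinM.
by rewrite rmorphM.
Qed.

Fact L2_normr0_eq0 u : L2_norm u = 0 -> u = 0.
Proof.
elim/quotW: u => f; rewrite L2_normE => -[] n0.
have := L2fun_Lnorm_fin f; rewrite n0 => /esym.
have -> : 0 = \pi_L2 0 by apply: (addrI (\pi_L2 0)); rewrite addr0 -L2_addE addr0.
move/Lnorm_eq0_eq0 => f0; apply/L2_eqP.
have /f0 : measurable_fun setT (EFin \o cmod f).
  by apply/measurable_EFinP; exact/measurable_cmod/L2fun_meas.
move=> /(_ ltac:(by [])); apply: filterS => x /(_ I) [] /Normc.eq0_normc.
by [].
Qed.

HB.instance Definition _ := Lmodule_isNormed.Build R[i] L2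
  L2_ler_normD L2_normrZ L2_normr0_eq0.

Definition L2_fun (u : L2) : T -> R[i] := (repr u : L2fun).

(* [0] when [f] is not square integrable; [L2_well_defined] below excludes this
   case for the operators defined from [L2_class] *)
Definition L2_class (f : T -> R[i]) : L2 := \pi_L2 (insubd (0 : L2fun) f).

Definition L2_inner (u v : L2) : R[i] :=
  \cint[mu]_(x in setT) (L2_fun u x * (L2_fun v x)^*%C).

End Lfun2c.
Arguments L2_class {d T R} mu f.

(* Borel sigma-algebra of R^n *)
HB.instance Definition _ (R : realType) (n : nat) :=
  Measurable.copy 'rV[R]_n (g_sigma_algebraType (@open 'rV[R]_n)).

Lemma product_sigma_finite d1 d2 (T1 : measurableType d1) (T2 : measurableType d2)
    (R : realType) (m1 : {sigma_finite_measure set T1 -> \bar R})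
    (m2 : {sigma_finite_measure set T2 -> \bar R}) :
  sigma_finite setT (m1 \x m2)%E.
Proof.
have /sigma_finiteP[F [TF ndF Foo]] := sigma_finiteT m1.
have /sigma_finiteP[G [TG ndG Goo]] := sigma_finiteT m2.
exists (fun n => F n `*` G n).
  apply/seteqP; split => // -[x y] _.
  have : [set: T1] x by []. rewrite TF => -[n _ Fnx].
  have : [set: T2] y by []. rewrite TG => -[k _ Gky].
  exists (maxn n k) => //; split.
  - by move: x Fnx; exact/subsetPset/ndF/leq_maxl.
  - by move: y Gky; exact/subsetPset/ndG/leq_maxr.
move=> k; have [? ?] := Foo k; have [? ?] := Goo k.
split; first exact: measurableX.
by rewrite product_measure1E// lte_mul_pinfty// ge0_fin_numE.
Qed.

Section lebesgue_rV.
Context {R : realType}.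

Lemma open_measurable_rV n (U : set 'rV[R]_n) : open U -> measurable U.
Proof. exact: sub_sigma_algebra. Qed.

Lemma measurable_fun_rV d (T : measurableType d) n (f : T -> 'rV[R]_n) :
  (forall i, measurable_fun setT (fun x => f x ord0 i)) -> measurable_fun setT f.
Proof.
move=> mf; apply: (@measurability _ _ _ _ _ _ (@open 'rV[R]_n)) => // _ [U oU <-].
rewrite setTI.
pose box (p : 'rV[rat]_n * nat) : set 'rV[R]_n :=
  [set v | forall i, `|ratr (p.1 ord0 i) - v ord0 i| < p.2.+1%:R^-1].
have mbox p : measurable (f @^-1` box p).
  rewrite (_ : _ @^-1` _ = \bigcap_(i in [set: 'I_n])
      (fun x => f x ord0 i) @^-1` ball (ratr (p.1 ord0 i) : R) p.2.+1%:R^-1); last first.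
    by apply/seteqP; split => [x h i _|x h i]; [exact: h|exact: (h i Logic.I)].
  apply: fin_bigcap_measurable => // i _.
  rewrite -[X in measurable X]setTI; apply: mf => //.
  exact: measurable_ball.
rewrite (_ : f @^-1` U = \bigcup_(p : 'rV[rat]_n * nat)
    (f @^-1` (if pselect (box p `<=` U) then box p else set0))); last first.
  apply/seteqP; split => x /=.
  - move=> Ux.
    have /nbhs_ballP[e /= e0 eU] : nbhs (f x) U by exact: open_nbhs_nbhs.
    have [k ke] : exists k : nat, (k.+1%:R^-1 : R) < e / 2.
      have e20 : 0 < e / 2 by rewrite divr_gt0.
      have := near_infty_natSinv_lt (PosNum e20); case=> k _ /(_ k (leqnn _)) h.
      by exists k.
    have k0 : 0 < (k.+1%:R^-1 : R) by rewrite invr_gt0.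
    have qi i : {q : rat | `|ratr q - f x ord0 i| < k.+1%:R^-1}.
      apply: cid.
      have /rat_in_itvoo[q] : f x ord0 i - k.+1%:R^-1 < f x ord0 i + k.+1%:R^-1.
        by rewrite ltrD2l gtrN.
      rewrite in_itv/= => /andP[q1 q2]; exists q.
      by rewrite ltr_distl q1 q2.
    exists (\row_i sval (qi i), k) => //=.
    have bx : box (\row_i sval (qi i), k) (f x) by move=> i /=; rewrite mxE; exact: (svalP (qi i)).
    case: pselect => //= nsub; exfalso; apply: nsub => v bv; apply: eU; split => // i j.
    rewrite (ord1 i) /ball/=.
    have := ler_distD (ratr (sval (qi j))) (f x ord0 j) (v ord0 j).
    move=> /le_lt_trans; apply; rewrite [ltRHS](splitr e) distrC ltrD//.
      exact: lt_trans (svalP (qi j)) ke.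
    by have := bv j; rewrite /= mxE => /lt_trans; apply.
  - by move=> [p _]; case: pselect => //= pU; exact: pU.
apply: countable_bigcupT_measurable => // p.
by case: pselect => //= _; rewrite preimage_set0.
Qed.

Lemma measurable_rV_coord n (i : 'I_n) :
  measurable_fun setT (fun v : 'rV[R]_n => v ord0 i).
Proof.
apply: (measurability _ (RGenOpens.measurableE R)) => _ [_ [a [b ->]] <-].
rewrite setTI; apply: open_measurable_rV; apply: open_comp; last exact: interval_open.
by move=> v _; exact: coord_continuous.
Qed.

Definition rV_cons n (p : R * 'rV[R]_n) : 'rV[R]_n.+1 :=
  \row_i oapp (p.2 ord0) p.1 (unlift ord0 i).

Definition rV_uncons n (v : 'rV[R]_n.+1) : R * 'rV[R]_n :=
  (v ord0 ord0, \row_j v ord0 (lift ord0 j)).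

Lemma rV_consK n : cancel (@rV_cons n) (@rV_uncons n).
Proof.
move=> [x v]; congr (_, _); first by rewrite mxE unlift_none.
by apply/rowP => j; rewrite !mxE liftK.
Qed.

Lemma measurable_rV_cons n : measurable_fun setT (@rV_cons n).
Proof.
apply: measurable_fun_rV => i; case: (unliftP ord0 i) => [j|] ->.
  apply: (@eq_measurable_fun _ _ _ _ _ (fun p : R * 'rV[R]_n => p.2 ord0 j)).
    by move=> p _; rewrite mxE liftK.
  exact: (measurableT_comp (measurable_rV_coord j)).
apply: (@eq_measurable_fun _ _ _ _ _ (@fst R 'rV[R]_n)) => //.
by move=> p _; rewrite mxE unlift_none.
Qed.

Lemma measurable_rV_uncons n : measurable_fun setT (@rV_uncons n).
Proof.
apply/measurable_fun_pairP; split; first exact: measurable_rV_coord.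
apply: measurable_fun_rV => i.
apply: (@eq_measurable_fun _ _ _ _ _ (fun v : 'rV[R]_n.+1 => v ord0 (lift ord0 i))).
  by move=> p _; rewrite mxE.
exact: measurable_rV_coord.
Qed.

Section step.
Context n (m : {sigma_finite_measure set 'rV[R]_n -> \bar R}).
Local Open Scope ereal_scope.

Definition leb_step := pushforward (lebesgue_measure \x m) (@rV_cons n).

Let leb_step0 : leb_step set0 = 0.
Proof. by rewrite /leb_step /pushforward preimage_set0 measure0. Qed.

Let leb_step_ge0 A : 0 <= leb_step A.
Proof. by rewrite /leb_step /pushforward; exact: measure_ge0. Qed.

Let leb_step_sigma_additive : semi_sigma_additive leb_step.
Proof.
have mf := @measurable_rV_cons n.
move=> F mF tF mUF; rewrite /leb_step /pushforward preimage_bigcup.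
apply: measure_semi_sigma_additive.
- by move=> k; rewrite -[X in measurable X]setTI; exact: mf.
- apply/trivIsetP => /= i j _ _ ij; rewrite -preimage_setI.
  by move/trivIsetP : tF => /(_ _ _ _ _ ij) ->//; rewrite preimage_set0.
- by rewrite -preimage_bigcup -[X in measurable X]setTI; exact: mf.
Qed.

HB.instance Definition _ := isMeasure.Build _ _ _ leb_step
  leb_step0 leb_step_ge0 leb_step_sigma_additive.

Let leb_step_sigma_finite : sigma_finite setT leb_step.
Proof.
have [F FT Ffin] := product_sigma_finite (@lebesgue_measure R) m.
exists (fun k => @rV_uncons n @^-1` F k).
  by rewrite -preimage_bigcup -FT preimage_setT.
move=> k; split.
  rewrite -[X in measurable X]setTI; apply: measurable_rV_uncons => //.
  exact: (Ffin k).1.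
rewrite /leb_step /pushforward -comp_preimage (_ : _ \o _ = id); last first.
  by apply/funext; exact: rV_consK.
exact: (Ffin k).2.
Qed.

HB.instance Definition _ := Measure_isSigmaFinite.Build _ _ _ leb_step
  leb_step_sigma_finite.
End step.

(* Lebesgue measure on R^n as the n-fold product of Lebesgue measure on R *)
Fixpoint lebesgue_rV n : {sigma_finite_measure set 'rV[R]_n -> \bar R} :=
  match n with
  | 0%N => dirac (0 : 'rV[R]_0)
  | k.+1 => leb_step (lebesgue_rV k)
  end.

Lemma lebesgue_rV_box n (a b : 'rV[R]_n) : (forall i, a ord0 i <= b ord0 i) ->
  lebesgue_rV n [set v | forall i, v ord0 i \in `[a ord0 i, b ord0 i]] =
  (\prod_i (b ord0 i - a ord0 i))%:E.
Proof.
elim: n a b => [|n IH] a b ab.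
  set B := (B in lebesgue_rV _ B).
  have -> : B = setT by apply/seteqP; split => // v _ [].
  rewrite big_ord0/=.
  by rewrite diracT.
rewrite big_ord_recl/= /leb_step /pushforward.
pose a' := (rV_uncons a).2; pose b' := (rV_uncons b).2.
pose B := [set v : 'rV[R]_n | forall i, v ord0 i \in `[a' ord0 i, b' ord0 i]].
set P := (P in (_ \x _)%E P).
have -> : P = `[a ord0 ord0, b ord0 ord0] `*` B.
  apply/seteqP; split => -[x v] /=.
    move=> h; split; first by have := h ord0; rewrite mxE unlift_none.
    by move=> i; have := h (lift ord0 i); rewrite !mxE liftK.
  move=> [hx hv] i; case: (unliftP ord0 i) => [j|] ->; rewrite mxE ?liftK ?unlift_none//.
  by have := hv j; rewrite !mxE.
have mB : measurable B.
  have -> : B = \bigcap_(i in [set: 'I_n])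
      (fun v : 'rV[R]_n => v ord0 i) @^-1` `[a' ord0 i, b' ord0 i].
    apply/seteqP; split => v h i; first by move=> _; exact: h.
    by have := h i Logic.I.
  apply: fin_bigcap_measurable => // i _; rewrite -[X in measurable X]setTI.
  by apply: measurable_rV_coord => //; exact: measurable_itv.
rewrite product_measure1E// IH; last by move=> i; rewrite !mxE.
have lI : @lebesgue_measure R `[a ord0 ord0, b ord0 ord0]%classic =
    (b ord0 ord0 - a ord0 ord0)%:E.
  rewrite lebesgue_measure_itv/= lte_fin; case: ltP (ab ord0) => // ba ab0.
  by rewrite (@le_anti _ _ (a ord0 ord0) (b ord0 ord0)) ?subrr// ba ab0.
rewrite EFinM; congr (_ * _)%E; first exact: lI.
by congr EFin; apply: eq_bigr => i _; rewrite !mxE.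
Qed.

End lebesgue_rV.

Section operators.
Context {d1 d2} {T1 : measurableType d1} {T2 : measurableType d2} {R : realType}.
Variables (mu : {measure set T1 -> \bar R}) (nu : {measure set T2 -> \bar R}).

(* [Phi] sends square integrable functions to square integrable functions and
   respects almost everywhere equality, i.e., it induces a map on the L2 spaces *)
Definition L2_well_defined (Phi : (T1 -> R[i]) -> T2 -> R[i]) : Prop :=
  (forall f, in_L2 mu f -> in_L2 nu (Phi f)) /\
  (forall f g, in_L2 mu f -> in_L2 mu g ->
    (\forall x \ae mu, f x = g x) -> \forall y \ae nu, Phi f y = Phi g y).

Definition L2_operator (Phi : (T1 -> R[i]) -> T2 -> R[i]) : L2 mu -> L2 nu :=
  fun u => L2_class nu (Phi (L2_fun u)).

Definition is_adjoint (A : L2 mu -> L2 nu) (B : L2 nu -> L2 mu) : Prop :=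
  forall u v, L2_inner (A u) v = L2_inner u (B v).

End operators.

Arguments L2_operator {d1 d2 T1 T2 R} mu nu Phi u.

Definition compact_operator (K : numFieldType) (V W : normedModType K)
    (A : V -> W) : Prop :=
  linear A /\ forall B : set V, bounded_set B -> precompact (A @` B).

Section geometry.
Context {R : realType} {d : nat}.

Definition dotv (x y : 'rV[R]_d) : R := \sum_i x ord0 i * y ord0 i.

Definition unit_sphere : set 'rV[R]_d := [set x | dotv x x = 1].

(* near each of its boundary points [D] is, up to the orthogonal change of
   coordinates [Q], the strict hypograph of a Lipschitz function [zeta] of the
   coordinates other than the [j]-th one *)
Definition lipschitz_boundary (D : set 'rV[R]_d) : Prop :=
  forall p, (closure D `\` D°) p ->
  exists (Q : 'M[R]_d) (j : 'I_d) (zeta : 'rV[R]_d.-1 -> R^o) (U : set 'rV[R]_d),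
    [/\ Q *m Q^T = 1%:M, lipschitz zeta, open_nbhs p U &
      forall x, U x ->
        (D x <-> (x *m Q) ord0 j < zeta (col' j (x *m Q)))].

Record bounded_lipschitz_domain (D : set 'rV[R]_d) : Prop := {
  bld_nonempty : D !=set0 ;
  bld_open : open D ;
  bld_connected : connected D ;
  bld_bounded : bounded_set D ;
  bld_boundary : lipschitz_boundary D }.

Lemma measurable_cylinder (D : set 'rV[R]_d) (t1 t2 : R) :
  open D -> measurable (D `*` `[t1, t2]).
Proof.
by move=> oD; apply: measurableX; [exact: open_measurable_rV|exact: measurable_itv].
Qed.

End geometry.

Definition interval_measure {R : realType} (a b : R) :
    {measure set (measurableTypeR R) -> \bar R} :=
  mrestr lebesgue_measure (measurable_itv `]a, b[).

Definition cylinder_measure {R : realType} {d : nat} (D : set 'rV[R]_d)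
    (oD : open D) (t1 t2 : R) : {measure set ('rV[R]_d * measurableTypeR R)%type -> \bar R} :=
  mrestr (lebesgue_rV d \x lebesgue_measure)%E (measurable_cylinder t1 t2 oD).

Definition expi {R : realType} (theta : R) : R[i] :=
  Complex (cos theta) (sin theta).

Section far_field.
Context {R : realType} {d : nat}.
Variables (D : set 'rV[R]_d) (t1 t2 : R) (F : R -> R) (K : 'rV[R]_d * R -> R).
Variables (xhat : 'rV[R]_d).

Local Notation leb := lebesgue_measure.
Local Notation lebd := (lebesgue_rV d).

Definition kernel_FKK (y : 'rV[R]_d) (t s : R) : R := F (t - s) * K (y, t) * K (y, s).

Definition covariance_data (tau k : R) : R[i] :=
  \cint[lebd]_(y in D)
    ((\cint[leb]_(s in `[t1, t2]) \cint[leb]_(t in `[t1, t2])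
        ((kernel_FKK y t s)%:C%C * expi ((k + tau) * t) * expi (- (k * s))))
     * expi (- (tau * dotv xhat y))).

Definition far_field_correlation (k0 tauc tauw : R) (phi : R -> R[i]) (tau : R) : R[i] :=
  \cint[leb]_(gamma in `]0, tauw[)
    (covariance_data (tauc + tau - gamma) k0 * phi gamma).

Definition far_field_L (u : 'rV[R]_d * R -> R[i]) (tau : R) : R[i] :=
  \cint[leb]_(t in `[t1, t2]) \cint[lebd]_(y in D)
    (expi (- (tau * (dotv xhat y - t))) * u (y, t)).

Definition far_field_T (k0 tauc : R) (psi : 'rV[R]_d * R -> R[i])
    (p : 'rV[R]_d * R) : R[i] :=
  (\cint[leb]_(s in `[t1, t2])
     ((kernel_FKK p.1 p.2 s)%:C%C * expi ((k0 + tauc) * p.2 - k0 * s)))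
  * expi (- (tauc * dotv xhat p.1)) * psi p.

End far_field.

(* Main.v *)
(** With the kernel [kappa (tau, (y, t)) = exp (- i tau (xhat . y - t))], the
    operator L is the integral operator with kernel [kappa], and its adjoint has
    the conjugate kernel.  By Fubini the covariance at frequency shift
    [tauc + tau - gamma] is the integral over [D x [t1, t2]] of
    [m (p) kappa (tau, p) conj (kappa (gamma, p))], where [m] is the multiplier
    of T; a second use of Fubini gives F = L T L*.

    Compactness.  L maps a bounded set to a set of uniformly bounded and
    uniformly Lipschitz functions.  By Tychonoff the functions with given bounds
    form a compact set for pointwise convergence, and on this set pointwise
    convergence on a finite grid controls the uniform, hence the L2, distance.
    So the image lies in a compact set of L2; completeness of L2 is not needed.

    Density.  The closure of the range contains [exp (- i tau s)] for all [s] in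
    an open interval (apply L to approximate Dirac masses), hence by
    differentiation in [s] all [tau ^ n exp (- i tau s)], hence
    [p (tau) exp (- i tau s)] for polynomials [p].  The polynomials
    [(1 - x ^ n) ^ (2 ^ n)] tend to the indicator of [x < 1/2], so [p] can be
    replaced by the indicator of a half-line, then of any measurable set
    (Dynkin), and finally by any square integrable function. *)
Require Import Defs.
From HB Require Import structures.
From mathcomp Require Import all_boot all_order all_algebra.
From mathcomp Require Import complex.
From mathcomp Require Import all_classical all_reals all_analysis.
From mathcomp Require Import measurable_realfun lebesgue_Rintegral ess_sup_inf.
From mathcomp Require Import ring lra.

Set Implicit Arguments.
Unset Strict Implicit.
Unset Printing Implicit Defensive.
Import Order.TTheory GRing.Theory Num.Theory.
Import numFieldNormedType.Exports.
Local Open Scope classical_set_scope.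
Local Open Scope ring_scope.

Local Notation Re := complex.Re.
Local Notation Im := complex.Im.
Local Notation normc := Normc.normc.

(** * Integrals over product sets *)

(** Integrals are total functions: a divergent one gets a default value through [fine], so an
    exchange of integrals is valid only where sections are integrable. The assumption on [F] and [K]
    guarantees this for almost every point only; exchanges at a fixed point [y] are therefore made
    off a null set and integrated afterwards. An element of L2 is a class and operators act on a
    chosen representative. Identities are first proved for functions, often at every point, and then
    carried to classes by well-definedness. Complex integrals are estimated through real and
    imaginary parts, which is the source of the factors 2; only boundedness and convergence to 0
    matter. For density, one spatial point is enough: with [y] fixed and [t] moving between [t1] and
    [t2], the number xhat . y - t fills an open interval. The factor exp (- i tau s) has modulus
    one, so approximating functions multiplied by it amounts to approximating real weights, for
    which monotone and dominated arguments are available. *)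

Section product_sigma_finite.
Context d1 d2 (T1 : measurableType d1) (T2 : measurableType d2) (R : realType).
Variables (m1 : {sigma_finite_measure set T1 -> \bar R})
  (m2 : {sigma_finite_measure set T2 -> \bar R}).

(* an alias of [m1 \x m2], which the library only equips with a sigma-finite
   measure structure when [m1] and [m2] are finite *)
Definition sigma_finite_product := (m1 \x m2)%E.

HB.instance Definition _ := Measure.on sigma_finite_product.
HB.instance Definition _ := Measure_isSigmaFinite.Build _ _ _
  sigma_finite_product (product_sigma_finite m1 m2).

End product_sigma_finite.

Section Rintegral_restricted.
Context d (T : measurableType d) (R : realType) (mu : {measure set T -> \bar R}).
Variables (D : set T) (mD : measurable D).

(** The two measures agree on subsets of [D], and the complement of [D] is null for the restricted
    one, so the integrand may be cut off outside [D]. *)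
Lemma integral_mrestr (f : T -> \bar R) : measurable_fun setT f ->
  (\int[mrestr mu mD]_x f x = \int[mu]_(x in D) f x)%E.
Proof.
move=> mf.
transitivity (\int[mrestr mu mD]_(x in D) f x)%E; last first.
  by apply: eq_measure_integral => A mA AD; rewrite /= /mrestr setIidl.
rewrite [RHS]integral_mkcond; apply: ae_eq_integral => //.
  by apply/(measurable_restrictT _ mD); exact: measurable_funTS.
exists (~` D); split; first exact: measurableC.
  by rewrite /= /mrestr setICl measure0.
move=> x /= h Dx; apply: h => _; rewrite patchE mem_set//.
Qed.

(** An exceptional set is intersected with [D] in one direction and enlarged by the complement of
    [D] in the other. *)
Lemma ae_mrestr (P : T -> Prop) :
  (\forall x \ae mrestr mu mD, P x) <-> (\forall x \ae mu, D x -> P x).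
Proof.
split=> -[N [mN N0 PN]].
  exists (N `&` D); split => //; first exact: measurableI.
  move=> x /= h; split.
    by apply: PN => Px; apply: h.
  by apply: contrapT => nD; apply: h.
exists (N `|` ~` D); split => //; first by apply: measurableU => //; exact: measurableC.
  rewrite /= /mrestr setIUl setICl setU0; apply/eqP; rewrite -measure_le0 -N0.
  by apply: le_measure; rewrite ?inE//; exact: measurableI.
move=> x /= h; have [Dx|] := pselect (D x); last by right.
by left; apply: PN => /(_ Dx).
Qed.

End Rintegral_restricted.

Section real_Fubini.
Context d1 d2 (T1 : measurableType d1) (T2 : measurableType d2) (R : realType).
Variable m1 : {sigma_finite_measure set T1 -> \bar R}.
Variable m2 : {sigma_finite_measure set T2 -> \bar R}.

(** No integrability is assumed: Tonelli gives measurability of the integrals of the positive and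
    negative parts, and both subtraction in the extended reals and [fine] preserve it. *)
Lemma measurable_fun_section_integral (B : set T2) (f : T1 * T2 -> R) :
  measurable B -> measurable_fun setT f ->
  measurable_fun setT (fun x => \int[m2]_(y in B) f (x, y)).
Proof.
move=> mB mf; apply: measurableT_comp => /=; first exact: measurable_funTS.
pose g := EFin \o (f \_ (setT `*` B)).
have mg : measurable_fun setT g.
  apply/measurable_EFinP; apply/(measurable_restrictT _ (measurableX measurableT mB)).
  exact: measurable_funTS.
rewrite (_ : (fun x => _) = fun x => ((\int[m2]_y g^\+ (x, y)) - (\int[m2]_y g^\- (x, y))))%E.
  apply: emeasurable_funB.
  - by apply: (measurable_fun_fubini_tonelli_F (m2 := m2)) => //; exact: measurable_funepos.
  - by apply: (measurable_fun_fubini_tonelli_F (m2 := m2)) => //; exact: measurable_funeneg.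
apply/funext => x; rewrite integral_mkcond.
rewrite (_ : (fun y => (f (x, y))%:E) \_ B = fun y => g (x, y)).
  rewrite integralE; congr (_ - _)%E; apply: eq_integral => y _.
    by rewrite funepos_comp.
  by rewrite funeneg_comp.
apply/funext => y; rewrite /g /= !patchE in_setX/= in_setT/=.
by case: ifP.
Qed.

Variables (A : set T1) (B : set T2) (mA : measurable A) (mB : measurable B).

Lemma integral_abs_setX (f : T1 * T2 -> R) : measurable_fun setT f ->
  (\int[m1 \x m2]_(z in A `*` B) `|(f z)%:E| =
   \int[m1]_(x in A) \int[m2]_(y in B) `|(f (x, y))%:E|)%E.
Proof.
move=> mf; rewrite integral_mkcond fubini_tonelli1.
- rewrite [RHS]integral_mkcond; apply: eq_integral => x _.
  rewrite /fubini_F patchE; case: ifPn => xA.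
    rewrite [RHS]integral_mkcond; apply: eq_integral => y _.
    by rewrite !patchE in_setX xA.
  by apply: integral0_eq => y _; rewrite patchE in_setX (negbTE xA).
- apply/(measurable_restrictT _ (measurableX mA mB)).
  apply: measurable_funTS; apply: measurableT_comp => //.
  exact/measurable_EFinP.
- by move=> z; apply: erestrict_ge0.
Qed.

Lemma integrable_setXP (f : T1 * T2 -> R) : measurable_fun setT f ->
  (m1 \x m2)%E.-integrable (A `*` B) (EFin \o f) <->
  (\int[m1]_(x in A) \int[m2]_(y in B) `|(f (x, y))%:E| < +oo)%E.
Proof.
move=> mf; rewrite -integral_abs_setX//; split => [/integrableP[]//|h].
apply/integrableP; split => //.
by apply: measurable_funTS; exact/measurable_EFinP.
Qed.

(** The iterated integral of the majorant factors into two finite integrals. This is what justifies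
    Fubini for a bounded kernel times a function of each variable. *)
Lemma integrable_setX_tensor (f : T1 * T2 -> R) (g : T1 -> R) (h : T2 -> R) :
  measurable_fun setT f ->
  m1.-integrable A (EFin \o g) -> m2.-integrable B (EFin \o h) ->
  (forall x y, A x -> B y -> `|f (x, y)| <= g x * h y) ->
  (m1 \x m2)%E.-integrable (A `*` B) (EFin \o f).
Proof.
move=> mf ig ih fgh; apply/integrable_setXP => //.
have mg' := measurable_int _ ig.
have mh' := measurable_int _ ih.
have mg : measurable_fun A g by exact/measurable_EFinP.
have mh : measurable_fun B h by exact/measurable_EFinP.
have fh x y : A x -> B y -> `|f (x, y)| <= `|g x| * `|h y|.
  by move=> Ax By; rewrite -normrM; apply: (le_trans (fgh _ _ Ax By)); exact: ler_norm.
have mfx x : measurable_fun setT (fun y => f (x, y)).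
  exact: measurableT_comp.
have hfin : (\int[m2]_(y in B) `|(h y)%:E| < +oo)%E by have /integrableP[] := ih.
have hfin' : (\int[m2]_(y in B) `|(h y)%:E|)%E \is a fin_num.
  by rewrite ge0_fin_numE// integral_ge0.
apply: (@le_lt_trans _ _ (\int[m1]_(x in A) (`|(g x)%:E| * \int[m2]_(y in B) `|(h y)%:E|))%E).
- apply: ge0_le_integral => //.
  + by move=> x _; exact: integral_ge0.
  + apply: measurable_funTS.
    pose F := (fun z : T1 * T2 => (`|(f z)%:E|)%E) \_ (setT `*` B).
    rewrite (_ : (fun x => _) = fun x => \int[m2]_y F (x, y))%E.
      apply: (measurable_fun_fubini_tonelli_F (m2 := m2)) => //.
        apply/(measurable_restrictT _ (measurableX measurableT mB)).
        apply: measurable_funTS; apply: measurableT_comp => //.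
        exact/measurable_EFinP.
      by move=> z; apply: erestrict_ge0.
    apply/funext => x; rewrite integral_mkcond; apply: eq_integral => y _.
    by rewrite /F !patchE in_setX in_setT.
  + apply: emeasurable_funM => //.
    by apply: measurableT_comp => //; exact/measurable_EFinP.
  + move=> x Ax; rewrite -ge0_integralZl//; last first.
      by apply: measurableT_comp.
    apply: ge0_le_integral => //.
    * by apply: measurable_funTS; apply: measurableT_comp => //; exact/measurable_EFinP.
    * by apply: measurable_funeM; exact: measurableT_comp.
    * by move=> y By; rewrite -EFinM lee_fin; exact: fh.
- under eq_integral do rewrite -[in X in (_ * X)%E](fineK hfin').
  rewrite ge0_integralZr//.
  + apply: lte_mul_pinfty => //; [exact: integral_ge0| |exact: ltry].
    by rewrite ge0_fin_numE// ?integral_ge0//; have /integrableP[] := ig.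
  + by apply: measurableT_comp.
  + by rewrite lee_fin fine_ge0// integral_ge0.
Qed.

(** On a null set of [x] the inner integral may be infinite, and there [\int] takes a default value.
    The proof compares it almost everywhere with the extended-real section integral [fubini_F]. *)
Lemma Rintegral_setX12 (f : T1 * T2 -> R) :
  (m1 \x m2)%E.-integrable (A `*` B) (EFin \o f) ->
  m1.-integrable A (EFin \o (fun x => \int[m2]_(y in B) f (x, y))) /\
  \int[m1]_(x in A) (\int[m2]_(y in B) f (x, y)) = \int[(m1 \x m2)%E]_(z in A `*` B) f z.
Proof.
move=> If; pose g := EFin \o (f \_ (A `*` B)).
have Ig : (m1 \x m2)%E.-integrable setT g.
  by rewrite /g -restrict_EFin; apply/(integrable_mkcond _ _).1 => //; exact: measurableX.
have FE x : A x -> fubini_F m2 g x = (\int[m2]_(y in B) (f (x, y))%:E)%E.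
  move=> Ax; rewrite /fubini_F [RHS]integral_mkcond; apply: eq_integral => y _.
  by rewrite /g/= !patchE in_setX mem_set//=; case: ifP.
have FN x : ~ A x -> fubini_F m2 g x = 0%E.
  move=> nA; apply: integral0_eq => y _.
  by rewrite /g/= !patchE in_setX memNset.
have IF := integrable_fubini_F Ig.
have mF : measurable_fun setT (fun x => (fine (fubini_F m2 g x))%:E).
  apply/measurable_EFinP; apply: measurableT_comp => //.
  by have /integrableP[] := IF.
have aeF : ae_eq m1 setT (fubini_F m2 g) (fun x => (fine (fubini_F m2 g x))%:E).
  have := integrable_ae measurableT IF; apply: filterS => x /(_ I) h _.
  by rewrite fineK.
have E : {in A, (EFin \o (fun x => \int[m2]_(y in B) f (x, y))) =1 fun x => (fine (fubini_F m2 g x))%:E}.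
  by move=> x; rewrite inE => Ax /=; rewrite FE.
have IE : m1.-integrable setT (fun x => (fine (fubini_F m2 g x))%:E).
  apply/integrableP; split => //.
  rewrite (@ae_eq_integral _ _ _ m1 _ (fun x => `|fubini_F m2 g x|)%E)//.
  - by have /integrableP[] := IF.
  - exact: measurableT_comp.
  - by apply: measurableT_comp => //; have /integrableP[] := IF.
  - by apply: filterS aeF => x + _ => /(_ I) h; congr (abse _); exact: esym.
split.
  apply: (eq_integrable mA (fun x => (fine (fubini_F m2 g x))%:E)).
    by move=> x xA; rewrite E.
  exact: integrableS IE.
rewrite /Rintegral (eq_integral _ _ E) [X in _ = fine X]integral_mkcond.
rewrite (_ : _ \_ (A `*` B) = g); last by rewrite /g -restrict_EFin.
rewrite -integral12_prod_meas1//; congr fine.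
rewrite integral_mkcond; apply/esym; apply: ae_eq_integral => //.
- by have /integrableP[] := IF.
- by apply/(measurable_restrictT _ mA); exact: measurable_funTS.
apply: filterS aeF => x + _ => /(_ I) ->; rewrite patchE; case: ifPn => //.
by rewrite notin_setE => /FN ->.
Qed.

Lemma Rintegral_setX21 (f : T1 * T2 -> R) :
  (m1 \x m2)%E.-integrable (A `*` B) (EFin \o f) ->
  m2.-integrable B (EFin \o (fun y => \int[m1]_(x in A) f (x, y))) /\
  \int[m2]_(y in B) (\int[m1]_(x in A) f (x, y)) = \int[(m1 \x m2)%E]_(z in A `*` B) f z.
Proof.
move=> If; pose g := EFin \o (f \_ (A `*` B)).
have Ig : (m1 \x m2)%E.-integrable setT g.
  by rewrite /g -restrict_EFin; apply/(integrable_mkcond _ _).1 => //; exact: measurableX.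
have FE x : B x -> fubini_G m1 g x = (\int[m1]_(y in A) (f (y, x))%:E)%E.
  move=> Ax; rewrite /fubini_F [RHS]integral_mkcond; apply: eq_integral => y _.
  by rewrite /g/= !patchE in_setX (mem_set Ax)/= andbT; case: ifP.
have FN x : ~ B x -> fubini_G m1 g x = 0%E.
  move=> nA; apply: integral0_eq => y _.
  by rewrite /g/= !patchE in_setX (memNset nA)/= andbF.
have mg : measurable_fun setT g := measurable_int _ Ig.
(* The modulus of a section integral is at most the section integral of the modulus, whose integral
   is finite by Tonelli. *)
have IG : m2.-integrable setT (fubini_G m1 g).
  apply/integrableP; split; first exact: measurable_fubini_G Ig.
  apply: le_lt_trans ((integrable21ltyP _ _ mg).1 Ig).
  apply: ge0_le_integral => //.
  - by apply: measurableT_comp => //; exact: measurable_fubini_G Ig.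
  - apply: (measurable_fun_fubini_tonelli_G (m1 := m1) (abse \o g)) => //=.
    exact: measurableT_comp.
  - move=> y _; apply: le_abse_integral => //.
    exact: measurableT_comp.
have mG : measurable_fun setT (fun x => (fine (fubini_G m1 g x))%:E).
  apply/measurable_EFinP; apply: measurableT_comp => //.
  by have /integrableP[] := IG.
have aeF : ae_eq m2 setT (fubini_G m1 g) (fun x => (fine (fubini_G m1 g x))%:E).
  have := integrable_ae measurableT IG; apply: filterS => x /(_ I) h _.
  by rewrite fineK.
have E : {in B, (EFin \o (fun x => \int[m1]_(y in A) f (y, x))) =1 fun x => (fine (fubini_G m1 g x))%:E}.
  by move=> x; rewrite inE => Ax /=; rewrite FE.
have IE : m2.-integrable setT (fun x => (fine (fubini_G m1 g x))%:E).
  apply/integrableP; split => //.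
  rewrite (@ae_eq_integral _ _ _ m2 _ (fun x => `|fubini_G m1 g x|)%E)//.
  - by have /integrableP[] := IG.
  - exact: measurableT_comp.
  - by apply: measurableT_comp => //; have /integrableP[] := IG.
  - by apply: filterS aeF => x + _ => /(_ I) h; congr (abse _); exact: esym.
split.
  apply: (eq_integrable mB (fun x => (fine (fubini_G m1 g x))%:E)).
    by move=> x xA; rewrite E.
  exact: integrableS IE.
rewrite /Rintegral (eq_integral _ _ E) [X in _ = fine X]integral_mkcond.
rewrite (_ : _ \_ (A `*` B) = g); last by rewrite /g -restrict_EFin.
rewrite -integral21_prod_meas1//; congr fine.
rewrite integral_mkcond; apply/esym; apply: ae_eq_integral => //.
- by have /integrableP[] := IG.
- by apply/(measurable_restrictT _ mB); exact: measurable_funTS.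
apply: filterS aeF => x + _ => /(_ I) ->; rewrite patchE; case: ifPn => //.
by rewrite notin_setE => /FN ->.
Qed.
End real_Fubini.

(** * Complex-valued integrals *)

Section complex_numbers.
Context {R : realType}.
Implicit Types (z w : R[i]) (a b : R).

Lemma normr_Re_le_normc z : `|Re z| <= normc z.
Proof. by case: z => a b; rewrite /= -sqrtr_sqr ler_wsqrtr// lerDl sqr_ge0. Qed.

Lemma normr_Im_le_normc z : `|Im z| <= normc z.
Proof. by case: z => a b; rewrite /= -sqrtr_sqr ler_wsqrtr// lerDr sqr_ge0. Qed.

Lemma normc_le_Re_Im z : normc z <= `|Re z| + `|Im z|.
Proof.
case: z => a b /=; rewrite -[leRHS]ger0_norm ?addr_ge0// -sqrtr_sqr ler_wsqrtr//.
have := mulr_ge0 (normr_ge0 a) (normr_ge0 b).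
by rewrite -(real_normK (num_real a)) -(real_normK (num_real b)); nra.
Qed.

Lemma gt0_complexE z : 0 < z -> exists2 r : R, 0 < r & z = r%:C%C.
Proof.
case: z => a b; rewrite ltcE /= => /andP[/eqP b0 a0].
by exists a => //; rewrite b0.
Qed.

Lemma normc_expi a : normc (expi a) = 1.
Proof. by rewrite /= cos2Dsin2 sqrtr1. Qed.

Lemma expiD a b : expi (a + b) = expi a * expi b.
Proof. by rewrite /expi cosD sinD; congr Complex; rewrite addrC; congr (_ + _); rewrite mulrC. Qed.

Lemma expi0 : expi 0 = 1 :> R[i].
Proof. by rewrite /expi cos0 sin0. Qed.

Lemma expiN a : expi (- a) = (expi a)^*%C.
Proof. by rewrite /expi cosN sinN. Qed.

Lemma normr_ReB_le_normc z w : `|Re z - Re w| <= normc (z - w).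
Proof. by have := normr_Re_le_normc (z - w); case: z; case: w. Qed.

Lemma normr_ImB_le_normc z w : `|Im z - Im w| <= normc (z - w).
Proof. by have := normr_Im_le_normc (z - w); case: z; case: w. Qed.

Lemma normc_opp z : normc (- z) = normc z.
Proof. by case: z => a b /=; rewrite !sqrrN. Qed.

Lemma normc_conjc z : normc z^*%C = normc z.
Proof. by case: z => a b /=; rewrite sqrrN. Qed.

Lemma normr_sinB_le a b : `|sin a - sin b| <= `|a - b|.
Proof.
wlog ab : a b / a <= b.
  move=> h; have [/h//|/ltW/h] := leP a b.
  by rewrite distrC [leRHS]distrC.
rewrite distrC [leRHS]distrC.
have [c _ ->] := @MVT_segment R sin cos a b ab (fun x _ => is_derive_sin x)
  (continuous_subspaceT (@continuous_sin R)).
by rewrite normrM ler_piMl// ler_norml cos_geN1 cos_le1.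
Qed.

Lemma normr_cosB_le a b : `|cos a - cos b| <= `|a - b|.
Proof.
wlog ab : a b / a <= b.
  move=> h; have [/h//|/ltW/h] := leP a b.
  by rewrite distrC [leRHS]distrC.
rewrite distrC [leRHS]distrC.
have [c _ ->] := @MVT_segment R cos (fun x => - sin x) a b ab (fun x _ => is_derive_cos x)
  (continuous_subspaceT (@continuous_cos R)).
by rewrite normrM ler_piMl// normrN ler_norml sin_geN1 sin_le1.
Qed.

(** Sine and cosine are 1-Lipschitz and are estimated separately, hence the factor 2. *)
Lemma normc_expiB_le a b : normc (expi a - expi b) <= 2 * `|a - b|.
Proof.
apply: (le_trans (normc_le_Re_Im _)); rewrite mulr_natl mulr2n /=.
by apply: lerD; [exact: normr_cosB_le|exact: normr_sinB_le].
Qed.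

End complex_numbers.

Section cmeasurable.
Context d (T : measurableType d) (R : realType).
Implicit Types (f g : T -> R[i]) (A : set T).

Lemma cmeasurable_funM A f g : cmeasurable_fun A f -> cmeasurable_fun A g ->
  cmeasurable_fun A (fun x => f x * g x).
Proof.
move=> [fr fi] [gr gi]; split.
- rewrite (_ : (fun x => _) = fun x => Re (f x) * Re (g x) - Im (f x) * Im (g x)).
    by apply: measurable_funB; exact: measurable_funM.
  by apply/funext => x; case: (f x); case: (g x).
- rewrite (_ : (fun x => _) = fun x => Re (f x) * Im (g x) + Im (f x) * Re (g x)).
    by apply: measurable_funD; exact: measurable_funM.
  by apply/funext => x; case: (f x); case: (g x).
Qed.

Lemma cmeasurable_funD A f g : cmeasurable_fun A f -> cmeasurable_fun A g ->
  cmeasurable_fun A (fun x => f x + g x).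
Proof.
move=> [fr fi] [gr gi]; split.
- rewrite (_ : (fun x => _) = fun x => Re (f x) + Re (g x)).
    exact: measurable_funD.
  by apply/funext => x; case: (f x); case: (g x).
- rewrite (_ : (fun x => _) = fun x => Im (f x) + Im (g x)).
    exact: measurable_funD.
  by apply/funext => x; case: (f x); case: (g x).
Qed.

Lemma cmeasurable_fun_cst A (c : R[i]) : cmeasurable_fun A (fun=> c).
Proof. by split; exact: measurable_cst. Qed.

Lemma cmeasurable_fun_real A (f : T -> R) : measurable_fun A f ->
  cmeasurable_fun A (fun x => (f x)%:C%C).
Proof. by move=> mf; split => //=; exact: measurable_cst. Qed.

Lemma cmeasurable_fun_conj A f : cmeasurable_fun A f ->
  cmeasurable_fun A (fun x => (f x)^*%C).
Proof.
move=> [fr fi]; split.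
- by rewrite (_ : (fun x => _) = fun x => Re (f x))//; apply/funext => x; case: (f x).
- rewrite (_ : (fun x => _) = fun x => - Im (f x)); first exact: measurable_funN.
  by apply/funext => x; case: (f x).
Qed.

Lemma cmeasurable_fun_expi A (h : T -> R) : measurable_fun A h ->
  cmeasurable_fun A (fun x => expi (h x)).
Proof.
move=> mh; split.
- apply: (measurableT_comp (continuous_measurable_fun (@continuous_cos R))) => //.
- apply: (measurableT_comp (continuous_measurable_fun (@continuous_sin R))) => //.
Qed.

Lemma cmeasurable_funTS A f : cmeasurable_fun setT f -> cmeasurable_fun A f.
Proof. by move=> [? ?]; split; exact: measurable_funTS. Qed.

Lemma measurable_cmodS A f : cmeasurable_fun A f -> measurable_fun A (cmod f).
Proof.
move=> [mr mi].
have -> : cmod f = fun x => Num.sqrt (Re (f x) ^+ 2 + Im (f x) ^+ 2).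
  by apply/funext => x; rewrite /cmod; case: (f x).
apply: (measurableT_comp (continuous_measurable_fun (@sqrt_continuous R))) => //.
by apply: measurable_funD; apply: measurable_funX.
Qed.

End cmeasurable.

Lemma cmeasurable_comp d1 d2 (T1 : measurableType d1) (T2 : measurableType d2)
    (R : realType) (f : T2 -> R[i]) (h : T1 -> T2) :
  cmeasurable_fun setT f -> measurable_fun setT h ->
  cmeasurable_fun setT (fun x => f (h x)).
Proof.
by move=> [fr fi] mh; split; [exact: (measurableT_comp fr mh)|exact: (measurableT_comp fi mh)].
Qed.

Definition cintegrable d (T : measurableType d) (R : realType)
    (mu : {measure set T -> \bar R}) (D : set T) (f : T -> R[i]) : Prop :=
  mu.-integrable D (EFin \o (fun x => Re (f x))) /\
  mu.-integrable D (EFin \o (fun x => Im (f x))).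

Section cintegral.
Context d (T : measurableType d) (R : realType) (mu : {measure set T -> \bar R}).
Variables (D : set T) (mD : measurable D).
Implicit Types f g : T -> R[i].

Lemma cintegrable_measurable f : cintegrable mu D f -> cmeasurable_fun D f.
Proof.
by move=> [fr fi]; split; apply/measurable_EFinP; [exact: measurable_int fr|exact: measurable_int fi].
Qed.

Lemma cintegrable_le f (g : T -> R) : cmeasurable_fun D f ->
  mu.-integrable D (EFin \o g) -> (forall x, D x -> normc (f x) <= g x) ->
  cintegrable mu D f.
Proof.
move=> [fr fi] ig fg; split; apply: (le_integrable mD _ _ ig) => //.
- exact/measurable_EFinP.
- move=> x Dx /=; rewrite lee_fin (le_trans (normr_Re_le_normc _))//.
  by rewrite (le_trans (fg _ Dx))// ler_norm.
- exact/measurable_EFinP.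
- move=> x Dx /=; rewrite lee_fin (le_trans (normr_Im_le_normc _))//.
  by rewrite (le_trans (fg _ Dx))// ler_norm.
Qed.

Lemma cintegrable_cmod f : cintegrable mu D f -> mu.-integrable D (EFin \o cmod f).
Proof.
move=> If; have [fr fi] := If.
have mf := cintegrable_measurable If.
apply: (le_integrable mD _ _ (integrableD mD (integrable_norm fr) (integrable_norm fi))).
  by apply/measurable_EFinP; exact: measurable_cmodS.
move=> x Dx /=; rewrite lee_fin ger0_norm ?normc_ge0// ger0_norm ?addr_ge0//.
exact: normc_le_Re_Im.
Qed.

Lemma cintegrableP f : cmeasurable_fun D f ->
  cintegrable mu D f <-> mu.-integrable D (EFin \o cmod f).
Proof.
move=> mf; split; first exact: cintegrable_cmod.
by move=> ic; apply: (cintegrable_le mf ic).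
Qed.

Lemma eq_cintegral f g : (forall x, D x -> f x = g x) ->
  cintegral mu D f = cintegral mu D g.
Proof.
move=> fg; rewrite /cintegral; congr Complex; apply: eq_Rintegral => x /set_mem Dx;
  by rewrite fg.
Qed.

Lemma ae_eq_cintegral f g : cmeasurable_fun D f -> cmeasurable_fun D g ->
  (\forall x \ae mu, D x -> f x = g x) -> cintegral mu D f = cintegral mu D g.
Proof.
move=> [fr fi] [gr gi] fg; rewrite /cintegral /Rintegral; congr Complex; congr fine;
  apply: ae_eq_integral => //; try exact/measurable_EFinP.
- by apply: filterS fg => x fg Dx; rewrite fg.
- by apply: filterS fg => x fg Dx; rewrite fg.
Qed.

Lemma cintegrableZl (c : R[i]) f : cintegrable mu D f ->
  cintegrable mu D (fun x => c * f x).
Proof.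
move=> If; have mf := cintegrable_measurable If.
apply: (cintegrable_le _ (integrableZl mD (normc c) (cintegrable_cmod If))).
  by apply: cmeasurable_funM => //; exact: cmeasurable_fun_cst.
by move=> x Dx; rewrite Normc.normcM.
Qed.

Lemma cintegrableD f g : cintegrable mu D f -> cintegrable mu D g ->
  cintegrable mu D (fun x => f x + g x).
Proof.
move=> If Ig; apply: (cintegrable_le _ (integrableD mD (cintegrable_cmod If) (cintegrable_cmod Ig))).
  by apply: cmeasurable_funD; exact: cintegrable_measurable.
by move=> x Dx /=; exact: le_normcD.
Qed.

Lemma cintegralZl (c : R[i]) f : cintegrable mu D f ->
  cintegral mu D (fun x => c * f x) = c * cintegral mu D f.
Proof.
move=> [fr fi]; case: c => a b; rewrite /cintegral /=.
have Z (r : R) (g : T -> R) : mu.-integrable D (EFin \o g) ->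
    mu.-integrable D (EFin \o (fun x => r * g x)) by move=> /(integrableZl mD r).
have -> : (Complex a b * Complex (\int[mu]_(x in D) Re (f x)) (\int[mu]_(x in D) Im (f x)))
  = Complex (a * \int[mu]_(x in D) Re (f x) - b * \int[mu]_(x in D) Im (f x))
            (a * \int[mu]_(x in D) Im (f x) + b * \int[mu]_(x in D) Re (f x)).
  by [].
rewrite -!RintegralZl// -RintegralB ?Z// -RintegralD ?Z//; congr Complex;
  by apply: eq_Rintegral => x _; case: (f x).
Qed.

Lemma cintegralZr (c : R[i]) f : cintegrable mu D f ->
  cintegral mu D (fun x => f x * c) = cintegral mu D f * c.
Proof.
by move=> If; rewrite mulrC -cintegralZl//; apply: eq_cintegral => x _; rewrite mulrC.
Qed.

Lemma cintegralD f g : cintegrable mu D f -> cintegrable mu D g ->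
  cintegral mu D (fun x => f x + g x) = cintegral mu D f + cintegral mu D g.
Proof.
move=> [fr fi] [gr gi]; rewrite /cintegral.
have -> : forall a b c e : R, Complex a b + Complex c e = Complex (a + c) (b + e) by [].
rewrite -!RintegralD//; congr Complex; apply: eq_Rintegral => x _;
  by case: (f x); case: (g x).
Qed.

Lemma cintegral_conj f : cintegrable mu D f ->
  cintegral mu D (fun x => (f x)^*%C) = (cintegral mu D f)^*%C.
Proof.
move=> [fr fi]; rewrite /cintegral /=; congr Complex.
  by apply: eq_Rintegral => x _; case: (f x).
rewrite -[RHS]mulN1r -RintegralZl//; apply: eq_Rintegral => x _.
by rewrite mulN1r; case: (f x).
Qed.

(** The factor 2 comes from bounding the real and the imaginary part one at a time, each by the
    integral of the modulus. *)
Lemma normc_cintegral_le f : cintegrable mu D f ->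
  normc (cintegral mu D f) <= 2 * \int[mu]_(x in D) cmod f x.
Proof.
move=> If; have [fr fi] := If; have Ic := cintegrable_cmod If.
apply: (le_trans (normc_le_Re_Im _)); rewrite mulr_natl mulr2n /=.
apply: lerD; (apply: le_trans; first exact: le_normr_Rintegral);
  apply: le_Rintegral => //; try exact: integrable_norm.
- by move=> x _; exact: normr_Re_le_normc.
- by move=> x _; exact: normr_Im_le_normc.
Qed.

Lemma normc_cintegral_le_bound f (g : T -> R) : cintegrable mu D f ->
  mu.-integrable D (EFin \o g) -> (forall x, D x -> normc (f x) <= g x) ->
  normc (cintegral mu D f) <= 2 * \int[mu]_(x in D) g x.
Proof.
move=> If Ig fg; apply: (le_trans (normc_cintegral_le If)).
by rewrite ler_wpM2l//; apply: le_Rintegral => //; exact: cintegrable_cmod.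
Qed.

Lemma cintegral_mrestr f : cmeasurable_fun setT f ->
  cintegral (mrestr mu mD) setT f = cintegral mu D f.
Proof.
by move=> [fr fi]; rewrite /cintegral /Rintegral !integral_mrestr//; exact/measurable_EFinP.
Qed.

End cintegral.

Section complex_Fubini.
Context d1 d2 (T1 : measurableType d1) (T2 : measurableType d2) (R : realType).
Variable m1 : {sigma_finite_measure set T1 -> \bar R}.
Variable m2 : {sigma_finite_measure set T2 -> \bar R}.

Lemma cmeasurable_fun_section_integral (B : set T2) (f : T1 * T2 -> R[i]) :
  measurable B -> cmeasurable_fun setT f ->
  cmeasurable_fun setT (fun x => cintegral m2 B (fun y => f (x, y))).
Proof.
move=> mB [fr fi]; split.
- exact: (measurable_fun_section_integral m2 mB fr).
- exact: (measurable_fun_section_integral m2 mB fi).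
Qed.

Variables (A : set T1) (B : set T2) (mA : measurable A) (mB : measurable B).
Let mAB : measurable (A `*` B) := measurableX mA mB.

Lemma cintegrable_setX_tensor (f : T1 * T2 -> R[i]) (g : T1 -> R) (h : T2 -> R) :
  cmeasurable_fun setT f ->
  m1.-integrable A (EFin \o g) -> m2.-integrable B (EFin \o h) ->
  (forall x y, A x -> B y -> normc (f (x, y)) <= g x * h y) ->
  cintegrable (m1 \x m2)%E (A `*` B) f.
Proof.
move=> mf Ig Ih fgh; apply/cintegrableP => //; first exact: cmeasurable_funTS.
apply: (integrable_setX_tensor mA mB _ Ig Ih); first exact: measurable_cmod.
by move=> x y Ax By; rewrite ger0_norm ?normc_ge0//; exact: fgh.
Qed.

Lemma cintegral_setX12 (f : T1 * T2 -> R[i]) :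
  cintegrable (m1 \x m2)%E (A `*` B) f ->
  cintegrable m1 A (fun x => cintegral m2 B (fun y => f (x, y))) /\
  cintegral m1 A (fun x => cintegral m2 B (fun y => f (x, y))) =
  cintegral (m1 \x m2)%E (A `*` B) f.
Proof.
move=> [fr fi]; have [? Er] := Rintegral_setX12 mA mB fr.
have [? Ei] := Rintegral_setX12 mA mB fi.
by split; [split|rewrite /cintegral/= Er Ei].
Qed.

Lemma cintegral_setX21 (f : T1 * T2 -> R[i]) :
  cintegrable (m1 \x m2)%E (A `*` B) f ->
  cintegrable m2 B (fun y => cintegral m1 A (fun x => f (x, y))) /\
  cintegral m2 B (fun y => cintegral m1 A (fun x => f (x, y))) =
  cintegral (m1 \x m2)%E (A `*` B) f.
Proof.
move=> [fr fi]; have [? Er] := Rintegral_setX21 mA mB fr.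
have [? Ei] := Rintegral_setX21 mA mB fi.
by split; [split|rewrite /cintegral/= Er Ei].
Qed.

Lemma cintegral_swap (f : T1 * T2 -> R[i]) :
  cintegrable (m1 \x m2)%E (A `*` B) f ->
  cintegral m1 A (fun x => cintegral m2 B (fun y => f (x, y))) =
  cintegral m2 B (fun y => cintegral m1 A (fun x => f (x, y))).
Proof. by move=> If; rewrite (cintegral_setX12 If).2 (cintegral_setX21 If).2. Qed.

End complex_Fubini.

(** * Square integrable functions *)

Local Open Scope quotient_scope.


Section L2_facts.
Context d (T : measurableType d) (R : realType) (mu : {measure set T -> \bar R}).
Implicit Types f g : T -> R[i].

Lemma Lnorm2_cmodE f :
  'N[mu]_2%:E[EFin \o cmod f]%E = ((\int[mu]_x (cmod f x ^+ 2)%:E) `^ 2^-1)%E.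
Proof.
rewrite unlock /Lnorm; congr (_ `^ _)%E; apply: eq_integral => x _ /=.
by rewrite powR_mulrn// ger0_norm// normc_ge0.
Qed.

Lemma in_L2P f : in_L2 mu f <->
  cmeasurable_fun setT f /\ mu.-integrable setT (fun x => (cmod f x ^+ 2)%:E).
Proof.
have absE : (fun x => `|(cmod f x ^+ 2)%:E|%E) = fun x => (cmod f x ^+ 2)%:E.
  by apply/funext => x; rewrite gee0_abs// lee_fin sqr_ge0.
split => -[mf nf]; split => //.
  apply/integrableP; split.
    by apply/measurable_EFinP; apply: measurable_funX; exact: measurable_cmod.
  rewrite absE; move: nf; rewrite /finite_norm Lnorm2_cmodE; apply: lty_poweRy.
  by rewrite invr_eq0 pnatr_eq0.
rewrite /finite_norm Lnorm2_cmodE; apply: poweR_lty.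
by have /integrableP[_] := nf; rewrite absE.
Qed.

Lemma in_L2_measurable f : in_L2 mu f -> cmeasurable_fun setT f.
Proof. by case. Qed.

Lemma in_L2_fun (u : L2 mu) : in_L2 mu (L2_fun u).
Proof. by rewrite /L2_fun; case: (repr u) => f /= /Lfun2cP. Qed.

Lemma in_L2_le f g (C : R) : cmeasurable_fun setT g -> in_L2 mu f ->
  (\forall x \ae mu, normc (g x) <= C * normc (f x)) -> in_L2 mu g.
Proof.
move=> mg /in_L2P[mf If] fg; apply/in_L2P; split => //.
have mg2 : measurable_fun setT (fun x => (cmod g x ^+ 2)%:E).
  by apply/measurable_EFinP; apply: measurable_funX; exact: measurable_cmod.
apply/integrableP; split => //.
have := integrableZl measurableT (C ^+ 2) If; move/integrableP => [mCf].
apply: le_lt_trans; apply: ae_ge0_le_integral => //.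
- exact: measurableT_comp.
- exact: measurableT_comp.
apply: filterS fg => x fg _; rewrite -EFinM !gee0_abs ?lee_fin ?(mulr_ge0 (sqr_ge0 C) (sqr_ge0 _)) ?sqr_ge0//.
rewrite -exprMn; have g0 := normc_ge0 (g x).
by rewrite lerXn2r ?nnegrE//; exact: le_trans fg.
Qed.

Lemma in_L2_bounded g (C : R) : (mu setT < +oo)%E -> cmeasurable_fun setT g ->
  (\forall x \ae mu, normc (g x) <= C) -> in_L2 mu g.
Proof.
move=> muT mg gC; apply: (@in_L2_le (fun=> 1) g C) => //.
  apply/in_L2P; split; first exact: cmeasurable_fun_cst.
  apply: (eq_integrable measurableT (fun=> (1 : R)%:E)).
    by move=> x _; rewrite /cmod Normc.normc1 expr1n.
  apply/integrableP; split => //.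
  by under eq_integral do rewrite gee0_abs ?lee_fin//; rewrite integral_cst//= mul1e.
by apply: filterS gC => x; rewrite Normc.normc1 mulr1.
Qed.

(** For square integrable functions the default branch of [L2_class] is not taken, so the class can
    be handled as the quotient class of the function itself. *)
Lemma L2_classE f : in_L2 mu f -> exists h : L2fun mu,
  (h : T -> R[i]) = f /\ L2_class mu f = \pi_(L2 mu) h.
Proof.
move=> /Lfun2cP fL; exists (MkL2fun fL); split => //.
by rewrite /L2_class; congr (\pi_(L2 mu) _); apply: val_inj; rewrite val_insubd fL.
Qed.

Lemma L2_class_ae f g : in_L2 mu f -> in_L2 mu g ->
  L2_class mu f = L2_class mu g <-> \forall x \ae mu, f x = g x.
Proof. by move=> /L2_classE[h [<- ->]] /L2_classE[k [<- ->]]; exact: L2_eqP. Qed.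

Lemma L2_fun_class f : in_L2 mu f -> \forall x \ae mu, L2_fun (L2_class mu f) x = f x.
Proof. by move=> /L2_classE[h [<- ->]]; exact: repr_piE. Qed.

Lemma L2_classK (u : L2 mu) : L2_class mu (L2_fun u) = u.
Proof.
rewrite /L2_class -[RHS]reprK; congr (\pi_(L2 mu) _); apply: val_inj.
by rewrite val_insubd; case: ifPn => // /negP; case; apply/Lfun2cP; exact: in_L2_fun.
Qed.

Lemma in_L2_comb (a : R[i]) f g : in_L2 mu f -> in_L2 mu g ->
  in_L2 mu (fun x => a * f x + g x).
Proof. exact: in_L2_lin. Qed.

Lemma L2_class_comb (a : R[i]) f g : in_L2 mu f -> in_L2 mu g ->
  L2_class mu (fun x => a * f x + g x) = a *: L2_class mu f + L2_class mu g.
Proof.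
move=> fL gL; have := in_L2_comb a fL gL.
move: fL gL => /L2_classE[h [<- ->]] /L2_classE[k [<- ->]] /L2_classE[l [lE ->]].
change (\pi_(L2 mu) l = L2_scale a (\pi_(L2 mu) h) + \pi_(L2 mu) k).
by rewrite L2_scale_pi -L2_addE; apply/L2_eqP; apply: aeW => x; rewrite lE.
Qed.

Lemma L2_normrE f : in_L2 mu f ->
  `|L2_class mu f| = (Num.sqrt (\int[mu]_x (cmod f x ^+ 2)))%:C%C.
Proof.
move=> /L2_classE[h [<- ->]]; change (L2_norm (\pi_(L2 mu) h) = (Num.sqrt (\int[mu]_x (cmod h x ^+ 2)))%:C%C).
rewrite L2_normE Lnorm2_cmodE fine_poweR powR12_sqrt//.
by apply: fine_ge0; apply: integral_ge0 => x _; rewrite lee_fin sqr_ge0.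
Qed.

Lemma cmod2_norm_fun (u : L2 mu) (M : R) : `|u| <= M%:C%C ->
  \int[mu]_x (cmod (L2_fun u) x ^+ 2) <= M ^+ 2.
Proof.
rewrite -{1}(L2_classK u) L2_normrE; last exact: in_L2_fun.
rewrite lecR => h.
have I0 : 0 <= \int[mu]_x (cmod (L2_fun u) x ^+ 2) by apply: Rintegral_ge0 => x _; exact: sqr_ge0.
rewrite -(sqr_sqrtr I0) lerXn2r ?nnegrE ?sqrtr_ge0//.
exact: le_trans h.
Qed.

Lemma L2_dist_class f g : in_L2 mu f -> in_L2 mu g ->
  `|L2_class mu f - L2_class mu g| =
  (Num.sqrt (\int[mu]_x (normc (f x - g x) ^+ 2)))%:C%C.
Proof.
move=> fL gL.
have -> : L2_class mu f - L2_class mu g = L2_class mu (fun x => (-1) * g x + f x).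
  by rewrite L2_class_comb// scaleN1r addrC.
rewrite L2_normrE; last exact: in_L2_comb.
by congr (Num.sqrt _)%:C%C; apply: eq_Rintegral => x _; rewrite /cmod mulN1r addrC.
Qed.

(** Dominated convergence for the squared distance. A single index close to the limit is all that a
    closure argument asks for. *)
Lemma L2_cvg_dominated (f_ : (T -> R[i])^nat) f (G : T -> R) (e : R) :
  (forall n, cmeasurable_fun setT (f_ n)) -> cmeasurable_fun setT f ->
  mu.-integrable setT (fun x => (G x ^+ 2)%:E) ->
  (\forall x \ae mu, forall n, normc (f_ n x) <= G x) ->
  (\forall x \ae mu, normc (f x) <= G x) ->
  (\forall x \ae mu, normc (f_ n x - f x) @[n --> \oo] --> (0 : R)) ->
  0 < e ->
  [/\ forall n, in_L2 mu (f_ n), in_L2 mu f &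
    exists n, `|L2_class mu (f_ n) - L2_class mu f| < e%:C%C].
Proof.
move=> mf_ mf IG f_G fG cf e0.
have inL g : cmeasurable_fun setT g -> (\forall x \ae mu, normc (g x) <= G x) -> in_L2 mu g.
  move=> mg gG; apply/in_L2P; split => //; apply/integrableP; split.
    by apply/measurable_EFinP; apply: measurable_funX; exact: measurable_cmod.
  have /integrableP[mG] := IG; apply: le_lt_trans; apply: ae_ge0_le_integral => //.
  - apply: measurableT_comp => //; apply/measurable_EFinP.
    by apply: measurable_funX; exact: measurable_cmod.
  - exact: measurableT_comp.
  apply: filterS gG => x gG _; rewrite !gee0_abs ?lee_fin ?sqr_ge0//.
  by rewrite lerXn2r ?nnegrE ?normc_ge0//; apply: le_trans gG; exact: normc_ge0.
have fnL n : in_L2 mu (f_ n) by apply: inL => //; apply: filterS f_G => x.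
have fL : in_L2 mu f by exact: inL.
split => //.
have mB n : cmeasurable_fun setT (fun x => f_ n x - f x).
  rewrite (_ : (fun x => _) = fun x => (-1) * f x + f_ n x).
    exact: cmeasurable_fun_lin.
  by apply/funext => x; rewrite mulN1r addrC.
have mB2 n : measurable_fun setT (fun x => (normc (f_ n x - f x) ^+ 2)%:E).
  by apply/measurable_EFinP; apply: measurable_funX; exact: measurable_cmod (mB n).
have cB2 : \forall x \ae mu, setT x ->
    (normc (f_ n x - f x) ^+ 2)%:E @[n --> \oo] --> (0 : \bar R)%E.
  apply: filterS cf => x cfx _; apply: cvg_EFin; first exact: nearW.
  by rewrite -[X in _ --> X](mulr0 (0 : R)); exact: cvgM.
(* The distance of [f_ n x] to [f x] is at most [2 * G x], whose square is the majorant. *)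
have IG4 : mu.-integrable setT (fun x => (4 * G x ^+ 2)%:E).
  by under eq_fun do rewrite EFinM; exact: integrableZl.
have dom : \forall x \ae mu, forall n, setT x ->
    (`|(normc (f_ n x - f x) ^+ 2)%:E| <= (4 * G x ^+ 2)%:E)%E.
  apply: filterS2 f_G fG => x f_Gx fGx n _; rewrite gee0_abs ?lee_fin ?sqr_ge0//.
  rewrite (_ : 4 * G x ^+ 2 = (G x + G x) ^+ 2); last by ring.
  have h : normc (f_ n x - f x) <= G x + G x.
    by apply: (le_trans (le_normcD _ _)); apply: lerD => //; rewrite normc_opp.
  by rewrite lerXn2r ?nnegrE ?normc_ge0//; apply: le_trans h; exact: normc_ge0.
have [_ _] := dominated_convergence measurableT mB2 (measurable_cst 0%E) cB2 IG4 dom.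
rewrite integral0 => /fine_cvgP[_] /cvgr0_norm_lt /(_ _ (exprn_gt0 2 e0))[N _ /(_ N (leqnn _))].
move=> /= h; exists N; rewrite L2_dist_class// ltcR.
rewrite -(ger0_norm (ltW e0)) -sqrtr_sqr ltr_sqrt ?exprn_gt0//.
by apply: le_lt_trans h; exact: ler_norm.
Qed.

End L2_facts.

Section L2_restricted.
Context d (T : measurableType d) (R : realType) (mu : {measure set T -> \bar R}).
Variables (D : set T) (mD : measurable D).
Hypothesis muD : (mu D < +oo)%E.
Local Notation muD_ := (mrestr mu mD).

Lemma mrestr_setT_lty : (muD_ setT < +oo)%E.
Proof. by rewrite /= /mrestr setTI. Qed.

Lemma integrable_cst_lty (c : R) : mu.-integrable D (EFin \o (fun=> c)).
Proof.
apply/integrableP; split; first by apply/measurable_EFinP; exact: measurable_cst.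
rewrite [X in (X < _)%E](_ : _ = \int[mu]_(x in D) (`|c|)%:E)%E//.
by rewrite integral_cst//; apply: lte_mul_pinfty => //; rewrite lee_fin.
Qed.

(** On a finite measure space L2 is contained in L1, by r <= 1 + r ^ 2. *)
Lemma in_L2_cintegrable f : in_L2 muD_ f -> cintegrable mu D f.
Proof.
move=> /in_L2P[mf /integrableP[m2 I2]].
have I2' : mu.-integrable D (fun x => (cmod f x ^+ 2)%:E).
  apply/integrableP; split; first exact: measurable_funTS.
  by rewrite -integral_mrestr//; exact: measurableT_comp.
have I1 := integrable_cst_lty 1.
apply: (@cintegrable_le _ _ _ _ _ mD f (fun x => 1 + cmod f x ^+ 2)).
- exact: cmeasurable_funTS.
- exact: (integrableD mD I1 I2').
- move=> x Dx; rewrite /cmod; have := normc_ge0 (f x); set r := normc _ => r0.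
  have [r1|r1] := leP r 1; first by rewrite (le_trans r1)// lerDl sqr_ge0.
  by rewrite (@le_trans _ _ (r ^+ 2))// ?lerDr// ler_eXnr// ltW.
Qed.

(** The same inequality r <= 1 + r ^ 2, integrated over [D], bounds the L1 norm uniformly on an L2
    ball; it takes the place of Cauchy-Schwarz. *)
Lemma L2_norm_ball_integral (u : L2 muD_) (M : R) : `|u| <= M%:C%C ->
  \int[mu]_(x in D) (cmod (L2_fun u) x) <= fine (mu D) + M ^+ 2.
Proof.
move=> /cmod2_norm_fun; set f := L2_fun u => IM.
have fL : in_L2 muD_ f := in_L2_fun u.
have [mf If2] := (in_L2P _ _).1 fL.
have m2 : measurable_fun setT (fun x => (cmod f x ^+ 2)%:E).
  exact: measurable_int If2.
have I2' : mu.-integrable D (fun x => (cmod f x ^+ 2)%:E).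
  have /integrableP[_ I2] := If2.
  apply/integrableP; split; first exact: measurable_funTS.
  by rewrite -integral_mrestr//; exact: measurableT_comp.
have I1 := integrable_cst_lty 1.
apply: (@le_trans _ _ (\int[mu]_(x in D) (1 + cmod f x ^+ 2))).
  apply: le_Rintegral => //.
  - exact: (cintegrable_cmod mD (in_L2_cintegrable fL)).
  - exact: (integrableD mD I1 I2').
  - move=> x Dx; rewrite /cmod; have := normc_ge0 (f x); set r := normc _ => r0.
    have [r1|r1] := leP r 1; first by rewrite (le_trans r1)// lerDl sqr_ge0.
    by rewrite (@le_trans _ _ (r ^+ 2))// ?lerDr// ler_eXnr// ltW.
rewrite RintegralD// Rintegral_cst// mul1r lerD2l.
by move: IM; rewrite /Rintegral integral_mrestr.
Qed.

Lemma in_L2_restr_bounded g (C : R) : cmeasurable_fun setT g ->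
  (forall x, D x -> normc (g x) <= C) -> in_L2 muD_ g.
Proof.
move=> mg gC; apply: (in_L2_bounded mrestr_setT_lty mg (C := C)).
by apply/ae_mrestr; exact: aeW.
Qed.

End L2_restricted.

Lemma leb_itv_lty (R : realType) (b0 b1 : bool) (a b : R) :
  (@lebesgue_measure R [set` Interval (BSide b0 a) (BSide b1 b)] < +oo)%E.
Proof. by rewrite lebesgue_measure_itv; case: ifP => //= _; rewrite -EFinB ltry. Qed.

(** * Integral operators and their adjoints *)

Lemma cintegral_swap_mulr d1 d2 (T1 : measurableType d1) (T2 : measurableType d2)
    (R : realType) (m1 : {sigma_finite_measure set T1 -> \bar R})
    (m2 : {sigma_finite_measure set T2 -> \bar R}) (A : set T1) (B : set T2)
    (c : R[i]) (f : T1 * T2 -> R[i]) :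
  measurable A -> measurable B -> cintegrable (m1 \x m2)%E (A `*` B) f ->
  cintegral m2 B (fun y => cintegral m1 A (fun x => f (x, y))) * c =
  cintegral m1 A (fun x => cintegral m2 B (fun y => f (x, y)) * c).
Proof.
move=> mA mB If; rewrite -(cintegral_swap mA mB If) -cintegralZr//.
exact: (cintegral_setX12 mA mB If).1.
Qed.

Definition integral_operator d1 d2 (T1 : measurableType d1) (T2 : measurableType d2)
    (R : realType) (mu : {measure set T1 -> \bar R}) (P : set T1)
    (k : T2 * T1 -> R[i]) (u : T1 -> R[i]) (y : T2) : R[i] :=
  cintegral mu P (fun x => k (y, x) * u x).

Section integral_operator.
Context d1 d2 (T1 : measurableType d1) (T2 : measurableType d2) (R : realType).
Variable mu : {sigma_finite_measure set T1 -> \bar R}.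
Variable nu : {sigma_finite_measure set T2 -> \bar R}.
Variables (P : set T1) (I : set T2) (mP : measurable P) (mI : measurable I).
Hypotheses (muP : (mu P < +oo)%E) (nuI : (nu I < +oo)%E).
Variable k : T2 * T1 -> R[i].
Hypotheses (mk : cmeasurable_fun setT k) (k1 : forall z, normc (k z) <= 1).
Implicit Types (u : T1 -> R[i]) (v : T2 -> R[i]).

Local Notation muP_ := (mrestr mu mP).
Local Notation nuI_ := (mrestr nu mI).
Local Notation A := (integral_operator mu P k).

Lemma cmeasurable_kernel_section y : cmeasurable_fun setT (fun x => k (y, x)).
Proof. exact: (cmeasurable_comp mk). Qed.

Lemma cintegrable_kernel_mul u y : cintegrable mu P u ->
  cintegrable mu P (fun x => k (y, x) * u x).
Proof.
move=> Iu; apply: (cintegrable_le mP _ (cintegrable_cmod mP Iu)).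
  apply: cmeasurable_funM; first exact/cmeasurable_funTS/cmeasurable_kernel_section.
  exact: cintegrable_measurable Iu.
by move=> x _; rewrite Normc.normcM ler_piMl// normc_ge0.
Qed.

Lemma cmeasurable_integral_operator u : cmeasurable_fun setT u ->
  cmeasurable_fun setT (A u).
Proof.
move=> mu_; apply: (@cmeasurable_fun_section_integral _ _ _ _ _ mu P
  (fun z => k z * u z.2)) => //.
by apply: cmeasurable_funM => //; exact: (cmeasurable_comp mu_).
Qed.

Lemma normc_integral_operator_le u y : cintegrable mu P u ->
  normc (A u y) <= 2 * \int[mu]_(x in P) cmod u x.
Proof.
move=> Iu; apply: normc_cintegral_le_bound => //.
- exact: cintegrable_kernel_mul.
- exact: cintegrable_cmod.
- by move=> x _; rewrite Normc.normcM ler_piMl// normc_ge0.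
Qed.

Lemma in_L2_integral_operator u : in_L2 muP_ u -> in_L2 nuI_ (A u).
Proof.
move=> uL; apply: (@in_L2_restr_bounded _ _ _ _ _ mI nuI _ (2 * \int[mu]_(x in P) cmod u x)).
  by apply: cmeasurable_integral_operator; exact: in_L2_measurable uL.
by move=> y _; apply: normc_integral_operator_le; exact: in_L2_cintegrable uL.
Qed.

(** The two images are equal as functions, not merely almost everywhere: each value is an integral
    of the input. *)
Lemma ae_eq_integral_operator u1 u2 : cmeasurable_fun setT u1 -> cmeasurable_fun setT u2 ->
  (\forall x \ae muP_, u1 x = u2 x) -> A u1 = A u2.
Proof.
move=> m1 m2 /ae_mrestr u12; apply/funext => y; apply: ae_eq_cintegral => //.
- by apply: cmeasurable_funTS; apply: cmeasurable_funM => //; exact: cmeasurable_kernel_section.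
- by apply: cmeasurable_funTS; apply: cmeasurable_funM => //; exact: cmeasurable_kernel_section.
- by apply: filterS u12 => x h Px; rewrite h.
Qed.

Lemma integral_operator_well_defined : L2_well_defined muP_ nuI_ A.
Proof.
split; first exact: in_L2_integral_operator.
move=> f g /in_L2_measurable mf /in_L2_measurable mg fg.
by rewrite (ae_eq_integral_operator mf mg fg); exact: aeW.
Qed.

Lemma integral_operator_comb (a : R[i]) u1 u2 : in_L2 muP_ u1 -> in_L2 muP_ u2 ->
  A (fun x => a * u1 x + u2 x) = fun y => a * A u1 y + A u2 y.
Proof.
move=> /(in_L2_cintegrable muP) I1 /(in_L2_cintegrable muP) I2; apply/funext => y.
have J1 := cintegrable_kernel_mul y I1; have J2 := cintegrable_kernel_mul y I2.
rewrite /integral_operator -cintegralZl// -cintegralD//; last exact: cintegrableZl.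
by apply: eq_cintegral => x _; rewrite mulrDr mulrCA.
Qed.

Lemma linear_L2_integral_operator : linear (L2_operator muP_ nuI_ A).
Proof.
move=> a u v; have uL := in_L2_fun u; have vL := in_L2_fun v.
rewrite /L2_operator.
rewrite -L2_class_comb; try exact: in_L2_integral_operator.
rewrite -integral_operator_comb//.
have m1 : cmeasurable_fun setT (L2_fun (a *: u + v)) := in_L2_measurable (in_L2_fun _).
have L2c : in_L2 muP_ (fun x => a * L2_fun u x + L2_fun v x) by exact: in_L2_comb.
(* The representative of [a *: u + v] agrees only almost everywhere with the combination of the
   representatives, and the integral does not see the difference. *)
rewrite (ae_eq_integral_operator m1 (in_L2_measurable L2c))//.
have -> : a *: u + v = L2_class muP_ (fun x => a * L2_fun u x + L2_fun v x).
  by rewrite L2_class_comb// !L2_classK.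
exact: L2_fun_class.
Qed.

Definition adjoint_kernel (z : T1 * T2) : R[i] := (k (z.2, z.1))^*%C.

Lemma cmeasurable_adjoint_kernel : cmeasurable_fun setT adjoint_kernel.
Proof.
apply: cmeasurable_fun_conj; apply: (cmeasurable_comp mk).
by apply/measurable_fun_pairP; split; [exact: measurable_snd|exact: measurable_fst].
Qed.

Lemma normc_adjoint_kernel z : normc (adjoint_kernel z) <= 1.
Proof. by rewrite normc_conjc. Qed.

(** Since the kernel has modulus at most 1, the product of the moduli of [u] and [v] is an
    integrable majorant. Both the adjoint relation and the factorization apply Fubini to a function
    of this shape. *)
Lemma cintegrable_kernel_tensor u v : cintegrable mu P u -> cintegrable nu I v ->
  cmeasurable_fun setT u -> cmeasurable_fun setT v ->
  cintegrable (nu \x mu)%E (I `*` P) (fun z => k z * u z.2 * v z.1).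
Proof.
move=> Iu Iv mu_ mv.
apply: (cintegrable_setX_tensor mI mP _ (cintegrable_cmod mI Iv) (cintegrable_cmod mP Iu)).
  apply: cmeasurable_funM; last exact: (cmeasurable_comp mv).
  by apply: cmeasurable_funM => //; exact: (cmeasurable_comp mu_).
move=> y x _ _; rewrite !Normc.normcM mulrC ler_wpM2l ?normc_ge0//.
by rewrite ler_piMl// normc_ge0.
Qed.

End integral_operator.

Section adjoint.
Context d1 d2 (T1 : measurableType d1) (T2 : measurableType d2) (R : realType).
Variable mu : {sigma_finite_measure set T1 -> \bar R}.
Variable nu : {sigma_finite_measure set T2 -> \bar R}.
Variables (P : set T1) (I : set T2) (mP : measurable P) (mI : measurable I).
Hypotheses (muP : (mu P < +oo)%E) (nuI : (nu I < +oo)%E).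
Variable k : T2 * T1 -> R[i].
Hypotheses (mk : cmeasurable_fun setT k) (k1 : forall z, normc (k z) <= 1).

Local Notation muP_ := (mrestr mu mP).
Local Notation nuI_ := (mrestr nu mI).
Local Notation A := (integral_operator mu P k).
Local Notation B := (integral_operator nu I (adjoint_kernel k)).

(** Both inner products are iterated integrals of k (y, x) f (x) conj (g (y)), in opposite
    orders. *)
Lemma integral_operator_adjoint :
  is_adjoint (L2_operator muP_ nuI_ A) (L2_operator nuI_ muP_ B).
Proof.
move=> u v; have uL := in_L2_fun u; have vL := in_L2_fun v.
set f := L2_fun u in uL *; set g := L2_fun v in vL *.
have mf := in_L2_measurable uL; have mg := in_L2_measurable vL.
have If := in_L2_cintegrable muP uL; have Ig := in_L2_cintegrable nuI vL.
have AL : in_L2 nuI_ (A f) := in_L2_integral_operator mI muP nuI mk k1 uL.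
have mk' := cmeasurable_adjoint_kernel mk.
have k1' := normc_adjoint_kernel k1.
have BL : in_L2 muP_ (B g) := in_L2_integral_operator mP nuI muP mk' k1' vL.
have mcg := cmeasurable_fun_conj mg.
have Icg : cintegrable nu I (fun y => (g y)^*%C).
  apply: (cintegrable_le mI _ (cintegrable_cmod mI Ig)); first exact: cmeasurable_funTS.
  by move=> y _; rewrite normc_conjc.
(* The inner product involves a representative of the class of [A f]; it is traded for [A f] itself,
   and likewise for [B g] below. *)
transitivity (cintegral nu I (fun y => A f y * (g y)^*%C)).
  rewrite -cintegral_mrestr; last first.
    by apply: cmeasurable_funM => //; exact: in_L2_measurable AL.
  apply: ae_eq_cintegral => //.
  - by apply: cmeasurable_funM => //; exact: in_L2_measurable (in_L2_fun _).
  - by apply: cmeasurable_funM => //; exact: in_L2_measurable AL.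
  - by apply: filterS (L2_fun_class AL) => y + _; rewrite /L2_operator => ->.
transitivity (cintegral mu P (fun x => f x * (B g x)^*%C)); last first.
  have mcB : cmeasurable_fun setT (fun x => (B g x)^*%C).
    exact/cmeasurable_fun_conj/(in_L2_measurable BL).
  rewrite -cintegral_mrestr; last by apply: cmeasurable_funM.
  apply/esym; apply: ae_eq_cintegral => //.
  - apply: cmeasurable_funM => //; apply: cmeasurable_fun_conj.
    exact: in_L2_measurable (in_L2_fun _).
  - exact: cmeasurable_funM.
  - by apply: filterS (L2_fun_class BL) => x + _; rewrite /L2_operator => ->.
transitivity (cintegral nu I (fun y => cintegral mu P (fun x => k (y, x) * f x * (g y)^*%C))).
  by apply: eq_cintegral => y _; rewrite cintegralZr//; exact: cintegrable_kernel_mul.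
rewrite (cintegral_swap mI mP (cintegrable_kernel_tensor mP mI mk k1 If Icg mf mcg)).
apply: eq_cintegral => x _; rewrite /integral_operator -(cintegral_conj mI); last first.
  exact: cintegrable_kernel_mul.
rewrite -cintegralZl//.
  by apply: eq_cintegral => y _; rewrite /adjoint_kernel/= rmorphM/= conjcK mulrCA mulrA.
have J := cintegrable_kernel_mul mI mk' k1' x Ig.
apply: (cintegrable_le mI _ (cintegrable_cmod mI J)).
  by apply: cmeasurable_fun_conj; exact: cintegrable_measurable J.
by move=> y _; rewrite normc_conjc.
Qed.

Lemma mul_well_defined (m : T1 -> R[i]) (C : R) : cmeasurable_fun setT m ->
  (\forall x \ae mu, P x -> normc (m x) <= C) ->
  L2_well_defined muP_ muP_ (fun u x => m x * u x).
Proof.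
move=> mm mC; split.
  move=> f fL; apply: (in_L2_le (C := C) _ fL).
    by apply: cmeasurable_funM => //; exact: in_L2_measurable fL.
  apply/ae_mrestr; apply: filterS mC => x h Px.
  by rewrite Normc.normcM ler_wpM2r ?normc_ge0//; exact: h.
by move=> f g _ _; apply: filterS => x ->.
Qed.

(** The composition A m B is again an integral operator, with kernel the integral of m k conj (k).
    Here [m] is merely integrable; square integrability is used for [v] only. *)
Lemma integral_operator_mul_adjoint (m : T1 -> R[i]) (v : T2 -> R[i]) :
  cmeasurable_fun setT m -> cintegrable mu P m -> in_L2 nuI_ v ->
  forall y, A (fun x => m x * B v x) y =
  cintegral nu I (fun y' => cintegral mu P (fun x => m x * k (y, x) * (k (y', x))^*%C) * v y').
Proof.
move=> mm Im vL y; have mv := in_L2_measurable vL; have Iv := in_L2_cintegrable nuI vL.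
have mk' := cmeasurable_adjoint_kernel mk.
have k1' := normc_adjoint_kernel k1.
have Ikm := cintegrable_kernel_mul mP mk k1 y Im.
have mkm : cmeasurable_fun setT (fun x => k (y, x) * m x).
  by apply: cmeasurable_funM => //; exact: cmeasurable_kernel_section.
(* With [y] fixed, [k (y, x) * m x] plays the part of the integrable function of [x], paired with
   [v] through the adjoint kernel. *)
transitivity (cintegral mu P (fun x => cintegral nu I (fun y' =>
    adjoint_kernel k (x, y') * v y' * (k (y, x) * m x)))).
  apply: eq_cintegral => x _; rewrite cintegralZr//; last exact: cintegrable_kernel_mul.
  by rewrite mulrA mulrC.
rewrite (cintegral_swap mP mI (cintegrable_kernel_tensor mI mP mk' k1' Iv Ikm mv mkm)).
apply: eq_cintegral => y' _; rewrite -cintegralZr//.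
  apply: eq_cintegral => x _; rewrite /adjoint_kernel/=.
  by rewrite mulrAC; congr (_ * _); rewrite mulrC; congr (_ * _); rewrite mulrC.
have J := cintegrable_kernel_mul mP mk k1 y Im.
apply: (cintegrable_le mP _ (cintegrable_cmod mP J)).
  apply: cmeasurable_funTS; apply: cmeasurable_funM.
    by apply: cmeasurable_funM => //; exact: cmeasurable_kernel_section.
  exact/cmeasurable_fun_conj/cmeasurable_kernel_section.
move=> x _; rewrite Normc.normcM normc_conjc [m x * _]mulrC /cmod.
by rewrite ler_piMr ?normc_ge0.
Qed.

End adjoint.

(** * The factorization *)

(** Well-definedness allows the chosen representative of the class of [f] to be replaced by [f];
    compositions of operators are computed on functions in this way. *)
Lemma L2_operator_class d1 d2 (T1 : measurableType d1) (T2 : measurableType d2)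
    (R : realType) (mu : {measure set T1 -> \bar R}) (nu : {measure set T2 -> \bar R})
    (Phi : (T1 -> R[i]) -> T2 -> R[i]) (f : T1 -> R[i]) :
  L2_well_defined mu nu Phi -> in_L2 mu f ->
  L2_operator mu nu Phi (L2_class mu f) = L2_class nu (Phi f).
Proof.
move=> [PL Pae] fL; have gL := in_L2_fun (L2_class mu f).
apply/L2_class_ae; [exact: PL|exact: PL|].
by apply: Pae => //; exact: L2_fun_class.
Qed.

(** By Tonelli the section integral is itself integrable, hence finite almost everywhere. It selects
    the points [y] at which the time integrals may be exchanged. *)
Lemma ae_section_lty d1 d2 (T1 : measurableType d1) (T2 : measurableType d2)
    (R : realType) (m1 : {sigma_finite_measure set T1 -> \bar R})
    (m2 : {sigma_finite_measure set T2 -> \bar R}) (A : set T1) (B : set T2)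
    (h : T1 * T2 -> \bar R) :
  measurable A -> measurable B -> measurable_fun setT h -> (forall z, 0 <= h z)%E ->
  (\int[m1 \x m2]_(z in A `*` B) h z < +oo)%E ->
  \forall x \ae m1, A x -> (\int[m2]_(y in B) h (x, y) < +oo)%E.
Proof.
move=> mA mB mh h0 hoo; pose g := h \_ (A `*` B).
have mg : measurable_fun setT g.
  by apply/(measurable_restrictT _ (measurableX mA mB)); exact: measurable_funTS.
have g0 z : (0 <= g z)%E by apply: erestrict_ge0.
have mG : measurable_fun setT (fubini_F m2 g) by exact: measurable_fun_fubini_tonelli_F.
have IG : m1.-integrable setT (fubini_F m2 g).
  apply/integrableP; split => //.
  under eq_integral do rewrite gee0_abs ?integral_ge0//.
  rewrite -fubini_tonelli1//; apply: le_lt_trans hoo.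
  by rewrite [leRHS]integral_mkcond.
have := integrable_ae measurableT IG; apply: filterS => x /(_ I) Gx Ax.
rewrite integral_mkcond (_ : (_ \_ B) = fun y => g (x, y)).
  by rewrite -ge0_fin_numE// integral_ge0.
by apply/funext => y; rewrite /g !patchE in_setX (mem_set Ax).
Qed.

Section domain_measure.
Context {R : realType} {d : nat}.

Lemma measurable_dotv (v : 'rV[R]_d) : measurable_fun setT (dotv v).
Proof.
apply: measurable_sum => i; apply: measurable_funM => //.
exact: measurable_rV_coord.
Qed.

Lemma bounded_set_coord (D : set 'rV[R]_d) : bounded_set D ->
  exists2 M : R, 0 <= M & forall v, D v -> forall i, `|v ord0 i| <= M.
Proof.
(* Boundedness provides a bound for each number strictly above [M0], hence [M0 + 1]; the maximum
   with 0 makes it nonnegative. *)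
move=> [M0 [_ DM]]; pose M := Num.max 0 (M0 + 1); exists M; first by rewrite le_max lexx.
move=> v Dv i; have := DM (Num.max 0 (M0 + 1)).
have -> : M0 < Num.max 0 (M0 + 1) by rewrite lt_max ltrDl ltr01 orbT.
move=> /(_ isT v Dv); apply: le_trans.
rewrite -[leRHS]/(mx_norm v) mx_normrE; exact: (le_bigmax _ (fun ij => `|v ij.1 ij.2|) (ord0, i)).
Qed.

Lemma measurable_rV_box (u v : 'rV[R]_d) :
  measurable [set x : 'rV[R]_d | forall i, x ord0 i \in `[u ord0 i, v ord0 i]].
Proof.
rewrite (_ : [set x : 'rV[R]_d | _] = \bigcap_(i in [set: 'I_d])
    (fun x : 'rV[R]_d => x ord0 i) @^-1` `[u ord0 i, v ord0 i]).
  apply: fin_bigcap_measurable => // i _; rewrite -[X in measurable X]setTI.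
  by apply: measurable_rV_coord => //; exact: measurable_itv.
apply/seteqP; split => x h i; first by move=> _; exact: h.
by have := h i Logic.I.
Qed.

Lemma lebesgue_rV_bounded_lty (D : set 'rV[R]_d) : measurable D -> bounded_set D ->
  (lebesgue_rV d D < +oo)%E.
Proof.
move=> mD /bounded_set_coord[M M0 DM].
have mB := measurable_rV_box (const_mx (- M)) (const_mx M).
apply: (@le_lt_trans _ _ (lebesgue_rV d [set v : 'rV[R]_d | forall i,
    v ord0 i \in `[(const_mx (- M) : 'rV[R]_d) ord0 i, (const_mx M : 'rV[R]_d) ord0 i]])).
  apply: le_measure; rewrite ?inE// => v Dv i; rewrite in_itv/= !mxE -ler_norml.
  exact: DM.
by rewrite lebesgue_rV_box ?ltry// => i; rewrite !mxE; lra.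
Qed.

End domain_measure.

Section far_field.
Context {R : realType} {d : nat}.
Variables (D : set 'rV[R]_d) (oD : open D) (bD : bounded_set D) (t1 t2 : R).
Variables (F : R -> R) (K : 'rV[R]_d * R -> R) (xhat : 'rV[R]_d).
Hypotheses (mF : measurable_fun setT F) (mK : measurable_fun setT K).

Local Notation leb := (@lebesgue_measure R).
Local Notation lebd := (@lebesgue_rV R d).
Local Notation J := ([set` `[t1, t2]] : set (measurableTypeR R)).
Local Notation P := (D `*` `[t1, t2] : set ('rV[R]_d * measurableTypeR R)).
Local Notation mu := (sigma_finite_product lebd leb).
Local Notation cyl := (cylinder_measure oD t1 t2).

Let mD : measurable D := open_measurable_rV oD.
Let mJ : measurable J := measurable_itv `[t1, t2].
Let mP : measurable P := measurable_cylinder t1 t2 oD.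

Lemma cylinder_lty : (mu P < +oo)%E.
Proof.
rewrite /sigma_finite_product product_measure1E//.
apply: lte_mul_pinfty => //; last exact: leb_itv_lty.
by rewrite ge0_fin_numE// lebesgue_rV_bounded_lty.
Qed.

(** The kernel of L depends on [(y, t)] through this number alone. Compactness uses that it is
    bounded on the cylinder, density that it takes all values of an interval. *)
Definition phase (p : 'rV[R]_d * measurableTypeR R) : R := dotv xhat p.1 - p.2.

Lemma measurable_phase : measurable_fun setT phase.
Proof.
apply: measurable_funB => //.
by apply: (measurableT_comp (measurable_dotv xhat)).
Qed.

Definition far_field_kernel (z : measurableTypeR R * ('rV[R]_d * measurableTypeR R)) : R[i] :=
  expi (- (z.1 * phase z.2)).

Lemma cmeasurable_far_field_kernel : cmeasurable_fun setT far_field_kernel.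
Proof.
apply: cmeasurable_fun_expi; apply: measurable_funN; apply: measurable_funM => //.
by apply: (measurableT_comp measurable_phase).
Qed.

Lemma normc_far_field_kernel z : normc (far_field_kernel z) <= 1.
Proof. by rewrite normc_expi. Qed.

Local Notation k := far_field_kernel.

(** In [far_field_L] the time integral is the outer one, so the second order of integration in
    Fubini is the relevant one. *)
Lemma far_field_LE u : cintegrable mu P u ->
  far_field_L D t1 t2 xhat u = integral_operator mu P k u.
Proof.
move=> Iu; apply/funext => tau.
exact: (cintegral_setX21 mD mJ (cintegrable_kernel_mul mP cmeasurable_far_field_kernel
  normc_far_field_kernel tau Iu)).2.
Qed.

Lemma measurable_kernel_FKK : measurable_fun setT
  (fun z : ('rV[R]_d * measurableTypeR R) * measurableTypeR R => kernel_FKK F K z.1.1 z.1.2 z.2).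
Proof.
apply: measurable_funM; first apply: measurable_funM.
- apply: (measurableT_comp mF); apply: measurable_funB => //.
  exact: (measurableT_comp measurable_snd).
- apply: (measurableT_comp mK).
  rewrite (_ : (fun x => _) = fst)//.
  by apply/funext => -[[]].
- apply: (measurableT_comp mK); apply/measurable_fun_pairP; split.
    exact: (measurableT_comp measurable_fst measurable_fst).
  exact: measurable_snd.
Qed.

Hypothesis hFK : (ess_sup cyl (fun p =>
      \int[leb]_(s in `[t1, t2]) `|kernel_FKK F K p.1 p.2 s|%:E) < +oo)%E.

Let kernel_mass (p : 'rV[R]_d * measurableTypeR R) :=
  (\int[leb]_(s in J) `|kernel_FKK F K p.1 p.2 s|%:E)%E.

Lemma ae_kernel_bound : exists2 M : R, 0 <= M & \forall p \ae mu, P p -> (kernel_mass p <= M%:E)%E.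
Proof.
have := ess_sup_ge cyl kernel_mass; move: hFK; rewrite -/kernel_mass.
case: (ess_sup cyl kernel_mass) => [r _|//|_] /ae_mrestr ae.
- exists (Num.max 0 r); first by rewrite le_max lexx.
  by apply: filterS ae => p hp /hp /le_trans; apply; rewrite lee_fin le_max lexx orbT.
(* The essential supremum of a nonnegative function is minus infinity only on a space of measure
   zero, where any bound serves. *)
- exists 0 => //; apply: filterS ae => p hp /hp /le_trans; apply.
  by rewrite leNye.
Qed.

Lemma measurable_kernel_mass : measurable_fun setT kernel_mass.
Proof.
pose g := (fun z : ('rV[R]_d * measurableTypeR R) * measurableTypeR R =>
  (`|kernel_FKK F K z.1.1 z.1.2 z.2|%:E)%E) \_ (setT `*` J).
rewrite (_ : kernel_mass = fun p => \int[leb]_s g (p, s))%E.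
  apply: (measurable_fun_fubini_tonelli_F (m2 := leb)) => //.
    apply/(measurable_restrictT _ (measurableX measurableT mJ)).
    apply: measurable_funTS; apply/measurable_EFinP.
    by apply: measurableT_comp => //; exact: measurable_kernel_FKK.
  by move=> z; apply: erestrict_ge0 => // z' _; rewrite lee_fin.
apply/funext => p; rewrite /kernel_mass integral_mkcond; apply: eq_integral => s _.
by rewrite /g !patchE in_setX in_setT.
Qed.

Lemma kernel_mass_ge0 p : (0 <= kernel_mass p)%E.
Proof. by apply: integral_ge0 => s _; rewrite lee_fin. Qed.

Lemma kernel_section_integrable p : (kernel_mass p < +oo)%E ->
  leb.-integrable J (EFin \o (fun s => kernel_FKK F K p.1 p.2 s)).
Proof.
move=> hp; apply/integrableP; split; last exact: hp.
apply: measurable_funTS; apply/measurable_EFinP.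
apply: (measurableT_comp measurable_kernel_FKK (g := fun s : measurableTypeR R => (p, s))).
by apply/measurable_fun_pairP; split; [exact: measurable_cst|exact: measurable_id].
Qed.

(* [far_field_T] multiplies by [multiplier k0 tauc]; the covariance data involve all shifts *)
Definition multiplier (k0 tau : R) (p : 'rV[R]_d * measurableTypeR R) : R[i] :=
  (\cint[leb]_(s in `[t1, t2])
     ((kernel_FKK F K p.1 p.2 s)%:C%C * expi ((k0 + tau) * p.2 - k0 * s)))
  * expi (- (tau * dotv xhat p.1)).

Lemma cmeasurable_kernel_expi (k0 tau : R) : cmeasurable_fun setT
  (fun z : ('rV[R]_d * measurableTypeR R) * measurableTypeR R =>
  ((kernel_FKK F K z.1.1 z.1.2 z.2)%:C%C * expi ((k0 + tau) * z.1.2 - k0 * z.2))).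
Proof.
apply: cmeasurable_funM; first exact: (cmeasurable_fun_real measurable_kernel_FKK).
apply: cmeasurable_fun_expi; apply: measurable_funB; apply: measurable_funM => //.
exact: (measurableT_comp measurable_snd).
Qed.

Lemma cmeasurable_multiplier k0 tau : cmeasurable_fun setT (multiplier k0 tau).
Proof.
apply: cmeasurable_funM.
  exact: (cmeasurable_fun_section_integral leb mJ (cmeasurable_kernel_expi k0 tau)).
apply: cmeasurable_fun_expi; apply: measurable_funN; apply: measurable_funM => //.
exact: (measurableT_comp (measurable_dotv xhat)).
Qed.

Lemma cintegrable_kernel_expi k0 tau p : (kernel_mass p < +oo)%E -> cintegrable leb J
  (fun s => (kernel_FKK F K p.1 p.2 s)%:C%C * expi ((k0 + tau) * p.2 - k0 * s)).
Proof.
move=> /kernel_section_integrable IK.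
apply: (cintegrable_le mJ _ (integrable_norm IK)).
  apply: cmeasurable_funTS; apply: (cmeasurable_comp (cmeasurable_kernel_expi k0 tau)
    (h := fun s : measurableTypeR R => (p, s))).
  by apply/measurable_fun_pairP; split; [exact: measurable_cst|exact: measurable_id].
by move=> s _; rewrite Normc.normcM normc_expi mulr1 /= expr0n addr0 sqrtr_sqr.
Qed.

(** The exponentials have modulus one, so the multiplier is at most twice [kernel_mass], which is
    essentially bounded. *)
Lemma multiplier_bounded k0 tau :
  exists2 C : R, 0 <= C & \forall p \ae mu, P p -> normc (multiplier k0 tau p) <= C.
Proof.
have [M M0 hM] := ae_kernel_bound; exists (2 * M); first by rewrite mulr_ge0.
apply: filterS hM => p hp /hp {}hp.
have hoo : (kernel_mass p < +oo)%E by rewrite (le_lt_trans hp)// ltry.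
rewrite Normc.normcM normc_expi mulr1.
apply: (le_trans (normc_cintegral_le_bound mJ (cintegrable_kernel_expi k0 tau hoo)
  (integrable_norm (kernel_section_integrable hoo)) _)).
  by move=> s _; rewrite Normc.normcM normc_expi mulr1 /= expr0n addr0 sqrtr_sqr.
have hf : kernel_mass p \is a fin_num by rewrite ge0_fin_numE ?kernel_mass_ge0.
by rewrite ler_wpM2l// -lee_fin /Rintegral fineK//; exact: hf.
Qed.

Lemma cintegrable_multiplier k0 tau : cintegrable mu P (multiplier k0 tau).
Proof.
have [C C0 mC] := multiplier_bounded k0 tau.
have mm := cmeasurable_multiplier k0 tau.
apply: (in_L2_cintegrable cylinder_lty (mD := mP)).
apply: (in_L2_bounded (mrestr_setT_lty mP cylinder_lty) mm (C := C)).
exact/ae_mrestr.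
Qed.

(** The covariance integrates over [s] outside and [t] inside, whereas in the multiplier [t] is a
    coordinate of the cylinder and [s] the inner variable. For almost every [y] the kernel is
    integrable in both times and the order can be reversed; the remaining [y] do not affect the
    outer integral. *)
Lemma covariance_dataE tau k0 :
  covariance_data D t1 t2 F K xhat tau k0 = cintegral mu P (multiplier k0 tau).
Proof.
have [M M0 hM] := ae_kernel_bound.
have hP : (\int[mu]_(p in P) kernel_mass p < +oo)%E.
  apply: (@le_lt_trans _ _ (\int[mu]_(p in P) M%:E)%E).
    apply: ae_ge0_le_integral => //.
    - by move=> p _; exact: kernel_mass_ge0.
    - exact: measurable_funTS measurable_kernel_mass.
  by rewrite integral_cst//; apply: lte_mul_pinfty => //; exact: cylinder_lty.
(* For these [y] the function [t => kernel_mass (y, t)] has a finite integral, that is, the kernel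
   is integrable over pairs of times. *)
have good := ae_section_lty mD mJ measurable_kernel_mass kernel_mass_ge0 hP.
rewrite -(cintegral_setX12 mD mJ (cintegrable_multiplier k0 tau)).2.
have mG : cmeasurable_fun setT (fun z : ('rV[R]_d * measurableTypeR R) * measurableTypeR R =>
    (kernel_FKK F K z.1.1 z.2 z.1.2)%:C%C * expi ((k0 + tau) * z.2) * expi (- (k0 * z.1.2))).
  apply: cmeasurable_funM; first apply: cmeasurable_funM.
  - apply: (cmeasurable_comp (cmeasurable_fun_real measurable_kernel_FKK)
      (h := fun z : ('rV[R]_d * measurableTypeR R) * measurableTypeR R => ((z.1.1, z.2), z.1.2))).
    apply/measurable_fun_pairP; split.
      apply/measurable_fun_pairP; split; last exact: measurable_snd.
      exact: (measurableT_comp measurable_fst measurable_fst).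
    exact: (measurableT_comp measurable_snd measurable_fst).
  - by apply: cmeasurable_fun_expi; apply: measurable_funM.
  - apply: cmeasurable_fun_expi; apply: measurable_funN; apply: measurable_funM => //.
    exact: (measurableT_comp measurable_snd).
apply: ae_eq_cintegral => //.
- apply: cmeasurable_funTS; apply: cmeasurable_funM.
    apply: (cmeasurable_fun_section_integral leb mJ
      (f := fun z : 'rV[R]_d * measurableTypeR R => cintegral leb J (fun t =>
        (kernel_FKK F K z.1 t z.2)%:C%C * expi ((k0 + tau) * t) * expi (- (k0 * z.2))))).
    exact: (cmeasurable_fun_section_integral leb mJ mG).
  apply: cmeasurable_fun_expi; apply: measurable_funN; apply: measurable_funM => //.
  exact: measurable_dotv.
- apply: cmeasurable_funTS.
  exact: (cmeasurable_fun_section_integral leb mJ (cmeasurable_multiplier k0 tau)).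
apply: filterS good => y hy /hy {}hy.
(* [G] is known only through its pointwise equation, which keeps it opaque in the exchange of
   integrals. *)
have [G GE] : exists G : measurableTypeR R * measurableTypeR R -> R[i], forall z, G z =
    (kernel_FKK F K y z.1 z.2)%:C%C * expi ((k0 + tau) * z.1) * expi (- (k0 * z.2)).
  by exists (fun z =>
    (kernel_FKK F K y z.1 z.2)%:C%C * expi ((k0 + tau) * z.1) * expi (- (k0 * z.2))).
have mKy : measurable_fun setT (fun z : measurableTypeR R * measurableTypeR R =>
    kernel_FKK F K y z.1 z.2).
  apply: (measurableT_comp measurable_kernel_FKK
    (g := fun z : measurableTypeR R * measurableTypeR R => ((y, z.1), z.2))).
  apply/measurable_fun_pairP; split; last exact: measurable_snd.
  by apply/measurable_fun_pairP; split; [exact: measurable_cst|exact: measurable_fst].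
have mGy : cmeasurable_fun setT G.
  rewrite (funext GE); apply: cmeasurable_funM; first apply: cmeasurable_funM.
  - exact: cmeasurable_fun_real.
  - by apply: cmeasurable_fun_expi; apply: measurable_funM.
  - by apply: cmeasurable_fun_expi; apply: measurable_funN; apply: measurable_funM.
have IG : cintegrable (leb \x leb)%E (J `*` J) G.
  have IK : (leb \x leb)%E.-integrable (J `*` J) (EFin \o (fun z => kernel_FKK F K y z.1 z.2)).
    by apply/integrable_setXP.
  apply: (cintegrable_le _ _ (integrable_norm IK)).
  - exact: measurableX.
  - exact: cmeasurable_funTS.
  - move=> z _; rewrite GE !Normc.normcM !normc_expi !mulr1 /=.
    by rewrite expr0n addr0 sqrtr_sqr.
transitivity (cintegral leb J (fun s => cintegral leb J (fun t => G (t, s))) *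
    expi (- (tau * dotv xhat y))).
  congr (_ * _); apply: eq_cintegral => s _; apply: eq_cintegral => t _.
  by rewrite GE.
rewrite (cintegral_swap_mulr _ mJ mJ IG).
apply: eq_cintegral => t _; congr (_ * _); apply: eq_cintegral => s _.
by rewrite GE /= -mulrA -expiD.
Qed.


(** The shift by [tau - gamma] contributes a time factor that leaves the integral over [s], which
    converges because [kernel_mass p] is finite. Joined to the spatial factor it becomes exp (- i
    (tau - gamma) phase (p)). *)
Lemma multiplier_shift k0 tauc tau gamma p : (kernel_mass p < +oo)%E ->
  multiplier k0 (tauc + tau - gamma) p =
  multiplier k0 tauc p * k (tau, p) * (k (gamma, p))^*%C.
Proof.
move=> hp; have Ip := cintegrable_kernel_expi k0 tauc hp.
transitivity ((cintegral leb J (fun s => (kernel_FKK F K p.1 p.2 s)%:C%C *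
    expi ((k0 + tauc) * p.2 - k0 * s)) * expi ((tau - gamma) * p.2)) *
    expi (- ((tauc + tau - gamma) * dotv xhat p.1))).
  rewrite -cintegralZr// /multiplier; congr (_ * _); apply: eq_cintegral => s _.
  by rewrite -mulrA -expiD; congr (_ * expi _); ring.
rewrite /multiplier /far_field_kernel -expiN -!mulrA -!expiD; congr (_ * expi _).
by rewrite /phase /=; ring.
Qed.

Lemma covariance_data_shift k0 tauc tau gamma :
  covariance_data D t1 t2 F K xhat (tauc + tau - gamma) k0 =
  cintegral mu P (fun p => multiplier k0 tauc p * k (tau, p) * (k (gamma, p))^*%C).
Proof.
rewrite covariance_dataE; apply: ae_eq_cintegral.
- exact: mP.
- exact/cmeasurable_funTS/cmeasurable_multiplier.
- apply: cmeasurable_funTS; apply: cmeasurable_funM.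
    apply: cmeasurable_funM; first exact: cmeasurable_multiplier.
    exact: (cmeasurable_kernel_section cmeasurable_far_field_kernel).
  exact: (cmeasurable_fun_conj (cmeasurable_kernel_section cmeasurable_far_field_kernel _)).
have [M M0] := ae_kernel_bound; apply: filterS => p hp /hp {}hp.
by apply: multiplier_shift; rewrite (le_lt_trans hp)// ltry.
Qed.

Section factorization.
Variables (k0 tauc tauw : R).
Local Notation I := ([set` `]0, tauw[] : set (measurableTypeR R)).
Let mI : measurable I := measurable_itv `]0, tauw[.
Local Notation itv := (interval_measure 0 tauw).
Local Notation A := (integral_operator mu P k).
Local Notation B := (integral_operator leb I (adjoint_kernel k)).
Local Notation m := (multiplier k0 tauc).

Let leb_I_lty : (leb I < +oo)%E := leb_itv_lty false true 0 tauw.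

Let mk := cmeasurable_far_field_kernel.
Let k1 := normc_far_field_kernel.

Lemma far_field_correlationE (phi : R -> R[i]) : in_L2 itv phi ->
  far_field_correlation D t1 t2 F K xhat k0 tauc tauw phi =
  A (fun p => m p * B phi p).
Proof.
move=> phiL; apply/funext => tau.
rewrite (@integral_operator_mul_adjoint _ _ _ _ _ mu leb P I mP mI
  leb_I_lty k mk k1 m phi (cmeasurable_multiplier k0 tauc) (cintegrable_multiplier k0 tauc) phiL).
by apply: eq_cintegral => gamma _; rewrite covariance_data_shift.
Qed.

Lemma far_field_L_well_defined : L2_well_defined cyl itv (far_field_L D t1 t2 xhat).
Proof.
have [AL Aae] := @integral_operator_well_defined _ _ _ _ _ mu leb P I mP mI cylinder_lty
  leb_I_lty k mk k1.
have LA f : in_L2 cyl f -> far_field_L D t1 t2 xhat f = A f.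
  by move=> fL; apply: far_field_LE; exact: (in_L2_cintegrable cylinder_lty fL).
split; first by move=> f fL; rewrite (LA _ fL); exact: AL.
by move=> f g fL gL fg; rewrite (LA _ fL) (LA _ gL); exact: Aae.
Qed.

Lemma far_field_L_operatorE :
  L2_operator cyl itv (far_field_L D t1 t2 xhat) = L2_operator cyl itv A.
Proof.
apply/funext => u; rewrite /L2_operator far_field_LE//.
exact: (in_L2_cintegrable cylinder_lty (in_L2_fun u)).
Qed.

Lemma far_field_T_well_defined : L2_well_defined cyl cyl (far_field_T t1 t2 F K xhat k0 tauc).
Proof.
have [C _ mC] := multiplier_bounded k0 tauc.
exact: (mul_well_defined mP (cmeasurable_multiplier k0 tauc) mC).
Qed.

Let B_well_defined : L2_well_defined itv cyl B.
Proof.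
exact: (@integral_operator_well_defined _ _ _ _ _ leb mu I P mI mP leb_I_lty
  cylinder_lty _ (cmeasurable_adjoint_kernel mk) (normc_adjoint_kernel k1)).
Qed.

(** Well-definedness is inherited from the three factors, through the factorization [FE] at the
    level of functions. *)
Lemma far_field_correlation_well_defined :
  L2_well_defined itv itv (far_field_correlation D t1 t2 F K xhat k0 tauc tauw).
Proof.
have [AL Aae] := far_field_L_well_defined.
have [TL Tae] := far_field_T_well_defined.
have [BL Bae] := B_well_defined.
have LA f : in_L2 cyl f -> far_field_L D t1 t2 xhat f = A f.
  by move=> fL; apply: far_field_LE; exact: (in_L2_cintegrable cylinder_lty fL).
have FE f : in_L2 itv f -> far_field_correlation D t1 t2 F K xhat k0 tauc tauw f =
    far_field_L D t1 t2 xhat (far_field_T t1 t2 F K xhat k0 tauc (B f)).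
  by move=> fL; rewrite LA; [exact: far_field_correlationE|exact/TL/BL].
split; first by move=> f fL; rewrite (FE _ fL); exact/AL/TL/BL.
move=> f g fL gL fg; rewrite (FE _ fL) (FE _ gL); apply: Aae; [exact/TL/BL|exact/TL/BL|].
by apply: Tae; [exact: BL|exact: BL|exact: Bae].
Qed.

Lemma far_field_adjoint :
  is_adjoint (L2_operator cyl itv (far_field_L D t1 t2 xhat)) (L2_operator itv cyl B).
Proof.
rewrite far_field_L_operatorE.
exact: (@integral_operator_adjoint _ _ _ _ _ mu leb P I mP mI cylinder_lty leb_I_lty k mk k1).
Qed.

Lemma far_field_factorization :
  L2_operator itv itv (far_field_correlation D t1 t2 F K xhat k0 tauc tauw) =
  L2_operator cyl itv (far_field_L D t1 t2 xhat) \o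
  L2_operator cyl cyl (far_field_T t1 t2 F K xhat k0 tauc) \o L2_operator itv cyl B.
Proof.
have [AL Aae] := far_field_L_well_defined.
have [TL Tae] := far_field_T_well_defined.
have [BL Bae] := B_well_defined.
apply/funext => u /=; have uL := in_L2_fun u.
rewrite -[L2_operator itv cyl B u]/(L2_class cyl (B (L2_fun u))).
rewrite (L2_operator_class far_field_T_well_defined (BL _ uL)).
rewrite (L2_operator_class far_field_L_well_defined (TL _ (BL _ uL))).
rewrite /L2_operator (far_field_correlationE uL).
rewrite (far_field_LE (in_L2_cintegrable cylinder_lty (TL _ (BL _ uL)))).
by [].
Qed.

End factorization.
End far_field.

(** * Compactness *)

Section lipschitz_ball.
Context {R : realType}.
Variables (M Lam w : R).
Hypotheses (Lam0 : 0 <= Lam) (w0 : 0 < w).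
Local Notation I := ([set` `]0, w[] : set (measurableTypeR R)).
Local Notation itv := (interval_measure 0 w).
Local Notation X := (prod_topology (fun _ : bool * R => R)).

(* the two components, indexed by a boolean, are the real and imaginary parts *)
Definition lipschitz_ball : set X :=
  [set f : X | forall i, f i \in `[- M, M]] `&`
  [set f : X | forall b x y, `|f (b, x) - f (b, y)| <= Lam * `|x - y|].

Lemma continuous_coordinate i : continuous (fun f : X => f i : R).
Proof. by move=> f; exact: (@proj_continuous _ (fun=> R) i f). Qed.

(** Each Lipschitz inequality involves only two coordinates, so it is closed for pointwise
    convergence and cuts a closed subset out of the compact box. *)
Lemma compact_lipschitz_ball : compact lipschitz_ball.
Proof.
apply: compact_closedI.
  apply: (@tychonoff (bool * R)%type (fun=> R) (fun=> [set` `[- M, M]])) => i.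
  exact: segment_compact.
rewrite (_ : [set f : X | _] = \bigcap_(i in [set: bool * R * R])
    ((fun f : X => `|f (i.1.1, i.1.2) - f (i.1.1, i.2)|) @^-1` [set r | r <= Lam * `|i.1.2 - i.2|])).
  apply: closed_bigI => -[[b x] y] _ /=.
  apply: (closed_comp (f := fun f : X => `|f (b, x) - f (b, y)|)); last exact: closed_le.
  by move=> f _; exact: (cvg_norm (cvgB (@continuous_coordinate (b, x) f) (@continuous_coordinate (b, y) f))).
apply/seteqP; split => f fL.
  by move=> [[b x] y] _; exact: fL.
by move=> b x y; exact: (fL ((b, x), y) Logic.I).
Qed.

Definition complex_of_pair (f : X) (x : measurableTypeR R) : R[i] :=
  Complex (f (true, x)) (f (false, x)).

Lemma measurable_lipschitz (f : R -> R) :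
  (forall x y, `|f x - f y| <= Lam * `|x - y|) -> measurable_fun setT f.
Proof.
move=> fL; apply: continuous_measurable_fun => x.
(* Dividing by [Lam + 1] instead of [Lam] covers the case [Lam = 0]. *)
have L1 : 0 < Lam + 1 by rewrite ltr_wpDl.
apply/cvgrPdist_lt => e e0; near=> y.
apply: (le_lt_trans (fL _ _)).
apply: (@le_lt_trans _ _ ((Lam + 1) * `|x - y|)); first by rewrite ler_wpM2r// lerDl.
rewrite mulrC -ltr_pdivlMr//; near: y.
exact: (@nbhsx_ballx _ _ x (e / (Lam + 1)) (divr_gt0 e0 L1)).
Unshelve. all: by end_near. Qed.

Lemma cmeasurable_complex_of_pair (f : X) : lipschitz_ball f ->
  cmeasurable_fun setT (complex_of_pair f).
Proof.
move=> [_ fL]; split; apply: measurable_lipschitz => x y; exact: fL.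
Qed.

Let I_lty : (@lebesgue_measure R I < +oo)%E.
Proof. exact: leb_itv_lty. Qed.

Lemma in_L2_complex_of_pair (f : X) : lipschitz_ball f -> in_L2 itv (complex_of_pair f).
Proof.
move=> fL; apply: (in_L2_restr_bounded _ I_lty (C := M + M)).
  exact: cmeasurable_complex_of_pair.
move=> x _; apply: (le_trans (normc_le_Re_Im _)).
by apply: lerD; rewrite /= ler_norml; [have := fL.1 (true, x)|have := fL.1 (false, x)]; rewrite /= in_itv.
Qed.

(** A neighbourhood for pointwise convergence constrains finitely many values only. The common
    Lipschitz constant spreads this control from a finite grid to the whole interval. *)
Lemma continuous_L2_lipschitz_ball :
  {within lipschitz_ball, continuous (fun f => L2_class itv (complex_of_pair f))}.
Proof.
apply/subspace_continuousP => f fW.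
apply/cvgrPdist_lt => e e0.
have [r r0 ->] := gt0_complexE e0.
(* Each of the two components will be off by at most [3 * eta], hence the 6. The factor [1 + w]
   absorbs the length of the interval, since w < (1 + w) ^ 2. *)
pose eta := r / (6 * (1 + w)).
have w1 : 0 < 1 + w by rewrite addr_gt0.
have eta0 : 0 < eta by rewrite divr_gt0// mulr_gt0.
pose delta := eta / (Lam + 1).
have L1 : 0 < Lam + 1 by rewrite ltr_wpDl.
have delta0 : 0 < delta by rewrite divr_gt0.
(* The grid points [j * delta] with [j < N] reach far enough that every point of []0, w[] has one at
   distance at most [delta] on its left. *)
pose N := (Num.truncn (w / delta)).+1.
have near_grid : \forall g \near f, forall i : bool * 'I_N,
    `|(f : X) (i.1, i.2%:R * delta) - (g : X) (i.1, i.2%:R * delta)| < eta.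
  apply: (@filter_forall X _ (fun (i : bool * 'I_N) (g : X) =>
    `|(f : X) (i.1, i.2%:R * delta) - g (i.1, i.2%:R * delta)| < eta) (nbhs f)) => i.
  have /cvgrPdist_lt/(_ _ eta0) := @continuous_coordinate (i.1, i.2%:R * delta) f.
  by [].
rewrite near_withinE; apply: filterS near_grid => g fg gW.
have dist b x : I x -> `|f (b, x) - g (b, x)| <= 3 * eta.
  rewrite /= in_itv/= => /andP[x0 xw].
  have xd0 : 0 <= x / delta by rewrite divr_ge0// ltW.
  have /andP[j1 j2] := truncn_itv xd0.
  set j := Num.truncn (x / delta) in j1 j2.
  have jN : (j < N)%N.
    by rewrite ltnS; apply: le_truncn; rewrite ler_pM2r ?invr_gt0// ltW.
  have xj : `|x - j%:R * delta| <= delta.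
    move: j1 j2; rewrite ler_pdivlMr// ltr_pdivrMr// -natr1 => j1 j2.
    by rewrite ger0_norm ?subr_ge0//; lra.
  have Ld : Lam * `|x - j%:R * delta| <= eta.
    apply: (@le_trans _ _ (Lam * delta)); first by rewrite ler_wpM2l.
    by rewrite /delta mulrA ler_pdivrMr// mulrDr mulr1 mulrC lerDl ltW.
  have h1 := le_trans (fW.2 b x (j%:R * delta)) Ld.
  have h2 := fg (b, Ordinal jN).
  have h3 := le_trans (gW.2 b x (j%:R * delta)) Ld.
  move: h1 h2 h3 => /= h1 /ltW h2 h3.
  (* Two moves to the grid point, one for each function, and the distance at the grid point: one
     [eta] each. *)
  rewrite (_ : f (b, x) - g (b, x) = (f (b, x) - f (b, j%:R * delta)) +
    (f (b, j%:R * delta) - g (b, j%:R * delta)) - (g (b, x) - g (b, j%:R * delta))); last by ring.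
  apply: (le_trans (ler_normB _ _)); apply: (le_trans (lerD (ler_normD _ _) (lexx _))).
  by rewrite (_ : 3 * eta = eta + eta + eta) ?lerD//; ring.
have mf := cmeasurable_complex_of_pair fW; have mg := cmeasurable_complex_of_pair gW.
have mfg : cmeasurable_fun setT (fun x => complex_of_pair f x - complex_of_pair g x).
  rewrite (_ : (fun x => _) = fun x => (-1) * complex_of_pair g x + complex_of_pair f x).
    exact: cmeasurable_fun_lin.
  by apply/funext => x; rewrite mulN1r addrC.
rewrite L2_dist_class; [|exact: in_L2_complex_of_pair|exact: in_L2_complex_of_pair].
rewrite ltcR -(ger0_norm (ltW r0)) -sqrtr_sqr ltr_sqrt ?exprn_gt0//.
have m2 : measurable_fun setT
    (fun x => (normc (complex_of_pair f x - complex_of_pair g x) ^+ 2)%:E).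
  by apply/measurable_EFinP; apply: measurable_funX; exact: (measurable_cmod mfg).
rewrite /Rintegral integral_mrestr//.
have mI : measurable I by exact: measurable_itv.
have b2 x : I x -> normc (complex_of_pair f x - complex_of_pair g x) ^+ 2 <= (6 * eta) ^+ 2.
  have eta6 : 0 <= 6 * eta by rewrite mulr_ge0// ltW.
  move=> Ix; rewrite lerXn2r ?nnegrE ?normc_ge0//.
  apply: (le_trans (normc_le_Re_Im _)).
  rewrite (_ : 6 * eta = 3 * eta + 3 * eta); last by ring.
  by apply: lerD; exact: dist.
apply: (@le_lt_trans _ _ ((6 * eta) ^+ 2 * w)).
  rewrite -lee_fin fineK; last first.
    rewrite ge0_fin_numE; last by apply: integral_ge0 => x _; rewrite lee_fin sqr_ge0.
    apply: (@le_lt_trans _ _ (\int[lebesgue_measure]_(x in I) ((6 * eta) ^+ 2)%:E)%E).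
      apply: ge0_le_integral => //.
      - by move=> x _; rewrite lee_fin sqr_ge0.
      - exact: measurable_funTS.
    rewrite integral_cst//; apply: lte_mul_pinfty => //.
    by rewrite lee_fin sqr_ge0.
  apply: (@le_trans _ _ (\int[lebesgue_measure]_(x in I) ((6 * eta) ^+ 2)%:E)%E).
    apply: ge0_le_integral => //.
    - by move=> x _; rewrite lee_fin sqr_ge0.
    - exact: measurable_funTS.
  by rewrite integral_cst//= lebesgue_measure_itv/= lte_fin w0 sube0 EFinM.
rewrite (_ : 6 * eta = r / (1 + w)); last by rewrite /eta; field; rewrite gt_eqF.
rewrite expr_div_n mulrAC ltr_pdivrMr ?exprn_gt0// ltr_pM2l ?exprn_gt0//.
by rewrite expr2; nra.
Qed.

End lipschitz_ball.

Lemma L2_bounded_set d (T : measurableType d) (R : realType)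
    (mu : {measure set T -> \bar R}) (B : set (L2 mu)) : bounded_set B ->
  exists2 M : R, 0 <= M & forall u, B u -> `|u| <= M%:C%C.
Proof.
(* The norm takes values in [R[i]], so the bound [M0] is a real element of [R[i]] and is converted
   to an element of [R] strictly above it. *)
move=> [M0 [rM0 BM]]; exists (normc M0 + 1); first by rewrite addr_ge0// normc_ge0.
move=> u Bu; apply: BM => //; apply: (le_lt_trans (real_ler_norm rM0)).
by rewrite -[ `|M0| ]/((normc M0)%:C%C) ltcR ltrDl.
Qed.

Section compact_integral_operator.
Context d1 (T1 : measurableType d1) (R : realType).
Variable mu : {sigma_finite_measure set T1 -> \bar R}.
Variables (P : set T1) (mP : measurable P) (muP : (mu P < +oo)%E) (w : R) (w0 : 0 < w).
Variables (k : measurableTypeR R * T1 -> R[i]) (mk : cmeasurable_fun setT k).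
Variables (k1 : forall z, normc (k z) <= 1) (Lam : R).
Hypothesis Lam0 : 0 <= Lam.
Hypothesis kL : forall x y p, P p -> normc (k (x, p) - k (y, p)) <= Lam * `|x - y|.
Local Notation I := ([set` `]0, w[] : set (measurableTypeR R)).
Let mI : measurable I := measurable_itv `]0, w[.
Let nuI : (@lebesgue_measure R I < +oo)%E.
Proof. exact: leb_itv_lty. Qed.
Local Notation muP_ := (mrestr mu mP).
Local Notation itv := (interval_measure 0 w).
Local Notation A := (integral_operator mu P k).

Lemma lipschitz_integral_operator u x y : cintegrable mu P u ->
  normc (A u x - A u y) <= 2 * Lam * (\int[mu]_(p in P) cmod u p) * `|x - y|.
Proof.
move=> Iu; have Ix := cintegrable_kernel_mul mP mk k1 x Iu.
have Iy := cintegrable_kernel_mul mP mk k1 y Iu.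
have IyN := cintegrableZl mP (-1) Iy.
have -> : A u x - A u y = cintegral mu P (fun p => k (x, p) * u p + (-1) * (k (y, p) * u p)).
  by rewrite cintegralD// cintegralZl// mulN1r.
have Ic := cintegrable_cmod mP Iu.
have Icz : mu.-integrable P (EFin \o (fun p => (Lam * `|x - y|) * cmod u p)).
  exact: (integrableZl mP (Lam * `|x - y|) Ic).
apply: (le_trans (normc_cintegral_le_bound mP (cintegrableD mP Ix IyN) Icz _)).
  move=> p Pp; rewrite mulN1r -mulrBl Normc.normcM ler_wpM2r ?normc_ge0//.
  exact: kL.
by rewrite RintegralZl// le_eqVlt; apply/orP; left; apply/eqP; ring.
Qed.

(** The functions [A u] are defined, bounded and Lipschitz on the whole line, so they lie in a
    Lipschitz ball without any extension from the interval. *)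
Lemma compact_L2_integral_operator : compact_operator (L2_operator muP_ itv A).
Proof.
split; first exact: (linear_L2_integral_operator mI muP nuI mk k1).
move=> B /L2_bounded_set[M M0 BM].
(* [C] bounds the L1 norm of every [u] in [B], by [L2_norm_ball_integral]; sup norm and Lipschitz
   constant of the image are multiples of it. *)
pose C := fine (mu P) + M ^+ 2.
have C0 : 0 <= C by rewrite addr_ge0 ?sqr_ge0// fine_ge0.
have L0 : 0 <= 2 * Lam * C by rewrite !mulr_ge0.
pose W := lipschitz_ball (2 * C) (2 * Lam * C).
have cW : compact ((fun f => L2_class itv (complex_of_pair f)) @` W).
  apply: continuous_compact; last exact: compact_lipschitz_ball.
  exact: continuous_L2_lipschitz_ball.
rewrite precompactE; apply: (subclosed_compact _ cW); first exact: closed_closure.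
(* A compact subset of a normed space is closed, so it contains the closure of the image as soon as
   it contains the image. *)
have clW := compact_closed (@norm_hausdorff _ _) cW.
rewrite [X in _ `<=` X]((closure_id _).1 clW); apply: closure_subset => _ [u Bu <-].
have uL := in_L2_fun u; have Iu := in_L2_cintegrable muP uL.
have uC := L2_norm_ball_integral muP (BM _ Bu).
exists (fun i => if i.1 then Re (A (L2_fun u) i.2) else Im (A (L2_fun u) i.2)).
  split.
    move=> [b x]; rewrite in_itv/= -ler_norml.
    have h : normc (A (L2_fun u) x) <= 2 * C.
      apply: (le_trans (normc_integral_operator_le mP mk k1 x Iu)).
      by rewrite ler_wpM2l.
    apply: le_trans h; case: b; first exact: (normr_Re_le_normc (A (L2_fun u) x)).
    exact: (normr_Im_le_normc (A (L2_fun u) x)).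
  move=> b x y /=.
  have h : normc (A (L2_fun u) x - A (L2_fun u) y) <= 2 * Lam * C * `|x - y|.
    apply: (le_trans (lipschitz_integral_operator x y Iu)).
    by rewrite ler_wpM2r// ler_wpM2l// mulr_ge0.
  apply: le_trans h; case: b.
    exact: (normr_ReB_le_normc (A (L2_fun u) x) (A (L2_fun u) y)).
  exact: (normr_ImB_le_normc (A (L2_fun u) x) (A (L2_fun u) y)).
by rewrite /L2_operator; congr L2_class.
Qed.

End compact_integral_operator.

(** * Density of exponentials *)

(** The norm is complex-valued, and positive elements of [R[i]] are exactly the positive reals; this
    form leaves only real radii. *)
Lemma closure_normcP (R : realType) (V : normedModType R[i]) (S : set V) (u : V) :
  closure S u <-> forall e : R, 0 < e -> exists2 v, S v & `|u - v| < e%:C%C.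
Proof.
split=> [Su e e0|h B /nbhs_ballP[e /= /gt0_complexE[r r0 ->]] eB].
  have e0' : 0 < e%:C%C :> R[i] by rewrite ltcR.
  have [v [Sv]] := Su _ (nbhsx_ballx u _ e0').
  by rewrite -ball_normE /= => uv; exists v.
have [v Sv uv] := h r r0; exists v; split => //; apply: eB.
by rewrite -ball_normE.
Qed.

(** * Second-order estimates for sine and cosine *)

Section sine_cosine_estimates.
Context {R : realType}.
Implicit Types t : R.

Lemma normr_sin_le t : `|sin t| <= `|t|.
Proof. by have := normr_sinB_le t 0; rewrite sin0 !subr0. Qed.

Lemma normr_cos_sub1_le t : `|cos t - 1| <= `|t|.
Proof. by have := normr_cosB_le t 0; rewrite cos0 subr0. Qed.

(** By the mean value theorem f (t) = f' (c) t with [c] between 0 and [t], and the modulus of f' (c)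
    is at most that of [t]. *)
Let MVT0 (f df : R -> R) t : f 0 = 0 -> (forall x : R, is_derive x (1 : R) f (df x)) ->
  (forall x, `|df x| <= `|x|) -> `|f t| <= t ^+ 2.
Proof.
move=> f0 fd dfx.
(* The interval with endpoints [min 0 t] and [max 0 t] treats both signs of [t] at once. *)
have cf : {within `[Num.min 0 t, Num.max 0 t], continuous f}.
  apply: continuous_subspaceT => x; apply: differentiable_continuous.
  by apply/derivable1_diffP; have [] := fd x.
have mm : Num.min 0 t <= Num.max 0 t by rewrite ge_min le_max lexx.
have [c cI] := MVT_segment mm (fun x _ => fd x) cf.
have ct : `|c| <= `|t|.
  move: cI; rewrite in_itv/=; have [t0|t0] := leP 0 t.
    by move=> /andP[c0 ct]; rewrite !ger0_norm.
  move=> /andP[tc c0].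
  by rewrite !ler0_norm ?lerN2// ltW.
have [t0|t0] := leP 0 t.
  rewrite f0 !subr0 => ->.
  rewrite normrM -real_normK ?num_real// expr2 ler_wpM2r//.
  exact: le_trans (dfx _) ct.
rewrite f0 !sub0r => /eqP; rewrite eqr_oppLR => /eqP ->.
rewrite normrN normrM normrN -real_normK ?num_real// expr2 ler_wpM2r//.
exact: le_trans (dfx _) ct.
Qed.

Lemma normr_cos_sub1_le_sqr t : `|cos t - 1| <= t ^+ 2.
Proof.
apply: (MVT0 (f := fun x => cos x - 1) (df := fun x => - sin x)).
- by rewrite cos0 subrr.
- by move=> x; rewrite -[- sin x]subr0; apply: is_deriveB.
- by move=> x; rewrite normrN; exact: normr_sin_le.
Qed.

Lemma normr_sinB_le_sqr t : `|sin t - t| <= t ^+ 2.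
Proof.
apply: (MVT0 (f := fun x => sin x - x) (df := fun x => cos x - 1)).
- by rewrite sin0 subrr.
- exact: normr_cos_sub1_le.
Qed.

End sine_cosine_estimates.

(** * Bernoulli inequalities and step polynomials *)

Section power_estimates.
Context {R : realFieldType}.
Implicit Types y : R.

Lemma bernoulli_ge y n : 0 <= y -> 1 + n%:R * y <= (1 + y) ^+ n.
Proof.
move=> y0; elim: n => [|n IH]; first by rewrite mul0r addr0 expr0.
rewrite exprS -natr1; have n0 : 0 <= n%:R * y by rewrite mulr_ge0.
apply: le_trans (ler_wpM2l _ IH); last by rewrite addr_ge0.
by rewrite mulrDl mulrDr !mul1r; nra.
Qed.

Lemma bernoulli_sub_ge y n : 0 <= y <= 1 -> 1 - n%:R * y <= (1 - y) ^+ n.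
Proof.
move=> /andP[y0 y1]; elim: n => [|n IH]; first by rewrite mul0r subr0 expr0.
rewrite exprS -natr1; have n0 : 0 <= n%:R * y by rewrite mulr_ge0.
apply: le_trans (ler_wpM2l _ IH); last by rewrite subr_ge0.
by nra.
Qed.

(** Multiply by (1 + y) ^ n, which is at least 1 + n y by Bernoulli, and note that (1 - y ^ 2) ^ n
    <= 1. *)
Lemma expr_sub_le y n : 0 <= y <= 1 -> (1 - y) ^+ n <= (1 + n%:R * y)^-1.
Proof.
move=> /andP[y0 y1].
have p0 : 0 < 1 + n%:R * y by rewrite ltr_pwDl// mulr_ge0.
rewrite -[leRHS]mul1r ler_pdivlMr//.
apply: (@le_trans _ _ ((1 - y) ^+ n * (1 + y) ^+ n)).
  by rewrite ler_wpM2l ?bernoulli_ge// exprn_ge0// subr_ge0.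
rewrite -exprMn (_ : (1 - y) * (1 + y) = 1 - y ^+ 2); last by ring.
by rewrite exprn_ile1 ?subr_ge0 ?gerBl ?sqr_ge0// expr_le1.
Qed.

End power_estimates.

(** The exponent [2 ^ n] puts the threshold at 1/2. Below it, Bernoulli gives the lower bound 1 - (2
    x) ^ n; above it, [expr_sub_le] gives the upper bound 1 / (1 + (2 x) ^ n). At 1/2 itself the
    limit is 1 / e. *)
Lemma cvg_step_polynomial (R : realType) (x : R) : 0 <= x <= 1 -> x != 2^-1 ->
  (1 - x ^+ n) ^+ (2 ^ n) @[n --> \oo] --> ((x < 2^-1)%R%:R : R).
Proof.
move=> /andP[x0 x1] x2.
have xn n : 0 <= x ^+ n <= 1 by rewrite exprn_ge0// exprn_ile1.
have geo (r : R) : 0 <= r < 1 -> r ^+ n @[n --> \oo] --> (0 : R).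
  by move=> /andP[r0 r1]; apply: cvg_expr; rewrite ger0_norm.
have [xl|xg] := ltP x 2^-1.
  have gx : (2 * x) ^+ n @[n --> \oo] --> (0 : R).
    by apply: geo; apply/andP; split; [rewrite mulr_ge0|lra].
  have : 1 - (2 * x) ^+ n @[n --> \oo] --> (1 - 0 : R) by apply: cvgB => //; exact: cvg_cst.
  rewrite subr0 => h; apply: (squeeze_cvgr _ h (cvg_cst _)); apply: nearW => n.
  apply/andP; split; last first.
    by rewrite exprn_ile1// ?subr_ge0 ?gerBl; have /andP[] := xn n.
  apply: le_trans (bernoulli_sub_ge (2 ^ n) (xn n)).
  by rewrite natrX exprMn.
have {xg x2}xg : 2^-1 < x by rewrite lt_neqAle eq_sym x2.
have x00 : 0 < x by apply: lt_trans xg; rewrite invr_gt0.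
have h : ((2 * x)^-1) ^+ n @[n --> \oo] --> (0 : R).
  apply: geo; rewrite invr_ge0 mulr_ge0//= invf_lt1 ?mulr_gt0//; lra.
apply: (squeeze_cvgr _ (cvg_cst _) h); apply: nearW => n.
apply/andP; split; first by rewrite exprn_ge0// subr_ge0; have /andP[] := xn n.
apply: (le_trans (expr_sub_le _ (xn n))).
rewrite natrX -exprMn exprVn lef_pV2 ?posrE ?exprn_gt0 ?mulr_gt0//.
  by rewrite lerDr.
by rewrite ltr_pwDl// exprn_ge0// mulr_ge0.
Qed.

(** * Closure of a linear subspace: from exponentials to monomials times exponentials *)

Section density.
Context {R : realType}.
Variables (w : R) (w0 : 0 < w).
Local Notation I := ([set` `]0, w[] : set (measurableTypeR R)).
Local Notation itv := (interval_measure 0 w).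
Variable S : set (L2 itv).
Hypothesis S0 : S 0.
Hypothesis S_comb : forall (a : R[i]) u v, S u -> S v -> S (a *: u + v).
Implicit Types (f g : measurableTypeR R -> R[i]) (h : measurableTypeR R -> R).

Let mI : measurable I := measurable_itv `]0, w[.

Let I_gt0_lt x : I x -> 0 < x < w.
Proof. by rewrite /= in_itv. Qed.

Let I_lty : (@lebesgue_measure R I < +oo)%E.
Proof. exact: leb_itv_lty. Qed.

Let ae_itv (Q : measurableTypeR R -> Prop) : (forall x, I x -> Q x) -> \forall x \ae itv, Q x.
Proof. by move=> h; apply/ae_mrestr; exact: aeW. Qed.

Definition in_closure f : Prop := in_L2 itv f /\ closure S (L2_class itv f).

Lemma in_closure_comb (a : R[i]) f g : in_closure f -> in_closure g ->
  in_closure (fun x => a * f x + g x).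
Proof.
move=> [fL cf] [gL cg]; split; first exact: in_L2_comb.
rewrite L2_class_comb//; apply/closure_normcP => e e0.
have a1 : 0 < normc a + 1 by rewrite ltr_wpDl// normc_ge0.
(* The [+ 1] allows [a = 0]. *)
have e1 : 0 < e / 2 / (normc a + 1) by rewrite !divr_gt0.
have [u Su fu] := (closure_normcP _ _).1 cf _ e1.
have e2 : 0 < e / 2 by rewrite divr_gt0.
have [v Sv gv] := (closure_normcP _ _).1 cg _ e2.
exists (a *: u + v); first exact: S_comb.
rewrite (_ : _ - _ = a *: (L2_class itv f - u) + (L2_class itv g - v)); last first.
  by rewrite scalerBr opprD addrACA.
apply: (le_lt_trans (ler_normD _ _)); rewrite normrZ.
rewrite [e in ltRHS](_ : e = e / 2 + e / 2); last by rewrite -splitr.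
rewrite rmorphD; apply: ler_ltD => //.
rewrite -[ `|a| ]/((normc a)%:C%C).
apply: (@le_trans _ _ ((normc a)%:C%C * (e / 2 / (normc a + 1))%:C%C)).
  apply: ler_wpM2l; last exact: ltW.
  by rewrite lecE /= eqxx normc_ge0.
rewrite -rmorphM lecR mulrA ler_pdivrMr// mulrC ler_wpM2l ?ltW//.
by rewrite ltrDl.
Qed.

Lemma ae_eq_in_closure f g : in_closure f -> cmeasurable_fun setT g ->
  (forall x, I x -> f x = g x) -> in_closure g.
Proof.
move=> [fL cf] mg fg; have gL : in_L2 itv g.
  apply: (in_L2_le (C := 1) mg fL); apply: ae_itv => x Ix.
  by rewrite mul1r fg.
split => //; rewrite -(_ : L2_class itv f = L2_class itv g)//.
by apply/L2_class_ae => //; exact: ae_itv.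
Qed.

Lemma in_closure0 : in_closure (fun=> 0).
Proof.
have L : in_L2 itv (fun=> 0 : R[i]) by exact: in_L2_0.
split => //; apply: subset_closure.
have -> : L2_class itv (fun=> 0) = (-1) *: L2_class itv (fun=> 0) + L2_class itv (fun=> 0).
  rewrite -L2_class_comb//; congr L2_class.
  by apply/funext => x; rewrite mulr0 addr0.
by rewrite scaleN1r addNr.
Qed.

(** Dominated convergence puts some [f_ n] within [e / 2] of the limit, and [S] has a point within
    [e / 2] of that [f_ n]. *)
Lemma in_closure_dominated (f_ : (measurableTypeR R -> R[i])^nat) f h :
  (forall n, in_closure (f_ n)) -> cmeasurable_fun setT f ->
  itv.-integrable setT (fun x => (h x ^+ 2)%:E) ->
  (forall n x, I x -> normc (f_ n x) <= h x) ->
  (forall x, I x -> normc (f x) <= h x) ->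
  (\forall x \ae itv, normc (f_ n x - f x) @[n --> \oo] --> (0 : R)) ->
  in_closure f.
Proof.
move=> cf_ mf Ih f_h fh f_f.
have mf_ n : cmeasurable_fun setT (f_ n) := in_L2_measurable (cf_ n).1.
have dom e := @L2_cvg_dominated _ _ _ itv f_ f h e mf_ mf Ih
  (ae_itv (fun x Ix n => f_h n x Ix)) (ae_itv fh) f_f.
have [fnL fL _] := dom 1 ltr01.
split => //; apply/closure_normcP => e e0.
have e2 : 0 < e / 2 by rewrite divr_gt0.
have [_ _ [n fn]] := dom _ e2.
have [v Sv fv] := (closure_normcP _ _).1 (cf_ n).2 _ e2.
exists v => //; rewrite [e in ltRHS](_ : e = e / 2 + e / 2); last by rewrite -splitr.
rewrite rmorphD -(subrKA (L2_class itv (f_ n))).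
by apply: (le_lt_trans (ler_normD _ _)); apply: ltrD => //; rewrite distrC.
Qed.

Lemma integrable_itv_cst (c : R) : itv.-integrable setT (fun=> (c ^+ 2)%:E).
Proof. exact: (integrable_cst_lty (D := setT) measurableT (mrestr_setT_lty mI I_lty) (c ^+ 2)). Qed.

Lemma in_closure_bounded (f_ : (measurableTypeR R -> R[i])^nat) f (c : R) :
  (forall n, in_closure (f_ n)) -> cmeasurable_fun setT f ->
  (forall n x, I x -> normc (f_ n x) <= c) ->
  (forall x, I x -> normc (f x) <= c) ->
  (\forall x \ae itv, normc (f_ n x - f x) @[n --> \oo] --> (0 : R)) ->
  in_closure f.
Proof.
move=> cf_ mf f_c fc f_f.
exact: (in_closure_dominated (h := fun=> c) cf_ mf (integrable_itv_cst c)).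
Qed.

Variables (a b : R).
Hypothesis S_expi : forall s, a < s < b -> in_closure (fun x => expi (- (x * s))).

Let measurable_expi (s : R) :
  cmeasurable_fun setT (fun x : measurableTypeR R => expi (- (x * s))).
Proof. by apply: cmeasurable_fun_expi; apply: measurable_funN; exact: measurable_funM. Qed.

Let measurable_monomial n (s : R) : cmeasurable_fun setT
  (fun x : measurableTypeR R => (x ^+ n)%:C%C * expi (- (x * s))).
Proof.
apply: cmeasurable_funM => //; apply: cmeasurable_fun_real.
exact: measurable_funX.
Qed.

(* [x^(n+1) e^(-ixs)] is, up to the factor [i], the derivative in [s] of [x^n e^(-ixs)] *)
Lemma in_closure_monomial n s : a < s < b ->
  in_closure (fun x => (x ^+ n)%:C%C * expi (- (x * s))).
Proof.
elim: n s => [|n IH] s sab.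
  apply: (ae_eq_in_closure (S_expi sab)) => // x _.
  by rewrite expr0 mul1r.
have /andP[sa sb] := sab.
(* With [m.+2] rather than [m.+1], the point [s + d m] stays strictly below [b] already at
   [m = 0]. *)
pose d m := (b - s) / m.+2%:R.
have bs : 0 < b - s by rewrite subr_gt0.
have d0 m : 0 < d m by rewrite divr_gt0.
have dm m : a < s + d m < b.
  rewrite (lt_trans sa) ?ltrDl// -ltrBrDl ltr_pdivrMr//.
  by rewrite ltr_pMr// ltr1n.
(* [c m] is i / d m: the factor i cancels the - i produced by differentiating exp (- i x s) in [s].
   The trailing zero in [f_] gives it the shape of two nested combinations. *)
pose c m : R[i] := Complex 0 (d m)^-1.
pose f_ m x := c m * ((x ^+ n)%:C%C * expi (- (x * (s + d m)))) +
  ((- c m) * ((x ^+ n)%:C%C * expi (- (x * s))) + 0).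
have f_E m x : f_ m x = ((x ^+ n)%:C%C * expi (- (x * s))) * (c m * (expi (- (x * d m)) - 1)).
  by rewrite /f_ mulrDr opprD expiD; ring.
have nx (x : R) : 0 < x -> normc (x ^+ n)%:C%C = x ^+ n.
  by move=> x0; rewrite /= expr0n addr0 sqrtr_sqr ger0_norm// exprn_ge0// ltW.
have nc m : normc (c m) = (d m)^-1.
  by rewrite /= expr0n add0r sqrtr_sqr ger0_norm// invr_ge0 ltW.
(* The Lipschitz bound 2 x d m for the exponential cancels the division by d m and leaves 2 x ^ (n +
   1), with x < w. *)
apply: (in_closure_bounded (f_ := f_) (c := 2 * w ^+ n.+1)).
- move=> m; apply: in_closure_comb; first exact: IH.
  by apply: in_closure_comb; [exact: IH|exact: in_closure0].
- exact: measurable_monomial.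
- move=> m x /I_gt0_lt/andP[x0 xw].
  rewrite f_E !Normc.normcM normc_expi mulr1 nx// nc.
  have h1 := normc_expiB_le (- (x * d m)) 0.
  rewrite expi0 subr0 normrN ger0_norm in h1; last by rewrite mulr_ge0// ltW.
  apply: (@le_trans _ _ (x ^+ n * ((d m)^-1 * (2 * (x * d m))))).
    by rewrite ler_wpM2l ?exprn_ge0 ?(ltW x0)// ler_wpM2l// invr_ge0 ltW.
  rewrite (_ : x ^+ n * _ = 2 * x ^+ n.+1); last first.
    by rewrite exprS; field; rewrite gt_eqF.
  by rewrite ler_wpM2l// lerXn2r ?nnegrE ?ltW.
- move=> x /I_gt0_lt/andP[x0 xw].
  rewrite Normc.normcM normc_expi mulr1 /= expr0n addr0 sqrtr_sqr.
  rewrite ger0_norm ?exprn_ge0 ?(ltW x0)//.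
  apply: (@le_trans _ _ (w ^+ n.+1)); first by rewrite lerXn2r ?nnegrE ?ltW.
  by rewrite ler_peMl ?exprn_ge0 ?(ltW w0)// ler1n.
apply: ae_itv => x /I_gt0_lt/andP[x0 xw].
have cd : x ^+ n * (2 * x ^+ 2 * d m) @[m --> \oo] --> (0 : R).
  rewrite -(mulr0 (x ^+ n)); apply: cvgM; first exact: cvg_cst.
  rewrite -(mulr0 (2 * x ^+ 2)); apply: cvgM; first exact: cvg_cst.
  rewrite -(mulr0 (b - s)); apply: cvgM; first exact: cvg_cst.
  apply/cvgrPdist_lt => e e0; have [N _ hN] := near_infty_natSinv_lt (PosNum e0).
  exists N => // m Nm; rewrite sub0r normrN ger0_norm ?invr_ge0//.
  apply: le_lt_trans (hN m Nm); rewrite lef_pV2 ?posrE// ler_nat.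
  exact: leqnSn.
apply: (squeeze_cvgr _ (cvg_cst _) cd); apply: nearW => m.
rewrite normc_ge0 andTb f_E exprSr.
rewrite (_ : _ - _ = ((x ^+ n)%:C%C * expi (- (x * s))) *
    (c m * (expi (- (x * d m)) - 1) - x%:C%C)); last by rewrite rmorphM/=; ring.
rewrite !Normc.normcM normc_expi mulr1 nx// ler_wpM2l ?exprn_ge0 ?(ltW x0)//.
(* Subtracting x removes the linear term of the exponential. What remains is quadratic in d m, and
   of order d m after the division. *)
have -> : c m * (expi (- (x * d m)) - 1) - x%:C%C =
    c m * Complex (cos (x * d m) - 1) (- (sin (x * d m) - x * d m)).
  rewrite /expi cosN sinN /c; apply/eqP; rewrite eq_complex /=; apply/andP; split; apply/eqP.
    by field; rewrite gt_eqF.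
  by field; rewrite gt_eqF.
rewrite Normc.normcM nc.
have h : normc (Complex (cos (x * d m) - 1) (- (sin (x * d m) - x * d m))) <= 2 * (x * d m) ^+ 2.
  apply: (le_trans (normc_le_Re_Im _)); rewrite mulr_natl mulr2n /= normrN.
  by apply: lerD; [exact: normr_cos_sub1_le_sqr|exact: normr_sinB_le_sqr].
have di : 0 <= (d m)^-1 by rewrite invr_ge0 ltW.
apply: (le_trans (ler_wpM2l di h)).
rewrite (_ : (d m)^-1 * _ = 2 * x ^+ 2 * d m)//.
by field; rewrite gt_eqF.
Qed.

End density.

(** * From monomial weights to all square integrable functions *)

Section density_real.
Context {R : realType}.
Variables (w : R) (w0 : 0 < w).
Local Notation I := ([set` `]0, w[] : set (measurableTypeR R)).
Local Notation itv := (interval_measure 0 w).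
Variable S : set (L2 itv).
Hypothesis S0 : S 0.
Hypothesis S_comb : forall (a : R[i]) u v, S u -> S v -> S (a *: u + v).
Variable s : R.
Hypothesis S_monomial : forall n, in_closure S (fun x => (x ^+ n)%:C%C * expi (- (x * s))).
Implicit Types (h : measurableTypeR R -> R) (Y : set (measurableTypeR R)).

Let mI : measurable I := measurable_itv `]0, w[.

Let ae_itv (Q : measurableTypeR R -> Prop) : (forall x, I x -> Q x) -> \forall x \ae itv, Q x.
Proof. by move=> h; apply/ae_mrestr; exact: aeW. Qed.

Let I_gt0_lt x : I x -> 0 < x < w.
Proof. by rewrite /= in_itv. Qed.

Let measurable_e : cmeasurable_fun setT (fun x : measurableTypeR R => expi (- (x * s))).
Proof. by apply: cmeasurable_fun_expi; apply: measurable_funN; exact: measurable_funM. Qed.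

Let measurable_mul_e h : measurable_fun setT h ->
  cmeasurable_fun setT (fun x => (h x)%:C%C * expi (- (x * s))).
Proof. by move=> mh; apply: cmeasurable_funM => //; exact: cmeasurable_fun_real. Qed.

(** The exponential with the fixed [s] has modulus one, so bounds and limits for the weighted
    functions are those of the real weight [h]. *)
Definition in_closure_weight h : Prop :=
  measurable_fun setT h /\ in_closure S (fun x => (h x)%:C%C * expi (- (x * s))).

Local Notation W := in_closure_weight.

Let normc_mul_e (r x : R) : normc (r%:C%C * expi (- (x * s))) = `|r|.
Proof. by rewrite Normc.normcM normc_expi mulr1 /= expr0n addr0 sqrtr_sqr. Qed.

Lemma in_closure_weight_comb (c : R) h1 h2 : W h1 -> W h2 -> W (fun x => c * h1 x + h2 x).
Proof.
move=> [m1 c1] [m2 c2].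
have m12 : measurable_fun setT (fun x => c * h1 x + h2 x).
  by apply: measurable_funD => //; exact: measurable_funM.
split => //.
apply: (ae_eq_in_closure (in_closure_comb S_comb c%:C%C c1 c2)).
  exact: measurable_mul_e.
by move=> x _; rewrite rmorphD rmorphM mulrDl mulrA.
Qed.

Lemma eq_in_closure_weight h1 h2 : W h1 -> measurable_fun setT h2 ->
  (forall x, I x -> h1 x = h2 x) -> W h2.
Proof.
move=> [m1 c1] m2 h12; split => //; apply: (ae_eq_in_closure c1).
  exact: measurable_mul_e.
by move=> x Ix; rewrite h12.
Qed.

Lemma in_closure_weight_monomial n : W (fun x => x ^+ n).
Proof. by split; [exact: measurable_funX|exact: S_monomial]. Qed.

Lemma in_closure_weight0 : W (fun=> 0).
Proof.
have h := in_closure_weight_monomial 0.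
have := in_closure_weight_comb (-1) h h; congr W; apply/funext => x.
by rewrite mulN1r addNr.
Qed.

Lemma in_closure_weight1 : W (fun=> 1).
Proof. exact: (in_closure_weight_monomial 0). Qed.

Lemma in_closure_weight_sum n (h_ : nat -> measurableTypeR R -> R) (c : nat -> R) :
  (forall i, W (h_ i)) -> W (fun x => \sum_(i < n) c i * h_ i x).
Proof.
move=> Wh; elim: n => [|n IH].
  by under eq_fun do rewrite big_ord0; exact: in_closure_weight0.
under eq_fun do rewrite big_ord_recr/= addrC.
exact: in_closure_weight_comb.
Qed.

Lemma in_closure_weight_poly (p : {poly R}) : W (fun x => p.[x]).
Proof.
under eq_fun do rewrite horner_coef.
exact: (@in_closure_weight_sum (size p) (fun n x => x ^+ n) (fun i => p`_i)
  in_closure_weight_monomial).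
Qed.

Lemma in_closure_weight_dominated (h_ : (measurableTypeR R -> R)^nat) h
    (G : measurableTypeR R -> R) :
  (forall n, W (h_ n)) -> measurable_fun setT h ->
  itv.-integrable setT (fun x => (G x ^+ 2)%:E) ->
  (forall n x, I x -> `|h_ n x| <= G x) ->
  (forall x, I x -> `|h x| <= G x) ->
  (\forall x \ae itv, h_ n x @[n --> \oo] --> h x) -> W h.
Proof.
move=> Wh mh IG hG hG' h_h; split => //.
apply: (in_closure_dominated (f_ := fun n x => (h_ n x)%:C%C * expi (- (x * s))) (h := G)) => //.
- by move=> n; exact: (Wh n).2.
- exact: measurable_mul_e.
- by move=> n x Ix; rewrite normc_mul_e; exact: hG.
- by move=> x Ix; rewrite normc_mul_e; exact: hG'.
apply: filterS h_h => x h_hx.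
rewrite (_ : (fun n => _) = fun n => `|h_ n x - h x|); last first.
  by apply/funext => n; rewrite -mulrBl -rmorphB normc_mul_e.
by apply/norm_cvg0P; rewrite -(subrr (h x)); apply: cvgB => //; exact: cvg_cst.
Qed.

Lemma in_closure_weight_bounded (h_ : (measurableTypeR R -> R)^nat) h (c : R) :
  (forall n, W (h_ n)) -> measurable_fun setT h ->
  (forall n x, I x -> `|h_ n x| <= c) -> (forall x, I x -> `|h x| <= c) ->
  (\forall x \ae itv, h_ n x @[n --> \oo] --> h x) -> W h.
Proof.
move=> Wh mh hc hc' h_h.
exact: (in_closure_weight_dominated (G := fun=> c) Wh mh (integrable_itv_cst w c)).
Qed.

(** Outside [[0, w[] the threshold makes the indicator constant on [I]; inside, the step polynomials
    are rescaled. *)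
Lemma in_closure_weight_ray (t : R) : W (\1_(`]-oo, t[ : set (measurableTypeR R))).
Proof.
have mray : measurable (`]-oo, t[ : set (measurableTypeR R)) by exact: measurable_itv.
have m1 : measurable_fun setT (\1_(`]-oo, t[ : set (measurableTypeR R)) : _ -> R).
  exact: measurable_indic.
have rayE (x : R) : \1_(`]-oo, t[ : set (measurableTypeR R)) x = (x < t)%R%:R :> R.
  rewrite indicE; have [xt|xt] := ltP x t.
    by rewrite mem_set//= in_itv.
  by rewrite memNset//= in_itv/= ltNge xt.
have [t0|t0] := ltP t 0.
  apply: (eq_in_closure_weight in_closure_weight0) => // x /I_gt0_lt/andP[x0 xw].
  by rewrite rayE ltNge ltW// (lt_trans t0).
have [tw|tw] := leP w t.
  apply: (eq_in_closure_weight in_closure_weight1) => // x /I_gt0_lt/andP[x0 xw].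
  by rewrite rayE (lt_le_trans xw).
(* Affine map sending [t] to the threshold 1/2 and, since [x - t] lies between [- w] and [w], the
   interval into [[0, 1]]. *)
pose l (x : R) := 2^-1 + (x - t) / (2 * w).
pose p n : {poly R} := (1 - ((2^-1 - t / (2 * w))%:P + (2 * w)^-1 *: 'X) ^+ n) ^+ (2 ^ n).
have pE n x : (p n).[x] = (1 - (l x) ^+ n) ^+ (2 ^ n).
  rewrite /p !hornerE; congr ((1 - _ ^+ _) ^+ _); rewrite /l; ring.
have l01 x : I x -> 0 <= l x <= 1.
  move=> /I_gt0_lt/andP[x0 xw]; rewrite /l; apply/andP; split.
    rewrite -[leLHS](subrr 2^-1) lerD2l lerNl -mulNr ler_pdivrMr ?mulr_gt0//; lra.
  rewrite [leRHS](splitr 1) div1r lerD2l ler_pdivrMr ?mulr_gt0//; lra.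
have lt2 x : (l x < 2^-1) = (x < t).
  by rewrite /l gtrDl pmulr_llt0 ?invr_gt0 ?mulr_gt0// subr_lt0.
apply: (in_closure_weight_bounded (h_ := fun n x => (p n).[x]) (c := 1)) => //.
- by move=> n; exact: in_closure_weight_poly.
- move=> n x /l01/andP[l0 l1]; rewrite pE.
  have ln : 0 <= l x ^+ n <= 1 by rewrite exprn_ge0// exprn_ile1.
  have /andP[ln0 ln1] := ln.
  by rewrite ger0_norm ?exprn_ge0 ?subr_ge0// exprn_ile1 ?subr_ge0// gerBl.
- by move=> x _; rewrite rayE; case: ltP; rewrite ?normr1 ?normr0.
(* Convergence fails only at the jump, a single point. *)
apply/ae_mrestr; exists [set t]; split.
- exact: measurable_set1.
- exact: lebesgue_measure_set1.
move=> x /= /not_implyP[Ix ncv]; apply: contrapT => /eqP xt; apply: ncv.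
rewrite rayE -lt2; under eq_fun do rewrite pE.
apply: cvg_step_polynomial; first exact: l01.
apply: contra xt => /eqP; rewrite /l => /(canRL (addKr _)); rewrite addNr => /eqP.
by rewrite mulf_eq0 invr_eq0 mulf_eq0 pnatr_eq0 (gt_eqF w0) !orbF subr_eq0.
Qed.

(** Rays are stable under intersection and generate the Borel sets. Complements come from
    subtracting from 1, and disjoint unions from bounded convergence of partial sums. *)
Lemma in_closure_weight_indic Y : measurable Y -> W (\1_Y : _ -> R).
Proof.
move=> mY; have mYs : <<s @RGenInftyO.G R >> Y.
  by have := mY; rewrite [X in X _ -> _]RGenInftyO.measurableE.
move: mYs; apply: (@dynkin_induction _ (measurableTypeR R) (@RGenInftyO.G R)
  (fun Y => W (\1_Y : _ -> R))).
- exact: RGenInftyO.measurableE.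
- move=> _ _ [x ->] [y ->]; exists (Num.min x y).
  by apply/seteqP; split => z /=; rewrite !in_itv/= lt_min => /andP.
- by rewrite (_ : \1_setT = fun=> 1) ?indicT//; exact: in_closure_weight1.
- by move=> _ [x ->]; exact: in_closure_weight_ray.
- move=> A mA WA; have := in_closure_weight_comb (-1) WA in_closure_weight1.
  congr W; apply/funext => x; rewrite !indicE in_setC mulN1r addrC.
  by case: (x \in A); rewrite ?subrr ?subr0.
move=> F mF tF WF.
have mUF : measurable (\bigcup_k F k) by exact: bigcupT_measurable.
have m1 : measurable_fun setT (\1_(\bigcup_k F k) : measurableTypeR R -> R).
  exact: measurable_indic.
pose g n (x : measurableTypeR R) : R := \sum_(i < n) 1 * \1_(F i) x.
(* By disjointness only the k-th term is nonzero at [x], so the partial sum jumps from 0 to 1 when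
   [n] passes [k]. *)
have gin k x : F k x -> forall n, g n x = (k < n)%N%:R.
  move=> Fkx; elim=> [|n IH]; first by rewrite /g big_ord0.
  rewrite /g big_ord_recr/= -/(g n x) IH mul1r indicE [in RHS]ltnS (leq_eqVlt k n).
  have [<-|kn] := eqVneq k n; first by rewrite ltnn add0r mem_set.
  rewrite memNset ?addr0 //= ?(negbTE kn)// => Fnx.
  move/trivIsetP : tF => /(_ k n Logic.I Logic.I kn)/seteqP[+ _] => /(_ x); exact.
have gout x : ~ (\bigcup_k F k) x -> forall n, g n x = 0.
  move=> nF n; rewrite /g big1// => i _; rewrite indicE memNset ?mulr0//.
  by move=> Fix_; apply: nF; exists i.
have g01 n x : `|g n x| <= 1.
  have [[k _ Fkx]|nF] := pselect ((\bigcup_k F k) x).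
    by rewrite (gin k)//; case: (k < n)%N; rewrite ?normr1 ?normr0.
  by rewrite gout// normr0.
apply: (in_closure_weight_bounded (h_ := g) (c := 1)) => //.
- by move=> n; exact: (@in_closure_weight_sum n (fun i => \1_(F i)) (fun=> 1)).
- by move=> x _; rewrite indicE; case: (_ \in _); rewrite ?normr1 ?normr0.
apply: ae_itv => x _; rewrite indicE.
have [[k _ Fkx]|nF] := pselect ((\bigcup_k F k) x).
  rewrite mem_set; last by exists k.
  apply: cvg_near_cst; exists k.+1 => // n /= kn.
  by rewrite (gin k)// kn.
rewrite memNset//; apply: cvg_near_cst; apply: nearW => n; exact: gout.
Qed.

Import HBNNSimple.

(** Increasing simple functions converge to [h] from below, hence are dominated by [G]; being finite
    sums of indicators, they are admissible weights. *)
Lemma in_closure_weight_nonneg h (G : measurableTypeR R -> R) : measurable_fun setT h ->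
  (forall x, 0 <= h x) -> itv.-integrable setT (fun x => (G x ^+ 2)%:E) ->
  (forall x, h x <= G x) -> W h.
Proof.
move=> mh h0 IG hG.
have mh' : measurable_fun setT (EFin \o h) by exact/measurable_EFinP.
pose g := nnsfun_approx measurableT mh'.
have h0' x : setT x -> (0 <= (EFin \o h) x)%E by move=> _; rewrite lee_fin.
have cg x : g n x @[n --> \oo] --> h x.
  have /fine_cvgP[_] := cvg_nnsfun_approx measurableT mh' h0' (Logic.I : setT x).
  exact.
have gh n x : g n x <= h x.
  have := le_approx n h0' (Logic.I : setT x).
  by rewrite -(nnsfun_approxE measurableT mh') lee_fin.
apply: (in_closure_weight_dominated (h_ := fun n => g n) (G := G)) => //.
- move=> n; pose s' : seq R := finmap.enum_fset (fset_set (range (g n))).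
  rewrite (_ : (g n : _ -> R) = fun x =>
      \sum_(i < size s') s'`_i * \1_(g n @^-1` [set s'`_i]) x); last first.
    by apply/funext => x; exact: fimfunEord.
  apply: (@in_closure_weight_sum _ (fun i => \1_(g n @^-1` [set s'`_i]))) => i.
  exact: in_closure_weight_indic.
- by move=> n x _; rewrite ger0_norm// (le_trans (gh n x)).
- by move=> x _; rewrite ger0_norm.
by apply: ae_itv => x _; exact: cg.
Qed.

(** The exponential is divided out of [f], the real and imaginary parts of the quotient are split
    into positive and negative parts, and each is dominated by the modulus of [f]. Multiplying back
    recovers [f]. *)
Lemma closure_monomials_setT (u : L2 itv) : closure S u.
Proof.
have uL := in_L2_fun u; set f := L2_fun u in uL.
have [mf If] := (in_L2P _ _).1 uL.
pose g x := f x * expi (x * s).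
have mg : cmeasurable_fun setT g.
  apply: cmeasurable_funM => //.
  by apply: cmeasurable_fun_expi; exact: measurable_funM.
have ng x : normc (g x) = cmod f x by rewrite Normc.normcM normc_expi mulr1.
have pos (h : measurableTypeR R -> R) : measurable_fun setT h ->
    (forall x, `|h x| <= cmod f x) -> W h.
  move=> mh hf.
  have Wp : W (fun x => Num.max (h x) 0).
    apply: (in_closure_weight_nonneg (G := cmod f)) => //.
    - exact: measurable_maxr.
    - by move=> x; rewrite le_max lexx orbT.
    - by move=> x; rewrite ge_max normc_ge0 andbT (le_trans (ler_norm _)).
  have Wn : W (fun x => Num.max (- h x) 0).
    apply: (in_closure_weight_nonneg (G := cmod f)) => //.
    - by apply: measurable_maxr => //; exact: measurable_funN.
    - by move=> x; rewrite le_max lexx orbT.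
    - by move=> x; rewrite ge_max normc_ge0 andbT (le_trans (ler_norm _))// normrN.
  have := in_closure_weight_comb (-1) Wn Wp; congr W; apply/funext => x.
  by case: (leP (h x) 0) => hx; [rewrite max_l ?oppr_ge0//; lra|rewrite max_r ?oppr_le0 ?ltW//; lra].
have [_ cr] : W (fun x => Re (g x)).
  by apply: pos => [|x]; [exact: mg.1|rewrite -ng; exact: normr_Re_le_normc].
have [_ ci] : W (fun x => Im (g x)).
  by apply: pos => [|x]; [exact: mg.2|rewrite -ng; exact: normr_Im_le_normc].
have fE x : I x -> Complex 0 1 * ((Im (g x))%:C%C * expi (- (x * s))) +
    (Re (g x))%:C%C * expi (- (x * s)) = f x.
  move=> _; transitivity (g x * expi (- (x * s))); last first.
    by rewrite /g -mulrA -expiD subrr expi0 mulr1.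
  rewrite mulrA -mulrDl; congr (_ * _).
  case: (g x) => p q; apply/eqP; rewrite eq_complex /=.
  by apply/andP; split; apply/eqP; ring.
have [_] := ae_eq_in_closure (in_closure_comb S_comb (Complex 0 1) ci cr) mf fE.
by rewrite L2_classK.
Qed.

End density_real.

(** * The range of the far-field operator *)

Section far_field_range.
Context {R : realType} {d : nat}.
Variables (D : set 'rV[R]_d) (oD : open D) (bD : bounded_set D) (t1 t2 : R).
Variables (xhat : 'rV[R]_d) (w : R) (w0 : 0 < w).

Local Notation leb := (@lebesgue_measure R).
Local Notation lebd := (@lebesgue_rV R d).
Local Notation J := ([set` `[t1, t2]] : set (measurableTypeR R)).
Local Notation P := (D `*` `[t1, t2] : set ('rV[R]_d * measurableTypeR R)).
Local Notation mu := (sigma_finite_product lebd leb).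
Local Notation cyl := (cylinder_measure oD t1 t2).
Local Notation I := ([set` `]0, w[] : set (measurableTypeR R)).
Local Notation itv := (interval_measure 0 w).
Local Notation k := (far_field_kernel xhat).
Local Notation A := (integral_operator mu P k).
Local Notation L := (L2_operator cyl itv (far_field_L D t1 t2 xhat)).

Let mI : measurable I := measurable_itv `]0, w[.
Let mP : measurable P := measurable_cylinder t1 t2 oD.
Let muP : (mu P < +oo)%E := cylinder_lty oD bD t1 t2.
Let nuI : (leb I < +oo)%E := leb_itv_lty false true 0 w.
Let mk := cmeasurable_far_field_kernel xhat.
Let k1 := normc_far_field_kernel xhat.

Lemma normr_dotv_le (v : 'rV[R]_d) (M : R) : (forall i, `|v ord0 i| <= M) ->
  `|dotv xhat v| <= (\sum_i `|xhat ord0 i|) * M.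
Proof.
move=> vM; rewrite mulr_suml; apply: (le_trans (ler_norm_sum _ _ _)).
by apply: ler_sum => i _; rewrite normrM ler_wpM2l.
Qed.

Lemma phase_bounded : exists2 C : R, 0 <= C & forall p, P p -> `|phase xhat p| <= C.
Proof.
have [M M0 DM] := bounded_set_coord bD.
exists ((\sum_i `|xhat ord0 i|) * M + (`|t1| + `|t2|)).
  by rewrite addr_ge0 ?mulr_ge0 ?sumr_ge0// addr_ge0.
move=> [y t] [/= Dy]; rewrite in_itv/= => /andP[tt1 tt2].
apply: (le_trans (ler_normB _ _)); apply: lerD.
  exact/normr_dotv_le/DM.
rewrite /= ler_norml; apply/andP; split.
  rewrite lerNl; apply: (@le_trans _ _ (- t1)); first by rewrite lerN2.
  by apply: (@le_trans _ _ `|t1|); [rewrite -normrN ler_norm|rewrite lerDl].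
by apply: (le_trans tt2); apply: (@le_trans _ _ `|t2|); [exact: ler_norm|rewrite lerDr].
Qed.

Lemma far_field_kernel_lipschitz : exists2 C : R, 0 <= C &
  forall x y p, P p -> normc (k (x, p) - k (y, p)) <= C * `|x - y|.
Proof.
have [C C0 hC] := phase_bounded; exists (2 * C); first by rewrite mulr_ge0.
move=> x y p /hC Cp; apply: (le_trans (normc_expiB_le _ _)) => /=.
rewrite -opprD normrN -mulrBl normrM [ `|x - y| * _]mulrC mulrA ler_wpM2r//.
by rewrite ler_wpM2l.
Qed.

Lemma compact_far_field_L : compact_operator L.
Proof.
have [C C0 kL] := far_field_kernel_lipschitz.
rewrite far_field_L_operatorE//.
exact: (@compact_L2_integral_operator _ _ _ mu P mP muP w w0 k mk k1 C C0 kL).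
Qed.

Lemma phase_dist (p q : 'rV[R]_d * measurableTypeR R) (e : R) :
  (forall i, `|p.1 ord0 i - q.1 ord0 i| <= e) -> `|p.2 - q.2| <= e ->
  `|phase xhat p - phase xhat q| <= (\sum_i `|xhat ord0 i| + 1) * e.
Proof.
move=> h1 h2.
have -> : phase xhat p - phase xhat q = dotv xhat (p.1 - q.1) - (p.2 - q.2).
  rewrite /phase; have -> : dotv xhat (p.1 - q.1) = dotv xhat p.1 - dotv xhat q.1.
    rewrite /dotv -sumrB; apply: eq_bigr => i _.
    by rewrite !mxE mulrBr.
  by ring.
apply: (le_trans (ler_normB _ _)); rewrite mulrDl mul1r; apply: lerD => //.
by apply: normr_dotv_le => i; rewrite !mxE.
Qed.

(** Only the closeness of its points to [(y, t)] matters for the averages, so that point may be a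
    corner; the volume is then [e ^+ d * e]. *)
Definition corner_box (y : 'rV[R]_d) (t e : R) : set ('rV[R]_d * measurableTypeR R) :=
  [set v : 'rV[R]_d | forall i, v ord0 i \in `[y ord0 i, (y + const_mx e) ord0 i]] `*`
  [set` `[t, t + e]].

Lemma measurable_corner_box y t e : measurable (corner_box y t e).
Proof. by apply: measurableX; [exact: measurable_rV_box|exact: measurable_itv]. Qed.

Lemma corner_box_measure y t e : 0 < e -> mu (corner_box y t e) = (e ^+ d * e)%:E.
Proof.
move=> e0; rewrite /sigma_finite_product product_measure1E; last 2 first.
- exact: measurable_rV_box.
- exact: measurable_itv.
rewrite EFinM; congr (_ * _)%E.
  transitivity (\prod_(i < d) ((y + const_mx e) ord0 i - y ord0 i))%:E.
    by apply: lebesgue_rV_box => i; rewrite !mxE lerDl ltW.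
  under eq_bigr do rewrite !mxE addrAC subrr add0r.
  by rewrite prodr_const card_ord.
have h : @lebesgue_measure R `[t, t + e]%classic = e%:E.
  by rewrite lebesgue_measure_itv/= lte_fin ltrDl e0 -EFinB addrAC subrr add0r.
exact: h.
Qed.

Lemma corner_box_sub y t : D y -> t1 < t < t2 -> exists2 e : R, 0 < e &
  forall r, 0 < r <= e -> corner_box y t r `<=` P.
Proof.
move=> Dy /andP[t1t tt2].
have /nbhs_ballP[e /= e0 eD] : nbhs y D by exact: open_nbhs_nbhs.
have t20 : 0 < t2 - t by rewrite subr_gt0.
(* The box is closed while the ball in [D] is open, hence [e / 2]; [t2 - t] keeps the time side
   within the cylinder. *)
exists (Num.min (e / 2) (t2 - t)); first by rewrite lt_min t20 divr_gt0.
move=> r; rewrite le_min => /andP[r0 /andP[re rt]] [v x] [/= vB].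
rewrite in_itv/= => /andP[tx xr]; split => /=.
  apply: eD; split => // i j; rewrite (ord1 i) /ball/=.
  have := vB j; rewrite in_itv/= !mxE => /andP[h1 h2].
  rewrite distrC ger0_norm ?subr_ge0//; apply: (@le_lt_trans _ _ r); first lra.
  by apply: (le_lt_trans re); rewrite ltr_pdivrMr// ltr_pMr// ltr1n.
by rewrite in_itv/=; apply/andP; split; lra.
Qed.

Lemma phase_corner_box y t e p : corner_box y t e p ->
  `|phase xhat p - phase xhat (y, t)| <= (\sum_i `|xhat ord0 i| + 1) * e.
Proof.
move=> [/= h1]; rewrite in_itv/= => /andP[h2 h3]; apply: phase_dist => /=.
  move=> i; have := h1 i; rewrite in_itv/= !mxE => /andP[h4 h5].
  by rewrite ger0_norm ?subr_ge0//; lra.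
by rewrite ger0_norm ?subr_ge0//; lra.
Qed.

(* an approximate Dirac mass at [(y, t)] *)
Definition box_average y t e (p : 'rV[R]_d * measurableTypeR R) : R[i] :=
  ((e ^+ d * e)^-1 * \1_(corner_box y t e) p)%:C%C.

Section box_average.
Variables (y : 'rV[R]_d) (t e : R).
Hypotheses (e0 : 0 < e) (eP : corner_box y t e `<=` P).
Local Notation E := (corner_box y t e).
Local Notation u := (box_average y t e).
Let m0 : 0 < e ^+ d * e. Proof. by rewrite mulr_gt0// exprn_gt0. Qed.

Lemma cmeasurable_box_average : cmeasurable_fun setT u.
Proof.
apply: cmeasurable_fun_real; apply: measurable_funM => //.
by apply: measurable_indic; exact: measurable_corner_box.
Qed.

Lemma cmod_box_average p : cmod u p = (e ^+ d * e)^-1 * \1_E p.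
Proof.
rewrite /cmod /= expr0n addr0 sqrtr_sqr ger0_norm// mulr_ge0//.
by rewrite invr_ge0 ltW.
Qed.

Lemma in_L2_box_average : in_L2 cyl u.
Proof.
apply: (@in_L2_restr_bounded _ _ _ mu P mP muP u (e ^+ d * e)^-1).
  exact: cmeasurable_box_average.
move=> p _; rewrite -[normc _]/(cmod u p) cmod_box_average ler_piMr//.
  by rewrite invr_ge0 ltW.
Qed.

Lemma cintegrable_box_average : cintegrable mu P u.
Proof. exact: (in_L2_cintegrable muP in_L2_box_average). Qed.

Let integral_weight : \int[mu]_(p in P) ((e ^+ d * e)^-1 * \1_E p) = 1.
Proof.
have mE := measurable_corner_box y t e.
rewrite RintegralZl//; last first.
  apply: (le_integrable mP _ _ (integrable_cst_lty mP muP 1)).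
    by apply/measurable_EFinP/measurable_funTS; exact: measurable_indic.
  by move=> p _; rewrite /= lee_fin normr1 indicE; case: (_ \in _); rewrite ?normr1 ?normr0.
rewrite [X in _ * X](_ : _ = e ^+ d * e); first by rewrite mulVf// gt_eqF.
transitivity (fine (mu E)); last exact: (congr1 fine (corner_box_measure y t e0)).
by congr fine; rewrite integral_indic//; congr (mu _); exact: setIidl.
Qed.

Lemma integral_cmod_box_average : \int[mu]_(p in P) cmod u p = 1.
Proof. by rewrite -integral_weight; apply: eq_Rintegral => p _; rewrite cmod_box_average. Qed.

Lemma cintegral_box_average : cintegral mu P u = 1.
Proof. by rewrite /cintegral /= integral_weight Rintegral_cst// mul0r. Qed.

(** As [u] has integral 1, the difference is an average of kernel differences over the box, where
    the phase varies by a multiple of [e]. One factor 2 comes from the exponential, the other from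
    the complex integral. *)
Lemma box_average_kernel (x : R) :
  normc (A u x - expi (- (x * phase xhat (y, t)))) <=
  2 * (2 * (`|x| * ((\sum_i `|xhat ord0 i| + 1) * e))).
Proof.
have Iu := cintegrable_box_average.
have Ix := cintegrable_kernel_mul mP mk k1 x Iu.
have IxN := cintegrableZl mP (- expi (- (x * phase xhat (y, t)))) Iu.
have -> : A u x - expi (- (x * phase xhat (y, t))) =
    cintegral mu P (fun p => k (x, p) * u p + (- expi (- (x * phase xhat (y, t)))) * u p).
  by rewrite cintegralD// cintegralZl// cintegral_box_average mulr1.
pose c := 2 * (`|x| * ((\sum_i `|xhat ord0 i| + 1) * e)); have Ic := cintegrable_cmod mP Iu.
have Icz : mu.-integrable P (EFin \o (fun p => c * cmod u p)).
  exact: (integrableZl mP c Ic).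
apply: (le_trans (normc_cintegral_le_bound mP (cintegrableD mP Ix IxN) Icz _)).
  move=> p Pp; rewrite -mulrDl Normc.normcM.
  have [Ep|nEp] := pselect (E p); last first.
    by rewrite -[normc (u p)]/(cmod u p) cmod_box_average indicE memNset// !mulr0.
  rewrite ler_wpM2r ?normc_ge0//; apply: (le_trans (normc_expiB_le _ _)) => /=.
  rewrite /c ler_wpM2l// -opprD normrN -mulrBr normrM ler_wpM2l//.
  exact: phase_corner_box.
by rewrite RintegralZl// integral_cmod_box_average mulr1.
Qed.

End box_average.

(** The time [t = dotv xhat y - s] is interior to the time interval, and the phase at [(y, t)] is
    exactly [s]. Averages over boxes shrinking to this point are mapped to functions converging
    boundedly to the exponential. *)
Lemma in_closure_range_expi y s : D y ->
  dotv xhat y - t2 < s < dotv xhat y - t1 ->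
  in_closure (range L) (fun x => expi (- (x * s))).
Proof.
move=> Dy /andP[s1 s2]; pose t := dotv xhat y - s.
have tt : t1 < t < t2 by rewrite /t; apply/andP; split; lra.
have [r r0 rP] := corner_box_sub Dy tt.
pose e n : R := r / n.+1%:R.
have e0 n : 0 < e n by rewrite divr_gt0.
have er n : 0 < e n <= r by rewrite e0 ler_pdivrMr// ler_pMr// ler1n.
have pt : phase xhat (y, t) = s by rewrite /phase /t /=; ring.
have LwD := far_field_L_well_defined oD bD t1 t2 xhat w.
have AE n : far_field_L D t1 t2 xhat (box_average y t (e n)) = A (box_average y t (e n)).
  by rewrite far_field_LE//; exact: cintegrable_box_average.
(* The bound 2 is twice the L1 norm of an average, which equals 1. *)
apply: (in_closure_bounded (f_ := fun n => A (box_average y t (e n))) (c := 2)).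
- move=> n; have uL := in_L2_box_average y t (e0 n); rewrite -AE; split; first exact: LwD.1.
  apply: subset_closure.
  exact: (ex_intro2 _ _ (L2_class cyl (box_average y t (e n))) Logic.I (L2_operator_class LwD uL)).
- by apply: cmeasurable_fun_expi; apply: measurable_funN; exact: measurable_funM.
- move=> n x _; have Iu := cintegrable_box_average y t (e0 n).
  apply: (le_trans (normc_integral_operator_le mP mk k1 x Iu)).
  by rewrite (integral_cmod_box_average (e0 n) (rP _ (er n))) mulr1.
- by move=> x _; rewrite normc_expi ler1n.
apply: aeW => x.
have cd : 2 * (2 * (`|x| * ((\sum_i `|xhat ord0 i| + 1) * e n))) @[n --> \oo] --> (0 : R).
  pose c := 2 * (2 * (`|x| * ((\sum_i `|xhat ord0 i| + 1) * r))).
  rewrite (_ : (fun n => _) = fun n => c * n.+1%:R^-1); last first.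
    by apply/funext => n; rewrite /c /e !mulrA.
  rewrite -[X in _ --> X](mulr0 c); apply: cvgM; first exact: cvg_cst.
  exact: cvg_harmonic.
apply: (squeeze_cvgr _ (cvg_cst _) cd); apply: nearW => n.
by rewrite normc_ge0 -pt; exact: (box_average_kernel (e0 n) (rP _ (er n))).
Qed.

Lemma dense_range_far_field_L : D !=set0 -> t1 < t2 -> dense (range L).
Proof.
move=> [y Dy] t12.
have linL : linear L := compact_far_field_L.1.
have S0 : range L 0.
  exists 0 => //; have := linL (-1) 0 0.
  by rewrite scaler0 addr0 scaleN1r addNr.
have S_comb (a : R[i]) u v : range L u -> range L v -> range L (a *: u + v).
  by move=> [u' _ <-] [v' _ <-]; exists (a *: u' + v'); [by []|exact: linL].
(* The midpoint in time; any [s] in the open interval would do. *)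
pose s := dotv xhat y - (t1 + t2) / 2.
have sab : dotv xhat y - t2 < s < dotv xhat y - t1.
  by rewrite /s; apply/andP; split; lra.
have mono n := in_closure_monomial w0 S0 S_comb
  (fun s' => in_closure_range_expi Dy (s := s')) n sab.
move=> O [v Ov] oO.
have cl : closure (range L) v by exact: (closure_monomials_setT w0 S_comb mono).
have [z [Sz Oz]] := cl _ (open_nbhs_nbhs (conj oO Ov)).
by exists z.
Qed.

End far_field_range.

Theorem proposition2p1 (R : realType) (d : nat) (hd : d = 2%N \/ d = 3%N)
    (D : set 'rV[R]_d) (hD : bounded_lipschitz_domain D)
    (hDc : connected (~` D))
    (t1 t2 : R) (ht1 : 0 < t1) (ht2 : t1 < t2)
    (xhat : 'rV[R]_d) (hxhat : unit_sphere xhat)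
    (k0 : R) (hk0 : 0 < k0)
    (taumin taumax : R) (htau : taumin < taumax)
    (F : R -> R) (mF : measurable_fun setT F)
    (K : 'rV[R]_d * R -> R) (mK : measurable_fun setT K)
    (suppK : closure [set p | K p != 0] `<=` closure (D `*` `[t1, t2])) :
  let tauc := (taumin + taumax) / 2 in
  let tauw := (taumax - taumin) / 2 in
  let cyl := cylinder_measure (bld_open hD) t1 t2 in
  let itv := interval_measure 0 tauw in
  forall hFK : (ess_sup cyl (fun p =>
      \int[lebesgue_measure]_(s in `[t1, t2]) `|kernel_FKK F K p.1 p.2 s|%:E)
      < +oo)%E,
  let phiF := far_field_correlation D t1 t2 F K xhat k0 tauc tauw in
  let phiL := far_field_L D t1 t2 xhat in
  let phiT := far_field_T t1 t2 F K xhat k0 tauc in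
  let opF : L2 itv -> L2 itv := L2_operator itv itv phiF in
  let opL : L2 cyl -> L2 itv := L2_operator cyl itv phiL in
  let opT : L2 cyl -> L2 cyl := L2_operator cyl cyl phiT in
  [/\ [/\ L2_well_defined itv itv phiF, L2_well_defined cyl itv phiL &
         L2_well_defined cyl cyl phiT],
      exists2 adjL : L2 itv -> L2 cyl,
        is_adjoint opL adjL & opF = opL \o opT \o adjL,
      compact_operator opL &
      dense (range opL)].
Proof.
move=> tauc tauw cyl itv hFK phiF phiL phiT opF opL opT.
have w0 : 0 < tauw by rewrite divr_gt0// subr_gt0.
have bD := bld_bounded hD.
split.
- split.
  + exact: (far_field_correlation_well_defined bD xhat mF mK hFK k0 tauc tauw).
  + exact: (far_field_L_well_defined (bld_open hD) bD t1 t2 xhat tauw).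
  + exact: (far_field_T_well_defined xhat mF mK hFK k0 tauc).
(* The adjoint sends phi to the integral over gamma of exp (i gamma (xhat . y - t)) phi (gamma). *)
- exists (L2_operator itv cyl (integral_operator lebesgue_measure [set` `]0, tauw[]
    (adjoint_kernel (far_field_kernel xhat)))).
    exact: (far_field_adjoint bD xhat).
  exact: (far_field_factorization bD xhat mF mK hFK k0 tauc tauw).
- exact: (compact_far_field_L (bld_open hD) bD t1 t2 xhat w0).
- exact: (dense_range_far_field_L (bld_open hD) bD xhat w0 (bld_nonempty hD) ht2).
Qed.
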